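(* Consider the integral equation $$\varphi(t,s,i,y)=\frac{1-F(T-t+y\mid i)}{1-F(y\mid i)}\eta_i(t,s)+\int_0^{T-t}e^{-r(i)v}\frac{f(y+v\mid i)}{1-F(y\mid i)}\sum_{j\neq i}p_{ij}(y+v)\int_0^\infty\varphi(t+v,x,j,0)\,\alpha(x;s,i,v)\,dx\,dv$$ with $\lim_{s\downarrow0}\varphi(t,s,i,y)=0$ for all $t\in[0,T]$, $i\in\mathcal{X}$, $y\in[0,t]$. Then: (i) this problem has a unique solution in $B$; (ii) the solution $\varphi$ of the integral equation is in $C^{1,2,1}(\mathcal{D})$; (iii) $\varphi(t,s,i,y)$ is nonnegative.
   Context: Fix $T>0$, $K>0$, a positive integer $k$, $\mathcal{X}=\{1,\dots,k\}$, and functions $r:\mathcal{X}\to[0,\infty)$, $\sigma:\mathcal{X}\to(0,\infty)$. For $i\ne j$ in $\mathcal{X}$ let $\lambda_{ij}:[0,\infty)\to(0,\infty)$, and set $\lambda_{ii}(y):=-\sum_{j\ne i}\lambda_{ij}(y)$, $\Lambda_i(y):=\int_0^y|\lambda_{ii}(v)|\,dv$, $F(y\mid i):=1-e^{-\Lambda_i(y)}$, $f(y\mid i):=\frac{d}{dy}F(y\mid i)$, $p_{ij}(y):=\lambda_{ij}(y)/|\lambda_{ii}(y)|$ for $j\neq i$, $p_{ii}(y):=0$, $\hat p_{ij}:=\int_0^\infty p_{ij}(y)\,dF(y\mid i)$. Standing assumption: (i) each $\lambda_{ij}$ is differentiable; (ii) $\lim_{y\to\infty}\Lambda_i(y)=\infty$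 for each $i$; (iii) the matrix $(\hat p_{ij})$ is irreducible. For each $i$, $\eta_i$ is the classical solution with at most linear growth in $s$ of the Black–Scholes–Merton problem $\frac{\partial\eta_i}{\partial t}+r(i)s\frac{\partial\eta_i}{\partial s}+\frac12\sigma^2(i)s^2\frac{\partial^2\eta_i}{\partial s^2}=r(i)\eta_i$ on $(0,T)\times(0,\infty)$, $\eta_i(T,s)=(s-K)^+$, $\lim_{s\downarrow0}\eta_i(t,s)=0$ for all $t\in[0,T]$. Moreover $$\alpha(x;s,i,v):=\frac{e^{-\frac12\beta^2}}{\sqrt{2\pi}\,x\,\sigma(i)\sqrt v},\qquad \beta=\beta(x,s,i,v):=\frac{\ln\left(\frac{x}{s}\right)-\left(r(i)-\frac{\sigma^2(i)}{2}\right)v}{\sigma(i)\sqrt v}.$$ Let $\mathcal{D}:=\{(t,s,i,y)\in(0,T)\times(0,\infty)\times\mathcal{X}\times(0,T): y\in(0,t)\}$ and $\overline{\mathcal{D}}:=\{(t,s,i,y): t\in[0,T],\ s\in(0,\infty),\ i\in\mathcal{X},\ y\in[0,t]\}$. Functions on $\mathcal{D}$ are understood to be continuous up to $\overline{\mathcal{D}}$, so that the values at $y=0$ and $t=T$ make sense. $B$ is the set of such continuous functions $\varphi$ with $\lim_{s\downarrow0}\varphi(\cdot,s,\cdot,\cdot)=0$ and $\|\varphi\|:=\sup_{\mathcal{D}}\left|\frac{\varphi(t,s,i,y)}{1+s}\right|<\infty$. $C^{1,2,1}(\mathcal{D})$ denotes functions which, for each $i$, are continuously differentiable in $t$, twice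 continuously differentiable in $s$ and continuously differentiable in $y$ on $\mathcal{D}$. *)

(* Defs.v *)
From HB Require Import structures.
From mathcomp Require Import all_boot all_order all_algebra.
From mathcomp Require Import all_classical all_reals all_analysis.

Set Implicit Arguments.
Unset Strict Implicit.
Unset Printing Implicit Defensive.
Import Order.TTheory GRing.Theory Num.Theory.
Import numFieldNormedType.Exports.

Local Open Scope classical_set_scope.
Local Open Scope ring_scope.

(* Differentiation of functions with domain [0, +oo[, one-sided at 0. Such a
   function is represented by a total one whose values on ]-oo, 0[ are
   irrelevant. *)
Section derivative_on_half_line.
Context {R : realType}.
Implicit Types (f : R -> R) (y : R).

Definition diff_quot f y (z : R) : R := (f z - f y) / (z - y).

Definition derivable_on_nng f y : Prop :=
  cvg (diff_quot f y @ within `[0, +oo[%classic y^').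

Definition deriv_on_nng f y : R :=
  lim (diff_quot f y @ within `[0, +oo[%classic y^').

End derivative_on_half_line.

(* Only the off-diagonal entries of [rate] are meaningful. *)
Record rates (R : realType) (k : nat) := Rates {
  rate :> 'I_k -> 'I_k -> R -> R ;
  rate_gt0 : forall i j y, i != j -> 0 <= y -> 0 < rate i j y ;
  rate_derivable : forall i j y, i != j -> 0 <= y ->
    derivable_on_nng (rate i j) y }.

Section holding_times.
Context {R : realType} {k : nat}.
Variable lam : rates R k.
Local Notation mu := (@lebesgue_measure R).
Implicit Types (i j : 'I_k) (y : R).

Definition diag_rate i y : R := - \sum_(j < k | j != i) lam i j y.

Definition cum_rate i y : R := \int[mu]_(v in `[0, y]) `|diag_rate i v|.

(* [cum_rate i] and [hold_cdf i] vanish on ]-oo, 0[. *)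
Definition hold_cdf i y : R := 1 - expR (- cum_rate i y).

Definition hold_pdf i y : R := deriv_on_nng (hold_cdf i) y.

Definition jump_prob i j y : R :=
  if j == i then 0 else lam i j y / `|diag_rate i y|.

Lemma derivable_on_nng_cvg (f : R -> R) y : derivable_on_nng f y ->
  f z @[z --> within `[0, +oo[%classic (nbhs y)] --> f y.
Proof.
move=> /cvg_ex[l fl].
have H : f z @[z --> within `[0, +oo[%classic y^'] --> f y.
  have -> : f y = f y + l * 0 by rewrite mulr0 addr0.
  apply: (@cvg_trans _
    ((f y + diff_quot f y z * (z - y)) @[z --> within `[0, +oo[%classic y^'])).
    apply: near_eq_cvg; near=> z.
    rewrite /diff_quot mulfVK ?subrKC// subr_eq0.
    by near: z; apply: filterS (nbhs_dnbhs_neq y) => z zy _; exact: zy.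
  apply: cvgD; first exact: cvg_cst.
  apply: cvgM; first exact: fl.
  rewrite -(subrr y); apply: cvgB; last exact: cvg_cst.
  apply: (cvg_trans _ (@cvg_id _ (nbhs y))).
  apply: cvg_trans; first exact: cvg_within.
  exact: cvg_within.
apply/cvgrPdist_lt => e e0.
move/cvgrPdist_lt : H => /(_ _ e0).
rewrite !near_withinE => H.
near=> z.
have [->|zy] := eqVneq z y; first by rewrite subrr normr0.
by move: zy; near: z; apply: filterS H => z h zy zD; exact: h.
Unshelve. all: by end_near. Qed.

Lemma diag_rate_continuous i b :
  {within `[0, b], continuous (fun v => `|diag_rate i v|)}.
Proof.
apply/subspace_continuousP => y /=; rewrite in_itv/= => /andP[y0 _].
apply: cvg_norm; apply: cvgN; apply: cvg_big => [|j ji]; first exact: add_continuous.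
rewrite eq_sym in ji.
move: (derivable_on_nng_cvg (@rate_derivable R k lam i j y ji y0)).
apply: cvg_trans; apply: cvg_app.
apply: within_subset => z /=; rewrite !in_itv/=.
by move=> /andP[->].
Qed.

Lemma diag_rate_integrable i b :
  mu.-integrable `[0, b] (EFin \o (fun v => `|diag_rate i v|)).
Proof.
apply: continuous_compact_integrable; first exact: segment_compact.
exact: diag_rate_continuous.
Qed.

Lemma hold_cdf_nondecreasing i : nondecreasing (hold_cdf i).
Proof.
move=> x y xy; rewrite /hold_cdf lerD2l lerN2 ler_expR lerN2 /cum_rate.
rewrite /Rintegral fine_le//.
- exact/integrable_fin_num/diag_rate_integrable.
- exact/integrable_fin_num/diag_rate_integrable.
apply: ge0_subset_integral => //=.
- exact: measurable_int (diag_rate_integrable i y).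
- by apply: subset_itvl; rewrite bnd_simp.
Qed.

Lemma hold_cdf_right_continuous i : right_continuous (hold_cdf i).
Proof.
move=> x; suff cx : cum_rate i z @[z --> x^'+] --> cum_rate i x.
  apply: cvgB; first exact: cvg_cst.
  by apply: continuous_cvg; [exact: continuous_expR|exact: cvgN].
have [x0|x0] := ltP x 0.
  have E0 z : z < 0 -> cum_rate i z = 0.
    by move=> z0; rewrite /cum_rate set_itv_ge ?Rintegral_set0// bnd_simp -ltNge.
  rewrite E0//; apply: cvg_near_cst; near=> z; apply: E0.
  by near: z; exact: nbhs_right_lt.
have x1 : x < x + 1 by rewrite ltrDl.
have b0 : 0 <= x + 1 by rewrite addr_ge0.
have /subspace_continuousP/(_ x) H := parameterized_integral_continuous b0
  (diag_rate_integrable i (x + 1)).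
have {}H := H _; rewrite /= in_itv/= x0 ltW// in H.
apply: cvg_trans (H isT); apply: cvg_app => P PD.
have {}PD : \forall z \near x, z \in `[0, x + 1] -> P z by [].
have {}PD : \forall z \near x^'+, z \in `[0, x + 1] -> P z.
  by rewrite near_withinE; apply: filterS PD => z h _.
suff: \forall z \near x^'+, P z by [].
near=> z; suff : z \in `[0, x + 1] by near: z; exact: PD.
rewrite in_itv/=; apply/andP; split; last by near: z; exact: nbhs_right_le.
by apply: (le_trans x0); near: z; exact: nbhs_right_ge.
Unshelve. all: by end_near. Qed.

HB.instance Definition _ i := isCumulative.Build R _ R (hold_cdf i)
  (@hold_cdf_nondecreasing i) (@hold_cdf_right_continuous i).

Definition mean_jump_mx : 'M[R]_k := \matrix_(i, j)
  \int[lebesgue_stieltjes_measure (hold_cdf i)]_(y in `[0, +oo[) jump_prob i j y.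

End holding_times.

Definition irreducible_mx (R : realType) (k : nat) (P : 'M[R]_k) : Prop :=
  forall i j, exists n : nat, 0 < (P ^+ n) i j.

Section black_scholes_merton.
Context {R : realType}.
Variables (T K : R).

Definition C12 (A : set (R * R)) (u : R -> R -> R) : Prop :=
  [/\ (forall p, A p -> [/\ derivable (u ^~ p.2) p.1 1,
         derivable (u p.1) p.2 1 & derivable (derive1 (u p.1)) p.2 1]),
      {within A, continuous (fun p => derive1 (u ^~ p.2) p.1)},
      {within A, continuous (fun p => derive1 (u p.1) p.2)} &
      {within A, continuous (fun p => derive1n 2 (u p.1) p.2)}].

Definition bsm_solution (drift vol : R) (u : R -> R -> R) : Prop :=
  [/\ C12 [set p | 0 < p.1 < T /\ 0 < p.2] u,
      {within [set p : R * R | 0 <= p.1 <= T /\ 0 < p.2],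
         continuous (fun p => u p.1 p.2)} &
      [/\ (forall t s, 0 < t < T -> 0 < s ->
         derive1 (u ^~ s) t + drift * s * derive1 (u t) s
           + 2^-1 * vol ^+ 2 * s ^+ 2 * derive1n 2 (u t) s = drift * u t s),
      (forall s, 0 < s -> u T s = Num.max (s - K) 0),
      (forall t, 0 <= t <= T -> u t s @[s --> 0^'+] --> 0) &
      (exists C, forall t s, 0 <= t <= T -> 0 < s -> `|u t s| <= C * (1 + s))]].

(* Transition density of the geometric Brownian motion with drift [drift] and
   volatility [vol], from [s] to [x] in time [v]. *)
Definition lognormal_dev (drift vol x s v : R) : R :=
  (ln (x / s) - (drift - vol ^+ 2 / 2) * v) / (vol * Num.sqrt v).

Definition lognormal_density (drift vol x s v : R) : R :=
  expR (- 2^-1 * lognormal_dev drift vol x s v ^+ 2)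
  / (Num.sqrt (2 * pi) * x * vol * Num.sqrt v).

End black_scholes_merton.

(* A function of (t, s, i, y) is represented by a total one of which only the
   values on the closure of the domain matter; both domains are products with
   the finite set of regimes, so only their (t, s, y)-part is recorded. *)
Section price_functions.
Context {R : realType} {k : nat}.
Variable T : R.
Implicit Type phi : R -> R -> 'I_k -> R -> R.

Definition dom : set (R * R * R) :=
  [set p | let: (t, s, y) := p in [/\ 0 < t < T, 0 < s, 0 < y < T & y < t]].

Definition cdom : set (R * R * R) :=
  [set p | let: (t, s, y) := p in [/\ 0 <= t <= T, 0 < s & 0 <= y <= t]].

Definition vanishes_at_0 phi : Prop := forall t i y,
  0 <= t <= T -> 0 <= y <= t -> phi t s i y @[s --> 0^'+] --> 0.

Definition growth_norm phi : \bar R :=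
  ereal_sup [set e | exists t s i y,
    dom (t, s, y) /\ e = `|phi t s i y / (1 + s)|%:E].

Definition in_B phi : Prop :=
  [/\ (forall i, {within cdom,
         continuous (fun p : R * R * R => phi p.1.1 p.1.2 i p.2)}),
      vanishes_at_0 phi & (growth_norm phi < +oo)%E].

Definition C121 phi : Prop := forall i,
  [/\ (forall t s y, dom (t, s, y) ->
         [/\ derivable (fun t' => phi t' s i y) t 1,
             derivable (fun s' => phi t s' i y) s 1,
             derivable (derive1 (fun s' => phi t s' i y)) s 1 &
             derivable (phi t s i) y 1]),
      {within dom, continuous (fun p : R * R * R =>
         derive1 (fun t' => phi t' p.1.2 i p.2) p.1.1)},
      {within dom, continuous (fun p : R * R * R =>
         derive1 (fun s' => phi p.1.1 s' i p.2) p.1.2)},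
      {within dom, continuous (fun p : R * R * R =>
         derive1n 2 (fun s' => phi p.1.1 s' i p.2) p.1.2)} &
      {within dom, continuous (fun p : R * R * R =>
         derive1 (phi p.1.1 p.1.2 i) p.2)}].

End price_functions.

Section integral_equation.
Context {R : realType} {k : nat}.
Variables (T : R) (r sigma : 'I_k -> R) (lam : rates R k).
Variable eta : 'I_k -> R -> R -> R.
Local Notation mu := (@lebesgue_measure R).
Local Notation F := (hold_cdf lam).
Local Notation f := (hold_pdf lam).
Local Notation p := (jump_prob lam).

Definition price_operator (phi : R -> R -> 'I_k -> R -> R)
    (t s : R) (i : 'I_k) (y : R) : R :=
  (1 - F i (T - t + y)) / (1 - F i y) * eta i t s
  + \int[mu]_(v in `[0, T - t])
      (expR (- r i * v) * (f i (y + v) / (1 - F i y))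
       * \sum_(j < k | j != i) (p i j (y + v)
           * \int[mu]_(x in `]0, +oo[)
               (phi (t + v) x j 0 * lognormal_density (r i) (sigma i) x s v))).

Definition solves_problem (phi : R -> R -> 'I_k -> R -> R) : Prop :=
  (forall t s i y, cdom T (t, s, y) ->
     phi t s i y = price_operator phi t s i y)
  /\ vanishes_at_0 T phi.

End integral_equation.

(* Main.v *)
(* In terms of the log-price z = ln s and the time to go t, the equation becomes
   a linear Volterra equation Phi = S + J Phi: the age at the start of a new
   regime is 0, so that only the values at age 0 are unknown, and J averages a
   continuous kernel in time against a drifted Gaussian flow in z.  Picard
   iteration in a norm with weight e^{cu} / sqrt u gives existence, uniqueness
   and nonnegativity.

   Derivatives in z fall on the Gaussian density.  Two of them cost 1/v, which is
   not integrable at v = 0, but the solution is Lipschitz in z and this saves a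
   factor sqrt v.  The time derivative is the solution psi of the differentiated
   equation, whose source blows up like 1 / sqrt t.  The age y enters the kernel
   through y + v only, so that along the lines y + t = const the kernel can be
   frozen and the Gaussian flow differentiated instead: this is d/dt - d/dy.

   Finally eta_i is identified with the Gaussian average of the payoff by the
   maximum principle, with barrier e^{c(T - t)} (s^2 + 1/s). *)

(* The rates are differentiable, but their derivatives need not be continuous or even locally
   integrable, so no derivative may fall on the kernel. Nor may one fall on the unknown function
   before its smoothness is known. Each derivative is therefore moved by a substitution to a place
   that can bear it. For time this is a detour: [psi] solves an equation of its own, its primitive
   solves the original equation, and only uniqueness identifies that primitive with the solution.

   Being a classical solution says nothing about how fast the derivatives of eta_i grow as t tends
   to T, whereas the source of the equation for [psi] must be O(1 / sqrt t). The Gaussian formula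
   supplies this rate, which is why eta_i has to be identified explicitly.

   The O(s) bound on the constructed solution also yields its limit 0 as s tends to 0, so the
   boundary condition needs no separate argument. Uniqueness, in contrast, is run with the O(1 + s)
   bound that membership in B provides. *)
Require Import Defs.
From HB Require Import structures.
From mathcomp Require Import all_boot all_order all_algebra.
From mathcomp Require Import all_classical all_reals all_analysis.
From mathcomp Require Import measurable_realfun.
From mathcomp Require Import ring lra.

Set Implicit Arguments.
Unset Strict Implicit.
Unset Printing Implicit Defensive.
Import Order.TTheory GRing.Theory Num.Theory.
Import numFieldNormedType.Exports.

Local Open Scope classical_set_scope.
Local Open Scope ring_scope.


(** * Integration over the line with parameters *)

Section line_integral.
Context {R : realType}.
Local Notation mu := (@lebesgue_measure R).
Implicit Types f g : R -> R.

Definition intgR f := mu.-integrable setT (EFin \o f).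
Definition intR f : R := \int[mu]_x f x.

Lemma intgR_mfun f : intgR f -> measurable_fun setT f.
Proof. by move=> /integrableP[/measurable_EFinP]. Qed.

Lemma intgR_le f g : measurable_fun setT f -> (forall x, `|f x| <= g x) ->
  intgR g -> intgR f.
Proof.
move=> mf fg; apply: le_integrable => //; first exact/measurable_EFinP.
move=> x _ /=; rewrite lee_fin; exact: le_trans (fg x) (ler_norm _).
Qed.

Lemma le_intR f g : intgR f -> intgR g -> (forall x, f x <= g x) ->
  intR f <= intR g.
Proof. by move=> ? ? fg; apply: le_Rintegral => // x _; exact: fg. Qed.

Lemma intgR_norm f : intgR f -> intgR (fun x => `|f x|).
Proof. by move=> fi; have := integrable_abse fi. Qed.

Lemma intR_norm_le f g : measurable_fun setT f -> (forall x, `|f x| <= g x) ->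
  intgR g -> `|intR f| <= intR g.
Proof.
move=> mf fg ig; have fi := intgR_le mf fg ig.
apply: (le_trans (le_normr_Rintegral _ fi)) => //.
by apply: le_intR => //; exact: intgR_norm.
Qed.

Lemma intR_ge0 f : (forall x, 0 <= f x) -> 0 <= intR f.
Proof. by move=> f0; apply: Rintegral_ge0. Qed.

Lemma intgRZ c f : intgR f -> intgR (fun x => c * f x).
Proof.
move=> fi; rewrite /intgR.
have -> : EFin \o (fun x => c * f x) = (fun x => c%:E * (EFin \o f) x)%E.
  by apply/funext => x; rewrite /= EFinM.
exact: integrableZl.
Qed.

Lemma intRZ c f : intgR f -> intR (fun x => c * f x) = c * intR f.
Proof. by move=> fi; exact: RintegralZl. Qed.

Lemma intgRD f g : intgR f -> intgR g -> intgR (fun x => f x + g x).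
Proof. by move=> fi gi; have := integrableD measurableT fi gi. Qed.

Lemma intRD f g : intgR f -> intgR g ->
  intR (fun x => f x + g x) = intR f + intR g.
Proof. by move=> fi gi; exact: RintegralD. Qed.

Lemma intgRB f g : intgR f -> intgR g -> intgR (fun x => f x - g x).
Proof. by move=> fi gi; have := integrableB measurableT fi gi. Qed.

Lemma intRB f g : intgR f -> intgR g ->
  intR (fun x => f x - g x) = intR f - intR g.
Proof. by move=> fi gi; exact: RintegralB. Qed.

Lemma ae_neq (c : R) (P : R -> Prop) : (forall x, x != c -> P x) ->
  {ae mu, forall x, P x}.
Proof.
move=> H; exists [set c]; split => //; first exact: lebesgue_measure_set1.
move=> x /= nP; apply: contrapT => /eqP xc; exact/nP/H.
Qed.

Lemma eq_intR_neq c f g : measurable_fun setT f -> measurable_fun setT g ->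
  (forall x, x != c -> f x = g x) -> intR f = intR g.
Proof.
move=> mf mg fg; rewrite /intR /Rintegral; congr fine.
apply: ae_eq_integral => //; [exact/measurable_EFinP..|].
by apply: (@ae_neq c) => x /fg xc _; rewrite /= xc.
Qed.

(** Dominated convergence is a statement about sequences; this carries it over to a parameter in a
    metric space. If convergence failed, a bad point could be picked in each ball of radius 1 / (n +
    1). *)
Lemma seq_cvgP (X : pseudoMetricType R) (f : X -> R) (p : X) (l : R) :
  (forall u : nat -> X, u n @[n --> \oo] --> p -> f (u n) @[n --> \oo] --> l) ->
  f x @[x --> p] --> l.
Proof.
move=> H; apply: contrapT => /cvgrPdist_lt/existsNP[e /not_implyP[e0 ne]].
have He n : {x | ball p n.+1%:R^-1 x /\ ~ `|l - f x| < e}.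
  apply: cid; apply: contrapT => /forallNP h; apply: ne.
  rewrite -nbhs_ballE; exists n.+1%:R^-1; first by rewrite /= invr_gt0.
  by move=> x px; apply: contrapT => nx; exact: (h x).
have /H/cvgrPdist_lt/(_ _ e0) : (sval (He n)) @[n --> \oo] --> p.
  apply/cvg_ballP => d d0; near=> n.
  have [xb _] := svalP (He n); apply: le_ball xb.
  rewrite -[leRHS]invrK lef_pV2 ?posrE ?invr_gt0//.
  near: n; exists (Num.truncn d^-1) => // s /= rs.
  by apply/ltW; rewrite -truncn_le_nat.
by move=> [n _ /(_ n (leqnn _))]; have [_] := svalP (He n).
Unshelve. all: end_near. Qed.

Lemma intR_cvg_seq (f : nat -> R -> R) f0 g c :
  (forall n, measurable_fun setT (f n)) -> measurable_fun setT f0 ->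
  intgR g -> (forall n w, `|f n w| <= g w) ->
  (forall w, w != c -> f n w @[n --> \oo] --> f0 w) ->
  intR (f n) @[n --> \oo] --> intR f0.
Proof.
move=> mf mf0 ig fg ff0.
have [|||||i0 _ H] := @dominated_convergence _ _ R mu setT measurableT
  (fun n => EFin \o f n) (EFin \o f0) (EFin \o g) => //.
- by move=> n; apply/measurable_EFinP; exact: mf.
- exact/measurable_EFinP.
- apply: (@ae_neq c) => w wc _; apply: cvg_EFin; first exact: nearW.
  exact: ff0.
- by apply: aeW => w n _; rewrite lee_fin fg.
by apply: fine_cvg; rewrite fineK//; exact: integrable_fin_num.
Qed.

(** The exceptional point [c] is meant for a moving end of the interval of integration, where the
    cut-off integrand jumps. *)
Lemma intR_cvg (X : pseudoMetricType R) (p : X) (f : X -> R -> R) g c :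
  (\forall x \near p, measurable_fun setT (f x)) -> intgR g ->
  (\forall x \near p, forall w, `|f x w| <= g w) ->
  (forall w, w != c -> f x w @[x --> p] --> f p w) ->
  intR (f x) @[x --> p] --> intR (f p).
Proof.
move=> mf ig fg fp; apply: seq_cvgP => u up.
have [N _ HN] : \forall n \near \oo,
    measurable_fun setT (f (u n)) /\ forall w, `|f (u n) w| <= g w.
  by apply: (up (fun x => measurable_fun setT (f x) /\ forall w, `|f x w| <= g w));
    near=> x; split; near: x.
rewrite -(cvg_shiftn N); apply: (@intR_cvg_seq _ _ g c) => //.
- by move=> n; have [] := HN (n + N)%N (leq_addl _ _).
- exact: nbhs_singleton mf.
- by move=> n; have [] := HN (n + N)%N (leq_addl _ _).
- by move=> w wc; rewrite (cvg_shiftn N (fun n => f (u n) w)); 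
  exact: (cvg_comp u (fun x => f x w) up (fp w wc)).
Unshelve. all: end_near. Qed.


Lemma is_derive1P f (a d : R) :
  is_derive a 1 f d <-> (f x - f a) / (x - a) @[x --> a^'] --> d.
Proof.
have E : (f x - f a) / (x - a) @[x --> a^'] --> d <->
    h^-1 *: (f (h *: 1 + a) - f a) @[h --> 0^'] --> d.
  split=> H.
    apply/cvgr_dnbhsP => u [u0 uc].
    move/cvgr_dnbhsP : H => /(_ (fun n => u n + a)) H.
    have {}H := H _.
    rewrite (_ : (fun n => _) = (fun n => (f (u n + a) - f a) / (u n + a - a))).
      apply: H; split.
        by move=> n; rewrite -subr_eq0 addrK.
      by rewrite -[X in _ --> X]add0r; apply: cvgD uc _; exact: cvg_cst.
    by apply/funext => n; rewrite addrK scaler1 /GRing.scale/= mulrC.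
  apply/cvgr_dnbhsP => u [u0 uc].
  move/cvgr_dnbhsP : H => /(_ (fun n => u n - a)) H.
  have {}H := H _.
  rewrite (_ : (fun n => _) = (fun n => (u n - a)^-1 *: (f ((u n - a) *: 1 + a) - f a))).
    apply: H; split.
      by move=> n; rewrite subr_eq0.
    by apply/subr_cvg0.
  by apply/funext => n; rewrite scaler1 subrK /GRing.scale/= mulrC.
split.
  by move=> [fa fE]; apply/E; rewrite -fE; exact: fa.
move/E => H; split; first by apply/cvg_ex; exists d.
exact: cvg_lim.
Qed.

(** The difference quotients, completed by [df] at [x = a], form a dominated family continuous at
    [a], so that [intR_cvg] applies. As a limit of such quotients, [df] comes out measurable. *)
Lemma intR_derive (f : R -> R -> R) (df G : R -> R) a c :
  (\forall x \near a, intgR (f x)) -> intgR G ->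
  (\forall x \near a, forall w, w != c -> `|f x w - f a w| <= `|x - a| * G w) ->
  (forall w, w != c -> is_derive a 1 (f ^~ w) (df w)) ->
  is_derive a 1 (fun x => intR (f x)) (intR df) /\ measurable_fun setT df.
Proof.
move=> fi iG fG fd.
have fia := nbhs_singleton fi.
(* At [w = c] there is no bound on the quotients: they are set to 0 there. *)
pose q x w := if w == c then 0 else if x == a then df w else (f x w - f a w) / (x - a).
have qc w : w != c -> q x w @[x --> a] --> q a w.
  move=> wc; rewrite /q (negbTE wc) eqxx.
  have /is_derive1P H := fd w wc.
  apply/cvgrPdist_lt => e e0; move/cvgrPdist_lt : H => /(_ _ e0) H.
  have {}H : \forall x \near a, x != a -> `|df w - (f x w - f a w) / (x - a)| < e.
    by [].
  near=> x; case: eqVneq => [_|xa]; first by rewrite subrr normr0.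
  by move: xa; near: x; exact: H.
have G0 w : w != c -> 0 <= G w.
  move=> wc.
  near a^' => x.
  have xa : x != a by near: x; exact: nbhs_dnbhs_neq.
  have : `|f x w - f a w| <= `|x - a| * G w.
    have : forall w, w != c -> `|f x w - f a w| <= `|x - a| * G w.
      by near: x; apply: nbhs_dnbhs; exact: fG.
    exact.
  move=> /(le_trans (normr_ge0 _)); rewrite pmulr_rge0// normr_gt0 subr_eq0//.
have qG : \forall x \near a, x != a -> forall w, `|q x w| <= `|G w|.
  near=> x => xa w; rewrite /q (negbTE xa); case: ifPn => wc; first by rewrite normr0.
  apply: (@le_trans _ _ (G w)); last exact: ler_norm.
  rewrite normf_div ler_pdivrMr ?normr_gt0 ?subr_eq0// mulrC.
  have : forall w, w != c -> `|f x w - f a w| <= `|x - a| * G w by near: x; exact: fG.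
  exact.
have qaG w : `|q a w| <= `|G w|.
  have [->|wc] := eqVneq w c; first by rewrite /q eqxx normr0.
  have /cvg_norm qn := qc w wc.
  have qn' : `|q x w| @[x --> a^'] --> `|q a w|.
    by apply: cvg_trans qn; apply: cvg_app; exact: nbhs_dnbhs.
  rewrite -(cvg_lim _ qn')//; apply: limr_le; first by apply/cvg_ex; eexists; exact: qn'.
  near=> x.
  have xa : x != a by near: x; exact: nbhs_dnbhs_neq.
  move: xa w {wc qn qn'}; near: x; apply: nbhs_dnbhs; exact: qG.
have mq : \forall x \near a, x != a -> measurable_fun setT (q x).
  near=> x => xa.
  rewrite /q (negbTE xa); apply: measurable_fun_ifT => //.
    exact: measurable_fun_eqr.
  apply: measurable_funM => //; apply: measurable_funB.
    by apply: intgR_mfun; near: x.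
  exact: intgR_mfun.
have mqa : measurable_fun setT (q a).
  have [e /= e0 He] : nbhs a (fun x => x != a -> measurable_fun setT (q x)) by exact: mq.
  (* Points other than [a] that tend to [a] inside the ball where the quotients are measurable, so
     that [q a] is a pointwise limit of measurable functions. *)
  pose u n := a + e / 2 * harmonic n.
  have un n : u n != a.
    by rewrite -subr_eq0 /u addrC addKr gt_eqF// mulr_gt0// ?divr_gt0// harmonic_gt0.
  have uc : u n @[n --> \oo] --> a.
    rewrite -[X in _ --> X]addr0; apply: cvgD; first exact: cvg_cst.
    rewrite -[X in _ --> X](mulr0 (e / 2)); apply: cvgM; first exact: cvg_cst.
    exact: cvg_harmonic.
  apply: (@measurable_fun_cvg _ _ _ setT (fun n => q (u n))).
    move=> n; apply: He => //=; rewrite /u opprD addrA subrr sub0r normrN.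
    rewrite gtr0_norm ?mulr_gt0// ?divr_gt0// ?harmonic_gt0//.
    apply: (@le_lt_trans _ _ (e / 2)); last by rewrite ltr_pdivrMr// ltr_pMr// ltr1n.
    by rewrite -[leRHS]mulr1 ler_pM2l ?divr_gt0// invf_le1// ler1n.
  move=> w _; have [->|wc] := eqVneq w c.
    by rewrite (_ : (fun _ => _) = cst 0); [rewrite /q eqxx; exact: cvg_cst|apply/funext => n; rewrite /q eqxx].
  exact: (cvg_comp u (fun x => q x w) uc (qc w wc)).
have mdf : measurable_fun setT df.
  rewrite (_ : df = fun w => if w == c then df c else q a w).
    by apply: measurable_fun_ifT => //; exact: measurable_fun_eqr.
  by apply/funext => w; rewrite /q eqxx; case: eqP => // ->.
split => //; apply/is_derive1P.
have -> : intR df = intR (q a).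
  by apply: (@eq_intR_neq c) => // w wc; rewrite /q (negbTE wc) eqxx.
have H : intR (q x) @[x --> a] --> intR (q a).
  apply: (@intR_cvg _ _ _ (fun w => `|G w|) c) => //.
  - near=> x; have [->//|xa] := eqVneq x a.
    by move: xa; near: x.
  - exact: intgR_norm.
  - near=> x; have [->//|xa] := eqVneq x a.
    by move: xa; near: x.
apply: cvg_trans (cvg_trans (cvg_app _ _) H); last exact: nbhs_dnbhs.
apply: near_eq_cvg; near=> x.
have xa : x != a by near: x; exact: nbhs_dnbhs_neq.
have fix_ : intgR (f x) by near: x; apply: nbhs_dnbhs.
rewrite -intRB// mulrC -intRZ; last exact: intgRB.
have mfx := intgR_mfun fix_.
have mfa := intgR_mfun fia.
apply: (@eq_intR_neq c).
- by move: xa; near: x; apply: nbhs_dnbhs; exact: mq.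
- by apply: measurable_funM => //; exact: measurable_funB.
- by move=> w wc; rewrite /q (negbTE wc) (negbTE xa) mulrC.
Unshelve. all: end_near. Qed.

End line_integral.

Section pointwise_derivatives.
Context {R : realType}.
Implicit Types f g : R -> R.

Lemma derD f g (x a b : R) : is_derive x 1 f a -> is_derive x 1 g b ->
  is_derive x 1 (fun t => f t + g t) (a + b).
Proof. exact: is_deriveD. Qed.

Lemma derB f g (x a b : R) : is_derive x 1 f a -> is_derive x 1 g b ->
  is_derive x 1 (fun t => f t - g t) (a - b).
Proof. exact: is_deriveB. Qed.

Lemma derN f (x a : R) : is_derive x 1 f a -> is_derive x 1 (fun t => - f t) (- a).
Proof. exact: is_deriveN. Qed.

Lemma derM f g (x a b : R) : is_derive x 1 f a -> is_derive x 1 g b ->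
  is_derive x 1 (fun t => f t * g t) (a * g x + f x * b).
Proof.
move=> fa gb; have H := @is_deriveM _ _ f g x 1 a b fa gb.
by apply: (is_derive_eq H); rewrite /GRing.scale/= addrC mulrC.
Qed.

Lemma derZ f c (x a : R) : is_derive x 1 f a ->
  is_derive x 1 (fun t => c * f t) (c * a).
Proof. by move=> fa; exact: (@is_deriveZ _ _ _ f c x 1 a fa). Qed.

Lemma derid (x : R) : is_derive x 1 (fun t => t) 1.
Proof. exact: is_derive_id. Qed.

Lemma derc (x c : R) : is_derive x 1 (fun t => c) 0.
Proof. exact: is_derive_cst. Qed.

Lemma derV f (x a : R) : f x != 0 -> is_derive x 1 f a ->
  is_derive x 1 (fun t => (f t)^-1) (- (f x) ^- 2 * a).
Proof. by move=> f0 fa; exact: is_deriveV. Qed.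

Lemma dercomp f g (x a b : R) : is_derive (f x) 1 g b -> is_derive x 1 f a ->
  is_derive x 1 (fun t => g (f t)) (b * a).
Proof. by move=> gb fa; exact: is_derive1_comp. Qed.

Lemma derexp f (x a : R) : is_derive x 1 f a ->
  is_derive x 1 (fun t => expR (f t)) (expR (f x) * a).
Proof. by apply: dercomp; exact: is_derive_expR. Qed.

Lemma der_cont f (x a : R) : is_derive x 1 f a -> {for x, continuous f}.
Proof. by move=> [fa _]; exact/differentiable_continuous/derivable1_diffP. Qed.

Lemma dereq f (x a b : R) : is_derive x 1 f a -> a = b -> is_derive x 1 f b.
Proof. by move=> ? <-. Qed.

End pointwise_derivatives.

Lemma der_sum {R : realType} (I : Type) (l : seq I) (P : pred I) (f : I -> R -> R)
  (df : I -> R) (x : R) : (forall i, P i -> is_derive x 1 (f i) (df i)) ->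
  is_derive x 1 (fun x => \sum_(i <- l | P i) f i x) (\sum_(i <- l | P i) df i).
Proof.
move=> H; elim: l => [|i l IH].
  by rewrite big_nil; under eq_fun do rewrite big_nil; exact: derc.
rewrite big_cons; under eq_fun do rewrite big_cons.
by case: ifP => // Pi; exact: (derD (H i Pi) IH).
Qed.

Lemma fin_bound {R : realType} (I : finType) (P : I -> R -> Prop) :
  (forall i a b, a <= b -> P i a -> P i b) -> (forall i, exists2 Q, 0 <= Q & P i Q) ->
  exists2 Q, 0 <= Q & forall i, P i Q.
Proof.
move=> Pm H.
have Q i : {Q | 0 <= Q /\ P i Q} by apply: cid; have [q q0 hq] := H i; exists q.
exists (\sum_i sval (Q i)); first by apply: sumr_ge0 => i _; have [] := svalP (Q i).
move=> i; have [_] := svalP (Q i); apply: Pm.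
by rewrite (bigD1 i)//= lerDl; apply: sumr_ge0 => j _; have [] := svalP (Q j).
Qed.

(** * Integrals with moving bounds, affine substitution, the integral of 1 / sqrt v *)

Section tools.
Context {R : realType}.
Local Notation mu := (@lebesgue_measure R).
Implicit Types f g : R -> R.

(** Turns an integral over a moving interval into one over the fixed line: the moving bound then
    sits in the integrand, where [intR_cvg] and [intR_derive] can treat it as a parameter. *)
Definition cut (a b : R) f (v : R) : R := if a < v < b then f v else 0.

Lemma cutE a b f : cut a b f = f \_ `]a, b[%classic.
Proof.
apply/funext => v; rewrite /cut patchE; case: ifPn => vab.
  by rewrite mem_set//= in_itv.
by rewrite memNset//= in_itv; exact/negP.
Qed.

Lemma intR_cut a b f : intR (cut a b f) = \int[mu]_(x in `]a, b[) f x.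
Proof. by rewrite cutE /intR -Rintegral_mkcond. Qed.

Lemma intgR_cut a b f :
  intgR (cut a b f) <-> mu.-integrable `]a, b[ (EFin \o f).
Proof.
rewrite cutE /intgR -restrict_EFin.
by split => H; [rewrite integrable_mkcond|rewrite -integrable_mkcond].
Qed.

Lemma mfun_cut a b f : (forall v, a < v < b -> {for v, continuous f}) ->
  measurable_fun setT (cut a b f).
Proof.
move=> cf; rewrite cutE; apply/(measurable_restrictT _ _).1 => //.
apply: open_continuous_measurable_fun => // v; rewrite inE/= in_itv/=.
exact: cf.
Qed.

Lemma intR_cut_itv (a b : R) f :
  measurable_fun (`]a, b[%classic : set (measurableTypeR R)) f ->
  \int[mu]_(x in `[a, b]) f x = intR (cut a b f).
Proof.
move=> mf; rewrite intR_cut /Rintegral integral_itv_bndoo//.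
exact/measurable_EFinP.
Qed.

Lemma intgR_cst_cut a b (C : R) : intgR (cut a b (fun _ => C)).
Proof.
apply/intgR_cut; apply/integrableP; split; first exact: measurable_cst.
rewrite /= integral_cst//= lebesgue_measure_itv/= lte_fin.
by case: ifPn => _; rewrite ?mule0 ?ltry// -EFinB -EFinM ltry.
Qed.

Lemma intR_cst_cut a b C : a <= b -> intR (cut a b (fun _ => C)) = C * (b - a).
Proof.
move=> ab; rewrite intR_cut Rintegral_cst//; congr (_ * _).
suff : mu `]a, b[%classic = (b - a)%:E by move=> /(congr1 fine).
rewrite lebesgue_measure_itv/= lte_fin; move: ab; rewrite le_eqVlt.
by case/predU1P => [->|->]; [rewrite ltxx subrr|rewrite EFinB].
Qed.

(** Lebesgue measure equals [|b|] times its image under [x -> a + b x], since the two agree on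
    half-open intervals; for [b < 0] the ends are exchanged. *)
Lemma ge0_integral_affine (f : R -> \bar R) (a b : R) : b != 0 ->
  measurable_fun setT f -> (forall x, 0 <= f x)%E ->
  (\int[mu]_x f x = `|b|%:E * \int[mu]_x f (a + b * x)%R)%E.
Proof.
move=> b0 mf f0.
pose phi : R -> measurableTypeR R := fun x => a + b * x.
have mphi : measurable_fun setT phi.
  by apply: measurable_funD => //; exact: measurable_funM.
pose phim : {mfun R >-> measurableTypeR R} := HB.pack phi (isMeasurableFun.Build _ _ _ _ _ mphi).
pose nb : {nonneg R} := NngNum (normr_ge0 b).
have E A : measurable A -> mu A = mscale nb (pushforward mu phim) A.
  apply: lebesgue_measure_unique => _ [[x y]] _ <-.
  transitivity (`|b|%:E * mu (phi @^-1` `]x, y]))%E; last by [].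
  have b1 : 0 < `|b| by rewrite normr_gt0.
  have [bp|bn|] := ltgtP 0 b; last by move=> /eqP; rewrite eq_sym (negbTE b0).
    have -> : phi @^-1` `]x, y] = `](x - a) / b, (y - a) / b]%classic.
      apply/seteqP; split => z; rewrite /phi/= !in_itv/= ltr_pdivrMr// ler_pdivlMr//.
        by rewrite ltrBlDl lerBrDl (mulrC z).
      by rewrite ltrBlDl lerBrDl (mulrC z).
    rewrite !lebesgue_measure_itv/= !lte_fin ltr_pM2r ?invr_gt0// ltrD2r.
    case: ifPn => xy; last by rewrite mule0.
    rewrite -!EFinB -EFinM (gtr0_norm bp); congr EFin; field.
    exact: b0.
  have -> : phi @^-1` `]x, y] = `[(y - a) / b, (x - a) / b[%classic.
    apply/seteqP; split => z; rewrite /phi/= !in_itv/= ltr_ndivlMr// ler_ndivrMr//.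
      by rewrite ltrBlDl lerBrDl (mulrC z) andbC.
    by rewrite ltrBlDl lerBrDl (mulrC z) andbC.
  rewrite !lebesgue_measure_itv/= !lte_fin ltr_nM2r ?invr_lt0// ltrD2r.
  case: ifPn => xy; last by rewrite mule0.
  rewrite -!EFinB -EFinM (ltr0_norm bn); congr EFin; field.
  exact: b0.
rewrite (@eq_measure_integral _ _ _ setT (mscale nb (pushforward mu phim)))//; last first.
  by move=> A mA _; exact: E.
rewrite ge0_integral_mscale//=; congr (_ * _)%E.
by rewrite ge0_integral_pushforward.
Qed.

Lemma intgR_affine f (a b : R) : b != 0 -> intgR f ->
  intgR (fun x => f (a + b * x)).
Proof.
move=> b0 fi; have mf := intgR_mfun fi.
apply/integrableP; split.
  apply/measurable_EFinP; apply: measurableT_comp => //.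
  by apply: measurable_funD => //; exact: measurable_funM.
have nf : measurable_fun setT (fun x => `|f x|%:E).
  by apply/measurable_EFinP; exact: measurableT_comp.
have := @ge0_integral_affine (fun x => `|f x|%:E) a b b0 nf (fun x => normr_ge0 _).
move: fi => /integrableP[_]; rewrite /= => H.
move=> E; rewrite E in H.
rewrite ltey; apply/eqP => E'; move: H; rewrite E'.
by rewrite gt0_muley ?lte_fin ?normr_gt0// ltxx.
Qed.

Lemma intR_affine f (a b : R) : b != 0 -> intgR f ->
  intR f = `|b| * intR (fun x => f (a + b * x)).
Proof.
move=> b0; have ge0 g : (forall x, 0 <= g x) -> intgR g ->
    intR g = `|b| * intR (fun x => g (a + b * x)).
  move=> g0 gi; have mg := intgR_mfun gi.
  have mgE : measurable_fun setT (fun x => (g x)%:E) by exact/measurable_EFinP.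
  rewrite /intR /Rintegral (@ge0_integral_affine (fun x => (g x)%:E) a b)//.
  by rewrite fineM//; exact: (integrable_fin_num measurableT (intgR_affine a b0 gi)).
move=> fi.
have pi_ : intgR (fun x => (f x + `|f x|) / 2).
  have := intgRZ 2^-1 (intgRD fi (intgR_norm fi)).
  by congr intgR; apply/funext => x; rewrite mulrC.
have ni : intgR (fun x => (`|f x| - f x) / 2).
  have := intgRZ 2^-1 (intgRB (intgR_norm fi) fi).
  by congr intgR; apply/funext => x; rewrite mulrC.
have fE : f = fun x => (f x + `|f x|) / 2 - (`|f x| - f x) / 2.
  by apply/funext => x; field.
rewrite [in LHS]fE intRB// ge0//; last first.
  by move=> x; rewrite divr_ge0// -lerBlDl sub0r lerNl lerNnormlW.
rewrite [X in _ - X]ge0//; last by move=> x; rewrite divr_ge0// subr_ge0 ler_norm.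
rewrite -mulrBr -intRB; [|exact: (intgR_affine a b0 pi_)|exact: (intgR_affine a b0 ni)].
by congr (_ * intR _); apply/funext => x; field.
Qed.

Lemma intgR_expsq (a : R) : 0 < a -> intgR (fun x => expR (- (a * x ^+ 2))).
Proof.
(* With variance 1 / (2a) the normal density is a multiple of exp(- a x^2). *)
move=> a0; pose s : R := Num.sqrt (2 * a)^-1.
have s0 : s != 0 by rewrite gt_eqF// sqrtr_gt0 invr_gt0 mulr_gt0.
have s2 : s ^+ 2 = (2 * a)^-1.
  by rewrite sqr_sqrtr// invr_ge0 mulr_ge0// ltW.
have := integrable_normal_pdf 0 s; rewrite normal_pdfE//.
move=> /(@intgRZ R (normal_peak s)^-1 (fun x => normal_peak s * normal_fun 0 s x)); congr intgR; apply/funext => x.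
rewrite mulrA mulVf ?mul1r ?gt_eqF ?normal_peak_gt0//.
rewrite /normal_fun subr0 s2; congr expR; field.
by rewrite gt_eqF.
Qed.

Lemma cut_refl t f : cut 0 t f \o (fun v => t + -1 * v) = cut 0 t (fun v => f (t - v)).
Proof.
apply/funext => v; rewrite /cut/= mulN1r subr_gt0 ltrBlDl ltrDr andbC.
by case: ifP.
Qed.

Lemma intgR_cut_refl t f : intgR (cut 0 t f) ->
  intgR (cut 0 t (fun v => f (t - v))).
Proof.
move=> fi; rewrite -cut_refl.
by have N1 : (-1 : R) != 0 by []; exact: (intgR_affine t N1 fi).
Qed.

Lemma intR_cut_refl t f : intgR (cut 0 t f) ->
  intR (cut 0 t (fun v => f (t - v))) = intR (cut 0 t f).
Proof.
move=> fi; rewrite -cut_refl.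
have N1 : (-1 : R) != 0 by [].
by rewrite (intR_affine t N1 fi) normrN1 mul1r.
Qed.

Lemma cut_derive a b x f : intgR (cut a b f) -> a < x < b ->
  {for x, continuous f} -> is_derive x 1 (fun y => intR (cut a y f)) (f x).
Proof.
move=> fi /andP[ax xb] fx.
have mf : measurable_fun (`]a, b[%classic : set (measurableTypeR R)) f.
  apply/measurable_EFinP; exact: measurable_int ((intgR_cut a b f).1 fi).
pose u := (x + b) / 2.
have xu : x < u by rewrite midf_lt.
have ub : u < b by rewrite midf_lt.
have iu : mu.-integrable `]a, u] (EFin \o f).
  have := (intgR_cut a b f).1 fi; apply: integrableS => //.
  by apply: subset_itvl; rewrite bnd_simp.
have := @continuous_FTC1 R f (BRight a) x u xu iu ax fx; cbv zeta => -[dF F'].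
have E : \forall y \near x, \int[mu]_(t in `]a, y]) f t = intR (cut a y f).
  near=> y; rewrite intR_cut /Rintegral.
  rewrite (@integral_itv_bndoo _ a y (EFin \o f) false false)//.
  apply/measurable_EFinP; apply: (measurable_funS _ _ mf) => //.
  apply: subset_itvl; rewrite bnd_simp ltW//; near: y.
  exact: lt_nbhsl.
have D : is_derive x 1 (fun y => \int[mu]_(t in `]a, y]) f t) (f x).
  by apply: DeriveDef; [exact: dF|rewrite -derive1E; exact: F'].
exact: (near_eq_is_derive E D).
Unshelve. all: end_near. Qed.

(** The integrand is unbounded at 0. The primitive 2 sqrt v is used on [[c n, b]] with
    [c n = b / (n + 1)], and monotone convergence lets [c n] tend to 0. *)
Lemma isqrt_cut_int (b : R) : 0 < b ->
  intgR (cut 0 b (fun v => (Num.sqrt v)^-1)) /\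
  intR (cut 0 b (fun v => (Num.sqrt v)^-1)) <= 2 * Num.sqrt b.
Proof.
move=> b0; pose g v : R := (Num.sqrt v)^-1.
pose c n : R := b * harmonic n.
have c0 n : 0 < c n by rewrite mulr_gt0// harmonic_gt0.
pose h n : R -> R := cut (c n) b g.
have gc (v : R) : 0 < v -> {for v, continuous g}.
  move=> v0; apply: cvgV; first by rewrite gt_eqF// sqrtr_gt0.
  exact: sqrt_continuous.
have mh n : measurable_fun setT (h n).
  apply: mfun_cut => v /andP[cv _]; apply: gc; exact: lt_trans cv.
have mg : measurable_fun setT (cut 0 b g).
  by apply: mfun_cut => v /andP[cv _]; exact: gc.
have Ih n : (\int[mu]_x (h n x)%:E <= (2 * Num.sqrt b)%:E)%E.
  have [bc|cb] := leP b (c n).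
    rewrite (_ : (fun x => _) = cst 0%E).
      by rewrite integral0 lee_fin mulr_ge0 ?sqrtr_ge0.
    apply/funext => x; rewrite /h /cut; case: ifP => // /andP[cx xb].
    by move: (lt_trans cx xb); rewrite ltNge bc.
  have cg : {within `[c n, b], continuous g}.
    apply: derivable_within_continuous => x; rewrite in_itv/= => /andP[cx _].
    have x0 := lt_le_trans (c0 n) cx.
    apply: derivableV; first by rewrite gt_eqF// sqrtr_gt0.
    by have [] := is_derive1_sqrt x0.
  have dF (x : R) : 0 < x -> is_derive x 1 (fun v => 2 * Num.sqrt v) (g x).
    move=> x0; have D := is_derive1_sqrt x0.
    have D2 := derZ 2 D.
    by apply: (dereq D2); rewrite /g invfM mulrA divff ?mul1r.
  have : (\int[mu]_(x in `[c n, b]) (g x)%:E =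
      (2 * Num.sqrt b)%:E - (2 * Num.sqrt (c n))%:E)%E.
    apply: (@continuous_FTC2 R g (fun v => 2 * Num.sqrt v)) => //.
      split.
      - move=> x; rewrite in_itv/= => /andP[cx _].
        by have [] := dF x (lt_trans (c0 n) cx).
      - apply: cvg_at_right_filter; apply: cvgM; first exact: cvg_cst.
        exact: sqrt_continuous.
      - apply: cvg_at_left_filter; apply: cvgM; first exact: cvg_cst.
        exact: sqrt_continuous.
    move=> x; rewrite in_itv/= => /andP[cx _]; rewrite derive1E.
    by have [_] := dF x (lt_trans (c0 n) cx).
  have -> : (\int[mu]_x (h n x)%:E = \int[mu]_(x in `[c n, b]) (g x)%:E)%E.
    rewrite integral_itv_bndoo; last first.
      apply/measurable_EFinP.
      have := mh n; rewrite /h cutE => /(measurable_restrictT _ _).2; exact.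
    by rewrite /h cutE [RHS]integral_mkcond restrict_EFin.
  by move=> ->; rewrite -EFinB lee_fin gerBl mulr_ge0// sqrtr_ge0.
have c_decr n m : (n <= m)%N -> c m <= c n.
  by move=> nm; rewrite ler_pM2l// /harmonic/= lef_pV2 ?posrE// ler_nat ltnS.
have hc x : h n x @[n --> \oo] --> cut 0 b g x.
  apply: cvg_near_cst.
  have [x0|x0] := leP x 0.
    apply: nearW => n; rewrite /h /cut [0 < x]ltNge x0/=.
    by rewrite ltNge (le_trans x0 (ltW (c0 n))).
  have cc : c n @[n --> \oo] --> 0.
    rewrite -(mulr0 b); apply: cvgM; [exact: cvg_cst|exact: cvg_harmonic].
  near=> n; rewrite /h /cut x0.
  suff -> : c n < x by [].
  near: n; exact: (cvgr_lt 0).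
have mhE n : measurable_fun setT (fun x => (h n x)%:E).
  by apply/measurable_EFinP; exact: mh.
have := @cvg_monotone_convergence _ _ R mu setT measurableT
  (fun n x => (h n x)%:E) mhE.
have h0 n x : 0 <= h n x.
  by rewrite /h /cut; case: ifP => // _; rewrite invr_ge0 sqrtr_ge0.
have hn x : {homo (fun n => (h n x)%:E) : n m / (n <= m)%N >-> (n <= m)%E}.
  move=> n m nm; rewrite lee_fin /h /cut.
  case: ifP => [/andP[cx xb]|_]; last by case: ifP => // _; rewrite invr_ge0 sqrtr_ge0.
  by rewrite xb (le_lt_trans (c_decr _ _ nm) cx).
move=> /(_ (fun n x _ => h0 n x) (fun x _ => hn x)) H.
have limE : (fun x => limn (fun n => (h n x)%:E)) = (fun x => (cut 0 b g x)%:E).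
  apply/funext => x; apply/cvg_lim => //; apply: cvg_EFin; first exact: nearW.
  exact: hc.
rewrite limE in H.
have H2 : (\int[mu]_x (cut 0 b g x)%:E <= (2 * Num.sqrt b)%:E)%E.
  rewrite -(cvg_lim _ H)//; apply: lime_le; first by apply/cvg_ex; eexists; exact: H.
  exact: nearW.
have g0 x : 0 <= cut 0 b g x.
  by rewrite /cut; case: ifP => // _; rewrite invr_ge0 sqrtr_ge0.
split.
  apply/integrableP; split; first exact/measurable_EFinP.
  rewrite (_ : (fun x => _) = (fun x => (cut 0 b g x)%:E)).
    by apply: (le_lt_trans H2); rewrite ltry.
  by apply/funext => x /=; rewrite ger0_norm.
rewrite /intR /Rintegral -[leRHS]/(fine (2 * Num.sqrt b)%:E) fine_le//.
rewrite ge0_fin_numE; last by apply: integral_ge0 => x _; rewrite lee_fin.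
by apply: (le_lt_trans H2); rewrite ltry.
Unshelve. all: end_near. Qed.

End tools.

(** * Gaussian averages *)

Section gaussian_averages.
Context {R : realType}.
Implicit Types (g : R -> R) (k : nat).

Definition gam (w : R) : R := expR (- (w ^+ 2 / 2)) / Num.sqrt (2 * pi).

(* The Gaussian density times the [k]-th Hermite polynomial, [k <= 2]: letting
   the [z]-derivatives fall on the density leaves [g] undifferentiated. *)
Definition gk k (w : R) : R :=
  match k with 0 => 1 | 1 => w | _ => w ^+ 2 - 1 end * gam w.

(* With [z] a log-price: the solution constructed below is O(s), which is
   [e = 0], but an arbitrary element of B is only O(1 + s), which is [e = 1]. *)
Definition wt (e z : R) : R := e + expR z.

Definition gavg k g (b c : R) : R := intR (fun w => g (b + c * w) * gk k w).

Lemma sqrt2pi_gt0 : 0 < Num.sqrt (2 * pi) :> R.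
Proof. by rewrite sqrtr_gt0 mulr_gt0// pi_gt0. Qed.

Lemma gam_ge0 w : 0 <= gam w.
Proof. by rewrite divr_ge0 ?expR_ge0// ltW// sqrt2pi_gt0. Qed.

Lemma cont_gam : continuous gam.
Proof.
move=> w; apply: cvgM; last exact: cvg_cst.
apply: continuous_comp; last exact: continuous_expR.
apply: cvgN; apply: cvgM; last exact: cvg_cst.
exact: exprn_continuous.
Qed.

Lemma cont_gk k : continuous (gk k).
Proof.
move=> w; apply: cvgM; last exact: cont_gam.
case: k => [|[|k]]; [exact: cvg_cst|exact: cvg_id|].
by apply: cvgB; [exact: exprn_continuous|exact: cvg_cst].
Qed.

Lemma gk_le k w : `|gk k w| <= (1 + w ^+ 2) * gam w.
Proof.
rewrite /gk normrM (ger0_norm (gam_ge0 w)) ler_wpM2r ?gam_ge0//.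
have w2 : 0 <= w ^+ 2 by rewrite sqr_ge0.
case: k => [|[|k]].
- by rewrite normr1 lerDl.
- have := sqr_ge0 (`|w| - 1); rewrite sqrrB1 real_normK ?num_real//.
  have := normr_ge0 w; lra.
- rewrite ler_norml; apply/andP; split; lra.
Qed.

Lemma wt_shift (e z a : R) : 0 <= e -> wt e (z + a) <= expR `|a| * wt e z.
Proof.
move=> e0; rewrite /wt mulrDr -expRD lerD//; last by rewrite addrC ler_expR lerD2r ler_norm.
by rewrite ler_peMl// -expR0 ler_expR.
Qed.

Lemma wt_ge0 (e z : R) : 0 <= e -> 0 <= wt e z.
Proof. by move=> e0; rewrite addr_ge0// expR_ge0. Qed.

(** One integrable majorant for all means within [M] of a point and all standard deviations up to
    [M]: the exponential factor is the price, by [wt_shift], of moving the weight from the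
    evaluation point back to the centre. *)
Definition gdom (M w : R) : R := expR (M + M * `|w|) * ((1 + w ^+ 2) * gam w).

Lemma gdom_ge0 M w : 0 <= gdom M w.
Proof.
by rewrite mulr_ge0 ?expR_ge0// mulr_ge0 ?gam_ge0// addr_ge0// sqr_ge0.
Qed.

Lemma sqr_expR8 (w : R) : 1 + w ^+ 2 <= 8 * expR (w ^+ 2 / 8).
Proof.
have := expR_ge1Dx (w ^+ 2 / 8) => H.
have w2 : 0 <= w ^+ 2 by rewrite sqr_ge0.
by apply: (@le_trans _ _ (8 * (1 + w ^+ 2 / 8))); [lra|rewrite ler_pM2l].
Qed.

(** The polynomial factor and the factor exp(M |w|) cost exp(w^2 / 8) each, which leaves exp(- w^2 /
    4) of the Gaussian exp(- w^2 / 2). *)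
Lemma intgR_gdom M : 0 <= M -> intgR (gdom M).
Proof.
move=> M0; have a0 : 0 < 4^-1 :> R by rewrite invr_gt0.
apply: (@intgR_le _ _ (fun w => (8 * expR (M + 2 * M ^+ 2) / Num.sqrt (2 * pi))
   * expR (- (4^-1 * w ^+ 2)))).
- apply: continuous_measurable_fun => w; apply: cvgM.
    apply: continuous_comp; last exact: continuous_expR.
    apply: cvgD; first exact: cvg_cst.
    by apply: cvgM; [exact: cvg_cst|exact: norm_continuous].
  apply: cvgM; last exact: cont_gam.
  by apply: cvgD; [exact: cvg_cst|exact: exprn_continuous].
- move=> w; rewrite ger0_norm ?gdom_ge0// /gdom /gam.
  have h1 := sqr_expR8 w.
  have h2 : M + M * `|w| <= M + 2 * M ^+ 2 + w ^+ 2 / 8.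
    have : 0 <= (`|w| - 4 * M) ^+ 2 by rewrite sqr_ge0.
    rewrite sqrrB real_normK ?num_real// exprMn; lra.
  have h3 : expR (M + M * `|w|) <= expR (M + 2 * M ^+ 2) * expR (w ^+ 2 / 8).
    by rewrite -expRD ler_expR.
  have -> : expR (- (4^-1 * w ^+ 2)) = expR (w ^+ 2 / 8) * expR (w ^+ 2 / 8) * expR (- (w ^+ 2 / 2)) :> R.
    by rewrite -!expRD; congr expR; lra.
  have h4 : expR (M + M * `|w|) * (1 + w ^+ 2) <=
     expR (M + 2 * M ^+ 2) * expR (w ^+ 2 / 8) * (8 * expR (w ^+ 2 / 8)).
    by apply: ler_pM; rewrite ?expR_ge0 ?addr_ge0 ?sqr_ge0.
  have := ler_wpM2r (gam_ge0 w) h4; rewrite /gam => h5.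
  rewrite [leLHS]mulrA; apply: (le_trans h5).
  rewrite le_eqVlt; apply/orP; left; apply/eqP; ring.
- exact/intgRZ/intgR_expsq.
Qed.

Definition gcst M := intR (gdom M).

Lemma gcst_ge0 M : 0 <= gcst M. Proof. exact/intR_ge0/gdom_ge0. Qed.

Lemma gavg_dom k g (D e b c z M w : R) : 0 <= D -> 0 <= e ->
  (forall x, `|g x| <= D * wt e x) -> `|b - z| <= M -> `|c| <= M ->
  `|g (b + c * w) * gk k w| <= D * wt e z * gdom M w.
Proof.
move=> D0 e0 gD bz cM; rewrite normrM.
have M0 : 0 <= M := le_trans (normr_ge0 _) cM.
have h1 : `|g (b + c * w)| <= D * (expR (M + M * `|w|) * wt e z).
  apply: (le_trans (gD _)); rewrite ler_wpM2l//.
  rewrite [b + _](_ : _ = z + (b - z + c * w)); last by ring.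
  apply: (le_trans (wt_shift _ _ e0)); rewrite ler_wpM2r ?wt_ge0// ler_expR.
  apply: (le_trans (ler_normD _ _)); rewrite lerD// normrM ler_wpM2r//.
apply: (le_trans (ler_pM _ _ h1 (gk_le k w))) => //.
rewrite /gdom le_eqVlt; apply/orP; left; apply/eqP; ring.
Qed.

Lemma gavg_mfun k g (b c : R) : measurable_fun setT g ->
  measurable_fun setT (fun w => g (b + c * w) * gk k w).
Proof.
move=> mg; apply: measurable_funM; last first.
  by apply: continuous_measurable_fun; exact: cont_gk.
by apply: measurableT_comp => //; exact: measurable_funD.
Qed.

Lemma gavg_int k g (D e b c : R) : 0 <= D -> 0 <= e -> measurable_fun setT g ->
  (forall x, `|g x| <= D * wt e x) ->
  intgR (fun w => g (b + c * w) * gk k w).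
Proof.
move=> D0 e0 mg gD.
apply: (@intgR_le _ _ (fun w => D * wt e b * gdom `|c| w)).
- exact: gavg_mfun.
- by move=> w; apply: gavg_dom => //; rewrite subrr normr0 normr_ge0.
- exact/intgRZ/intgR_gdom/normr_ge0.
Qed.

Lemma gavg_le k g (D e b c z M : R) : 0 <= D -> 0 <= e -> measurable_fun setT g ->
  (forall x, `|g x| <= D * wt e x) -> `|b - z| <= M -> `|c| <= M ->
  `|gavg k g b c| <= D * gcst M * wt e z.
Proof.
move=> D0 e0 mg gD bz cM.
have M0 : 0 <= M := le_trans (normr_ge0 _) cM.
apply: (le_trans (@intR_norm_le _ _ (fun w => D * wt e z * gdom M w) _ _ _)).
- exact: gavg_mfun.
- by move=> w; apply: gavg_dom.
- exact/intgRZ/intgR_gdom.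
- by rewrite intRZ; [rewrite mulrAC|exact/intgR_gdom].
Qed.

(** The averaged function moves with the parameter too, so its continuity is required along every
    continuous path; the proof uses the paths [b x + c x * w]. *)
Lemma gavg_cvg (X : pseudoMetricType R) (p : X) (b c : X -> R) (G : X -> R -> R)
    k (D e : R) : 0 <= D -> 0 <= e ->
  {for p, continuous b} -> {for p, continuous c} ->
  (\forall x \near p, measurable_fun setT (G x)) ->
  (\forall x \near p, forall u, `|G x u| <= D * wt e u) ->
  (forall u : X -> R, {for p, continuous u} ->
     G x (u x) @[x --> p] --> G p (u p)) ->
  gavg k (G x) (b x) (c x) @[x --> p] --> gavg k (G p) (b p) (c p).
Proof.
move=> D0 e0 cb cc mG GD Gc; rewrite /gavg.
pose M := 1 + `|c p|.
have M0 : 0 <= M by rewrite addr_ge0.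
apply: (@intR_cvg _ _ p (fun x w => G x (b x + c x * w) * gk k w)
   (fun w => D * wt e (b p) * gdom M w) 0).
- by apply: filterS mG => x; exact: gavg_mfun.
- exact/intgRZ/intgR_gdom.
- have n1 : \forall x \near p, `|b p - b x| < 1 by move/cvgrPdist_lt : cb; apply.
  have n2 : \forall x \near p, `|c p - c x| < 1 by move/cvgrPdist_lt : cc; apply.
  apply: filterS3 GD n1 n2 => x Gx bx cx w; apply: (gavg_dom k w D0 e0 Gx).
    by rewrite distrC ltW// (lt_le_trans bx)// lerDl.
  rewrite -[c x](subrK (c p)) (le_trans (ler_normD _ _))// lerD2r distrC.
  exact: ltW.
- move=> w _; apply: cvgM; last exact: cvg_cst.
  apply: (Gc (fun x => b x + c x * w)).
  by apply: cvgD => //; apply: cvgM => //; exact: cvg_cst.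
Qed.

Lemma gavg_ge0 g (b c : R) : (forall x, 0 <= g x) -> 0 <= gavg 0 g b c.
Proof.
by move=> g0; apply: intR_ge0 => w; rewrite mulr_ge0// /gk mul1r gam_ge0.
Qed.

Lemma intR_gam : intR gam = 1.
Proof.
have := @integral_normal_pdf R 0 1; rewrite normal_pdfE ?oner_neq0//.
move=> /(congr1 fine)/= <-; congr fine; apply: eq_integral => w _; congr EFin.
rewrite /gam /normal_peak /normal_fun subr0 expr1n mul1r mulrC.
by rewrite mulNr -[pi *+ 2]mulr_natl -[1 *+ 2]mulr_natl mulr1.
Qed.

Lemma gavg_cst (x b c : R) : gavg 0 (fun=> x) b c = x.
Proof.
rewrite /gavg (_ : (fun w => _) = (fun w => x * gam w)).
  rewrite intRZ ?intR_gam ?mulr1//.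
  have := @gavg_int 0 (fun=> 1) 1 1 0 0 ler01 ler01 (measurable_cst _).
  rewrite (_ : (fun w => _) = gam); last by apply/funext => w; rewrite /gk !mul1r.
  by apply => y; rewrite normr1 mul1r lerDl expR_ge0.
by apply/funext => w; rewrite /gk mul1r.
Qed.

End gaussian_averages.

(** * Differentiation of Gaussian averages in mean and standard deviation *)

Section kernel_derivatives.
Context {R : realType}.
Implicit Types (g : R -> R) (k : nat).

Lemma der_lip (f df : R -> R) (a x r C : R) :
  (forall t, `|t - a| < r -> is_derive t 1 f (df t)) ->
  (forall t, `|t - a| < r -> `|df t| <= C) ->
  `|x - a| < r -> `|f x - f a| <= `|x - a| * C.
Proof.
move=> fd dC xr.
have C0 : 0 <= C.
  apply: (le_trans (normr_ge0 (df a))); apply: dC.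
  by rewrite subrr normr0 (le_lt_trans (normr_ge0 _) xr).
have H (y z : R) : y < z -> `|y - a| < r -> `|z - a| < r ->
    `|f z - f y| <= `|z - y| * C.
  move=> yz yr zr.
  have bt (t : R) : y <= t <= z -> `|t - a| < r.
    move=> /andP[yt tz]; move: yr zr; rewrite !ltr_norml => /andP[? ?] /andP[? ?].
    by apply/andP; split; lra.
  have [||c] := @MVT R f df y z yz.
  - by move=> t; rewrite in_itv/= => /andP[/ltW yt /ltW tz]; apply/fd/bt/andP.
  - apply: derivable_within_continuous => t; rewrite in_itv/= => tb.
    by have [] := fd t (bt t tb).
  rewrite in_itv/= => /andP[/ltW yc /ltW cz] ->.
  by rewrite normrM mulrC ler_wpM2l//; apply/dC/bt/andP.
have ar : `|a - a| < r by rewrite subrr normr0 (le_lt_trans (normr_ge0 _) xr).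
have [xa|xa|->] := ltgtP x a; last by rewrite !subrr normr0 mul0r.
  by rewrite distrC (distrC x); exact: H.
exact: H.
Qed.

(** The derivative falls on the kernel [q], so that [g] need only be measurable; the factor [wt 1 x]
    in the bound on [dq] pays for the growth of [g]. *)
Lemma kern_derive (q dq : R -> R -> R) g (a d K al D : R) :
  0 < d -> 0 < al -> 0 <= D -> measurable_fun setT g ->
  (forall x, `|g x| <= D * wt 1 x) ->
  (forall t x, `|t - a| < d -> is_derive t 1 (q ^~ x) (dq t x)) ->
  (forall t x, `|t - a| < d -> `|dq t x| * wt 1 x <= K * expR (- (al * x ^+ 2))) ->
  (forall t, `|t - a| < d -> intgR (fun x => g x * q t x)) ->
  is_derive a 1 (fun t => intR (fun x => g x * q t x)) (intR (fun x => g x * dq a x)).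
Proof.
move=> d0 al0 D0 mg gD qd dqK qi.
have near_d : \forall t \near a, `|t - a| < d.
  by exists d => //= t /=; rewrite distrC.
have [||||H _ //] := @intR_derive _ (fun t x => g x * q t x) (fun x => g x * dq a x)
  (fun x => D * K * expR (- (al * x ^+ 2))) a 0.
- by apply: filterS near_d => t; exact: qi.
- exact/intgRZ/intgR_expsq.
- apply: filterS near_d => t td x _.
  rewrite -mulrBr normrM.
  have w0 : 0 < wt 1 x by rewrite ltr_pwDl ?expR_ge0.
  have h : `|q t x - q a x| <= `|t - a| * (K * expR (- (al * x ^+ 2)) / wt 1 x).
    apply: (@der_lip (q ^~ x) (dq ^~ x) a t d) => // s sd.
    by rewrite ler_pdivlMr//; exact: dqK.
  apply: (le_trans (ler_pM _ _ (gD x) h)) => //.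
  rewrite le_eqVlt; apply/orP; left; apply/eqP; field.
  by rewrite gt_eqF.
- move=> x _; have := derZ (g x) (qd a x _).
  by rewrite subrr normr0 => /(_ d0).
Qed.

Lemma der_gam (w : R) : is_derive w 1 gam (- gk 1 w).
Proof.
rewrite /gam.
have D1 : is_derive w 1 (fun t : R => - (t ^+ 2 / 2)) (- w).
  have := derN (derM (derM (derid w) (derid w)) (derc w (2^-1 : R))).
  rewrite (_ : (fun t => _) = (fun t : R => - (t ^+ 2 / 2))) => [H|].
    by apply: (dereq H); lra.
  by apply/funext => t; rewrite expr2.
have := derM (derexp D1) (derc w (Num.sqrt (2 * pi))^-1).
by move/dereq; apply; rewrite /gk /gam; ring.
Qed.

Lemma der_gk1 (w : R) : is_derive w 1 (gk 1) (- gk 2 w).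
Proof.
have := derM (derid w) (der_gam w); move/dereq; apply.
by rewrite /gk; ring.
Qed.

(** The substitution x = b + c w takes [b] and [c] out of the argument of [g], which may have kinks,
    and puts them into the smooth kernel. *)
Lemma gavg_kern k g (b c D e : R) : 0 < c -> 0 <= D -> 0 <= e ->
  measurable_fun setT g -> (forall x, `|g x| <= D * wt e x) ->
  intgR (fun x => g x * (gk k ((x - b) / c) / c)) /\
  gavg k g b c = intR (fun x => g x * (gk k ((x - b) / c) / c)).
Proof.
move=> c0 D0 e0 mg gD.
have gi := gavg_int k b c D0 e0 mg gD.
have ci0 : c^-1 != 0 by rewrite invr_eq0 gt_eqF.
have E : (fun x => g x * (gk k ((x - b) / c) / c)) =
    (fun x => c^-1 * (fun w => g (b + c * w) * gk k w) (- b / c + c^-1 * x)).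
  apply/funext => x /=.
  have -> : - b / c + c^-1 * x = (x - b) / c by ring.
  have -> : b + c * ((x - b) / c) = x by field; rewrite gt_eqF.
  by ring.
have gi' := intgR_affine (- b / c) ci0 gi.
split; first by rewrite E; exact: (intgRZ c^-1 gi').
rewrite E (intRZ _ gi') /gavg (intR_affine (- b / c) ci0 gi).
by rewrite gtr0_norm// invr_gt0.
Qed.

(** With u = (x - b) / c, the polynomial factor leaves exp(- 3 u^2 / 8), and u^2 is at least (x^2 /
    2 - M^2) / c2^2. The weight costs exp|x|, where |x| is at most x^2 / (16 c2^2) + 4 c2^2. The
    coefficient of x^2 / c2^2 is thus - 3/16 + 1/16 = - 1/8. *)
Lemma kern_dom (b c M c1 c2 x : R) : `|b| <= M -> 0 < c1 -> c1 <= c -> c <= c2 ->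
  (1 + ((x - b) / c) ^+ 2) * gam ((x - b) / c) * wt 1 x <=
  16 * expR (3 * M ^+ 2 / (8 * c2 ^+ 2) + 4 * c2 ^+ 2) / Num.sqrt (2 * pi)
  * expR (- ((8 * c2 ^+ 2)^-1 * x ^+ 2)).
Proof.
move=> bM c10 c1c cc2.
have c0 : 0 < c := lt_le_trans c10 c1c.
have c20 : 0 < c2 := lt_le_trans c0 cc2.
set u := (x - b) / c.
have c22 : 0 < c2 ^+ 2 by rewrite exprn_gt0.
have h1 := sqr_expR8 u.
have h2 : wt 1 x <= 2 * expR `|x|.
  rewrite /wt mulr2n mulrDl mul1r lerD//; first by rewrite -expR0 ler_expR.
  by rewrite ler_expR ler_norm.
have h3 : `|x| <= (16 * c2 ^+ 2)^-1 * x ^+ 2 + 4 * c2 ^+ 2.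
  have : 0 <= (`|x| / (4 * c2) - 2 * c2) ^+ 2 by rewrite sqr_ge0.
  rewrite sqrrB expr_div_n exprMn real_normK ?num_real//.
  have -> : `|x| / (4 * c2) * (2 * c2) *+ 2 = `|x|.
    by rewrite -mulr_natr; field; rewrite gt_eqF.
  rewrite exprMn.
  have -> : x ^+ 2 / ((4 : R) ^+ 2 * c2 ^+ 2) = (16 * c2 ^+ 2)^-1 * x ^+ 2.
    by field; rewrite gt_eqF.
  lra.
have M0 : 0 <= M := le_trans (normr_ge0 _) bM.
have b2 : b ^+ 2 <= M ^+ 2.
  by rewrite -real_normK ?num_real// lerXn2r ?nnegrE.
have h4 : (x ^+ 2 / 2 - M ^+ 2) / c2 ^+ 2 <= u ^+ 2.
  have h41 : x ^+ 2 / 2 - M ^+ 2 <= (x - b) ^+ 2.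
    have : 0 <= (x - 2 * b) ^+ 2 by rewrite sqr_ge0.
    rewrite !sqrrB exprMn; lra.
  rewrite /u expr_div_n.
  have cc : 0 < c ^+ 2 by rewrite exprn_gt0.
  (* As x^2 / 2 - M^2 may be negative, [c] can be compared with [c2] only once the numerator is a
     square. *)
  apply: (@le_trans _ _ ((x - b) ^+ 2 / c2 ^+ 2)).
    by rewrite ler_wpM2r// invr_ge0 ltW.
  rewrite ler_wpM2l ?sqr_ge0// lef_pV2 ?posrE//.
  by rewrite lerXn2r ?nnegrE// ltW.
have h5 : (1 + u ^+ 2) * expR (- (u ^+ 2 / 2)) * wt 1 x <=
    8 * expR (u ^+ 2 / 8) * expR (- (u ^+ 2 / 2)) * (2 * expR `|x|).
  apply: ler_pM; rewrite ?wt_ge0// ?mulr_ge0 ?expR_ge0 ?addr_ge0 ?sqr_ge0//.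
  by rewrite ler_wpM2r ?expR_ge0.
have h6 : 8 * expR (u ^+ 2 / 8) * expR (- (u ^+ 2 / 2)) * (2 * expR `|x|) <=
   16 * (expR (3 * M ^+ 2 / (8 * c2 ^+ 2) + 4 * c2 ^+ 2) *
     expR (- ((8 * c2 ^+ 2)^-1 * x ^+ 2))).
  rewrite [leLHS](_ : _ = 16 * (expR (u ^+ 2 / 8) * expR (- (u ^+ 2 / 2)) * expR `|x|)).
    rewrite ler_pM2l// -!expRD ler_expR.
    have : 3 / 8 * ((x ^+ 2 / 2 - M ^+ 2) / c2 ^+ 2) <= 3 / 8 * u ^+ 2.
      by rewrite ler_pM2l// divr_gt0.
    have -> : 3 / 8 * ((x ^+ 2 / 2 - M ^+ 2) / c2 ^+ 2) =
       3 * ((16 * c2 ^+ 2)^-1 * x ^+ 2) - 3 * M ^+ 2 / (8 * c2 ^+ 2).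
      by field; rewrite gt_eqF.
    have -> : (8 * c2 ^+ 2)^-1 * x ^+ 2 = 2 * ((16 * c2 ^+ 2)^-1 * x ^+ 2).
      by field; rewrite gt_eqF.
    lra.
  by ring.
have s0 := @sqrt2pi_gt0 R.
rewrite /gam.
have -> : (1 + u ^+ 2) * (expR (- (u ^+ 2 / 2)) / Num.sqrt (2 * pi)) * wt 1 x =
  (1 + u ^+ 2) * expR (- (u ^+ 2 / 2)) * wt 1 x / Num.sqrt (2 * pi) by ring.
rewrite ler_pdivrMr//; apply: (le_trans h5); apply: (le_trans h6).
by rewrite le_eqVlt; apply/orP; left; apply/eqP; field; rewrite gt_eqF.
Qed.

(** Differentiating gam((x - b) / c) / c in [b] produces the first Hermite polynomial and in [c] the
    second, whose term - 1 comes from the prefactor 1 / c. In both cases a factor 1 / c appears. *)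
Lemma gavg0_derive g (b c db dc : R -> R) (a d M c1 c2 D e : R) :
  0 < d -> 0 <= D -> 0 <= e <= 1 -> measurable_fun setT g ->
  (forall x, `|g x| <= D * wt e x) -> 0 < c1 ->
  (forall t, `|t - a| < d -> is_derive t 1 b (db t) /\ is_derive t 1 c (dc t)) ->
  (forall t, `|t - a| < d ->
     [/\ `|b t| <= M, `|db t| <= M, `|dc t| <= M & c1 <= c t <= c2]) ->
  is_derive a 1 (fun t => gavg 0 g (b t) (c t))
    (db a / c a * gavg 1 g (b a) (c a) + dc a / c a * gavg 2 g (b a) (c a)).
Proof.
move=> d0 D0 /andP[e0 e1] mg gD c10 der bnd.
have gD1 x : `|g x| <= D * wt 1 x.
  by apply: (le_trans (gD x)); rewrite ler_wpM2l// lerD2r.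
pose q (t x : R) := gk 0 ((x - b t) / c t) / c t.
pose dq (t x : R) := db t / c t * (gk 1 ((x - b t) / c t) / c t)
  + dc t / c t * (gk 2 ((x - b t) / c t) / c t).
have cpos (t : R) : `|t - a| < d -> 0 < c t.
  by move=> /bnd[_ _ _ /andP[h _]]; exact: lt_le_trans h.
have aa : `|a - a| < d by rewrite subrr normr0.
have H : is_derive a 1 (fun t => intR (fun x => g x * q t x)) (intR (fun x => g x * dq a x)).
  pose C := 16 * expR (3 * M ^+ 2 / (8 * c2 ^+ 2) + 4 * c2 ^+ 2) / Num.sqrt (2 * pi).
  apply: (kern_derive (q := q) (dq := dq) (K := 2 * M / c1 ^+ 2 * C)
     (al := (8 * c2 ^+ 2)^-1) d0 _ D0 mg gD1).
  - have [_ _ _ /andP[_ cc]] := bnd a aa.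
    by rewrite invr_gt0 mulr_gt0// exprn_gt0// (lt_le_trans (cpos a aa)).
  - move=> t x td; have [bd cd] := der t td.
    have c0 : c t != 0 by rewrite gt_eqF// cpos.
    have ud := derM (derB (derc t x) bd) (derV c0 cd).
    have H := derM (@dercomp _ _ _ _ _ _ (der_gam _) ud) (derV c0 cd).
    rewrite (_ : q ^~ x = (fun t => gam ((x - b t) / c t) / c t)); last first.
      by apply/funext => s; rewrite /q /gk mul1r.
    apply: (dereq H); rewrite /dq /gk; field.
    exact: c0.
  - move=> t x td; have [bM dbM dcM /andP[c1c cc2]] := bnd t td.
    have ct := cpos t td.
    have KD := kern_dom x bM c10 c1c cc2.
    set u := (x - b t) / c t in KD *.
    have w0 : 0 <= wt 1 x by rewrite wt_ge0.
    have M0 : 0 <= M := le_trans (normr_ge0 _) bM.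
    have -> : dq t x = (db t * gk 1 u + dc t * gk 2 u) / (c t) ^+ 2.
      by rewrite /dq -/u; field; rewrite gt_eqF.
    have h : `|db t * gk 1 u + dc t * gk 2 u| <= 2 * M * ((1 + u ^+ 2) * gam u).
      apply: (le_trans (ler_normD _ _)).
      rewrite (normrM (db t)) (normrM (dc t)).
      rewrite (_ : 2 * M * ((1 + u ^+ 2) * gam u) = M * ((1 + u ^+ 2) * gam u)
        + M * ((1 + u ^+ 2) * gam u)); last by ring.
      exact: (lerD (ler_pM (normr_ge0 _) (normr_ge0 _) dbM (gk_le 1 u))
        (ler_pM (normr_ge0 _) (normr_ge0 _) dcM (gk_le 2 u))).
    rewrite normrM normfV (gtr0_norm (exprn_gt0 2 ct)).
    have c12 : ((c t) ^+ 2)^-1 <= (c1 ^+ 2)^-1.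
      by rewrite lef_pV2 ?posrE ?exprn_gt0// lerXn2r ?nnegrE// ltW.
    have h2 := ler_pM (normr_ge0 _) (ltW (_ : 0 < ((c t) ^+ 2)^-1)) h c12.
    have {}h2 := h2 _; rewrite invr_gt0 exprn_gt0// in h2.
    apply: (le_trans (ler_wpM2r w0 (h2 isT))).
    have -> : 2 * M * ((1 + u ^+ 2) * gam u) / c1 ^+ 2 * wt 1 x =
       2 * M / c1 ^+ 2 * ((1 + u ^+ 2) * gam u * wt 1 x) by ring.
    rewrite -[leRHS]mulrA; apply: ler_wpM2l KD.
    by rewrite divr_ge0 ?sqr_ge0// mulr_ge0.
  - by move=> t td; have [] := gavg_kern 0 (b t) (cpos t td) D0 e0 mg gD.
have -> : db a / c a * gavg 1 g (b a) (c a) + dc a / c a * gavg 2 g (b a) (c a)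
    = intR (fun x => g x * dq a x).
  have [i1 ->] := gavg_kern 1 (b a) (cpos a aa) D0 e0 mg gD.
  have [i2 ->] := gavg_kern 2 (b a) (cpos a aa) D0 e0 mg gD.
  rewrite -(intRZ _ i1) -(intRZ _ i2) -intRD; [|exact: intgRZ|exact: intgRZ].
  by congr intR; apply/funext => x; rewrite /dq; ring.
apply: near_eq_is_derive H.
exists d => //= t /=; rewrite distrC => td.
by have [_ ->] := gavg_kern 0 (b t) (cpos t td) D0 e0 mg gD.
Qed.

Lemma gavg1_derive g (b c D e : R) :
  0 < c -> 0 <= D -> 0 <= e <= 1 -> measurable_fun setT g ->
  (forall x, `|g x| <= D * wt e x) ->
  is_derive b 1 (fun t => gavg 1 g t c) (gavg 2 g b c / c).
Proof.
move=> c0 D0 /andP[e0 e1] mg gD.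
have gD1 x : `|g x| <= D * wt 1 x.
  by apply: (le_trans (gD x)); rewrite ler_wpM2l// lerD2r.
pose q (t x : R) := gk 1 ((x - t) / c) / c.
pose dq (t x : R) := c^-1 * (gk 2 ((x - t) / c) / c).
have H : is_derive b 1 (fun t => intR (fun x => g x * q t x)) (intR (fun x => g x * dq b x)).
  pose M := `|b| + 1.
  pose C := 16 * expR (3 * M ^+ 2 / (8 * c ^+ 2) + 4 * c ^+ 2) / Num.sqrt (2 * pi).
  apply: (kern_derive (q := q) (dq := dq) (K := 1 / c ^+ 2 * C)
     (al := (8 * c ^+ 2)^-1) ltr01 _ D0 mg gD1).
  - by rewrite invr_gt0 mulr_gt0// exprn_gt0.
  - move=> t x td.
    have ud := derM (derB (derc t x) (derid t)) (derc t c^-1).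
    have H := derM (@dercomp _ _ _ _ _ _ (der_gk1 _) ud) (derc t c^-1).
    by apply: (dereq H); rewrite /dq; ring.
  - move=> t x td.
    have tM : `|t| <= M.
      rewrite -[t](subrK b) (le_trans (ler_normD _ _))// addrC lerD2l ltW//.
    have KD := kern_dom x tM c0 (lexx _) (lexx _).
    set u := (x - t) / c in KD *.
    have w0 : 0 <= wt 1 x by rewrite wt_ge0.
    have -> : dq t x = gk 2 u / c ^+ 2.
      by rewrite /dq -/u; field; rewrite gt_eqF.
    rewrite normrM normfV (gtr0_norm (exprn_gt0 2 c0)).
    have h2 : 0 <= (c ^+ 2)^-1 by rewrite invr_ge0 exprn_ge0// ltW.
    apply: (le_trans (ler_wpM2r w0 (ler_wpM2r h2 (gk_le 2 u)))).
    have -> : (1 + u ^+ 2) * gam u / c ^+ 2 * wt 1 x =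
       1 / c ^+ 2 * ((1 + u ^+ 2) * gam u * wt 1 x) by ring.
    by rewrite -[leRHS]mulrA; apply: ler_wpM2l KD; rewrite mul1r.
  - by move=> t td; have [] := gavg_kern 1 t c0 D0 e0 mg gD.
have -> : gavg 2 g b c / c = intR (fun x => g x * dq b x).
  have [i2 ->] := gavg_kern 2 b c0 D0 e0 mg gD.
  rewrite mulrC -(intRZ _ i2).
  by congr intR; apply/funext => x; rewrite /dq; ring.
apply: near_eq_is_derive H.
exists 1 => //= t /=; rewrite distrC => td.
by have [_ ->] := gavg_kern 1 t c0 D0 e0 mg gD.
Qed.

End kernel_derivatives.

(** * The drifted Gaussian flow and its smoothing estimates *)

Section heat_flow.
Context {R : realType}.
Variables (m s : R).
Implicit Types (g : R -> R) (n : nat).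
Hypothesis s_gt0 : 0 < s.

(* The [n]-th [z]-derivative of E g(z + m v + s W_v) for a Brownian motion W;
   junk at [v = 0] unless [n = 0]. *)
Definition hflow n g (v z : R) : R :=
  gavg n g (z + m * v) (s * Num.sqrt v) / (s * Num.sqrt v) ^+ n.

Definition bdd (D e : R) g : Prop := forall x, `|g x| <= D * wt e x.

(** Lipschitz continuity for functions of exponential growth: the factor [expR |a|] admits
    increments of any size, as in |exp(x + a) - exp x| <= |a| exp|a| exp x. *)
Definition wlip (D e : R) g : Prop := forall x a,
  `|g (x + a) - g x| <= D * (`|a| * expR `|a|) * wt e x.

(** On a constant [gavg 1] does not depend on the mean, and its derivative in the mean is
    [gavg 2 / c]. *)
Lemma gavg2_cst (x b c : R) : 0 < c -> gavg 2 (fun=> x) b c = 0.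
Proof.
move=> c0.
have xw y : `|x| <= `|x| * wt 1 y :> R by rewrite ler_peMr// lerDl expR_ge0.
have e01 : 0 <= (1 : R) <= 1 by rewrite ler01 lexx.
have [_] := gavg1_derive b c0 (normr_ge0 x) e01 (measurable_cst x) xw.
rewrite [X in 'D_1 X b](_ : _ = cst (gavg 1 (fun=> x) b c)); last first.
  by apply/funext.
rewrite derive_cst => /esym/eqP; rewrite mulf_eq0 invr_eq0 (gt_eqF c0) orbF.
by move/eqP.
Qed.

(** As the second Hermite weight annihilates constants, [g b] may be subtracted from the integrand;
    the increment g(b + c w) - g(b) then gains a factor [c]. Its further factor |w| is absorbed by
    raising [M] to [M + 1]. *)
Lemma gavg2_lip g (D D' e b c z M : R) : 0 <= D -> 0 <= D' -> 0 <= e ->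
  measurable_fun setT g -> bdd D e g -> wlip D' e g ->
  `|b - z| <= M -> 0 < c -> c <= M ->
  `|gavg 2 g b c| <= D' * c * gcst (M + 1) * wt e z.
Proof.
move=> D0 D'0 e0 mg gD gL bz c0 cM.
have M0 : 0 <= M := le_trans (normr_ge0 _) bz.
have i1 := gavg_int 2 b c D0 e0 mg gD.
have i2 : intgR (fun w => g b * gk 2 w).
  have gbw y : `|g b| <= `|g b| * wt 1 y :> R by rewrite ler_peMr// lerDl expR_ge0.
  exact: (gavg_int 2 b c (normr_ge0 _) ler01 (measurable_cst (g b)) gbw).
have E : gavg 2 g b c = intR (fun w => (g (b + c * w) - g b) * gk 2 w).
  rewrite (_ : (fun w => _) = (fun w => g (b + c * w) * gk 2 w - g b * gk 2 w)); last first.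
    by apply/funext => w; rewrite mulrBl.
  by rewrite intRB// -[X in _ - X]/(gavg 2 (fun=> g b) b c) gavg2_cst// subr0.
rewrite E.
have M10 : 0 <= M + 1 by rewrite addr_ge0.
have -> : D' * c * gcst (M + 1) * wt e z = intR (fun w => D' * c * wt e z * gdom (M + 1) w).
  rewrite intRZ; last exact: intgR_gdom.
  by rewrite mulrAC.
apply: intR_norm_le; last exact/intgRZ/intgR_gdom.
  apply: measurable_funM; last by apply: continuous_measurable_fun; exact: cont_gk.
  by apply: measurable_funB => //; apply: measurableT_comp => //; exact: measurable_funD.
move=> w; rewrite normrM.
have h1 : `|g (b + c * w) - g b| <= D' * c * (wt e z * expR (M + 1 + (M + 1) * `|w|)).
  apply: (le_trans (gL _ _)).
  rewrite normrM (gtr0_norm c0).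
  have w1 : `|w| <= expR `|w|.
    by apply: le_trans (expR_ge1Dx _); rewrite lerDr.
  have h2 : wt e b <= expR M * wt e z.
    rewrite [b](_ : _ = z + (b - z)); last by ring.
    by apply: (le_trans (wt_shift _ _ e0)); rewrite ler_wpM2r ?wt_ge0// ler_expR.
  have h3 : expR (c * `|w|) <= expR (M * `|w|) by rewrite ler_expR ler_wpM2r.
  have h4 : expR M * expR (M * `|w|) * expR `|w| <= expR (M + 1 + (M + 1) * `|w|).
    rewrite -!expRD ler_expR; lra.
  have h5 : (`|w| * expR (c * `|w|)) * wt e b <= (expR `|w| * expR (M * `|w|)) * (expR M * wt e z).
    by apply: ler_pM; rewrite ?mulr_ge0 ?expR_ge0 ?wt_ge0//; apply: ler_pM; rewrite ?expR_ge0.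
  have Dc : 0 <= D' * c by rewrite mulr_ge0// ltW.
  rewrite (_ : D' * (c * `|w| * expR (c * `|w|)) * wt e b =
    D' * c * (`|w| * expR (c * `|w|) * wt e b)); last by ring.
  apply: (ler_wpM2l Dc); apply: (le_trans h5).
  have := ler_wpM2l (wt_ge0 z e0) h4; apply: le_trans.
  by rewrite le_eqVlt; apply/orP; left; apply/eqP; ring.
apply: (le_trans (ler_pM _ _ h1 (gk_le 2 w))) => //.
rewrite /gdom le_eqVlt; apply/orP; left; apply/eqP; ring.
Qed.

(** The first two terms bound the displacement of the mean and the standard deviation for all times
    up to [L]; the 1 is the loss in [gavg2_lip]. *)
Definition hcst (L : R) : R := gcst (`|m| * L + s * Num.sqrt L + 1).

Lemma hflow_arg (L v z : R) : 0 <= v -> v <= L ->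
  `|z + m * v - z| <= `|m| * L + s * Num.sqrt L /\
  s * Num.sqrt v <= `|m| * L + s * Num.sqrt L.
Proof.
move=> v0 vL; have L0 := le_trans v0 vL; split.
  rewrite addrAC subrr add0r normrM (ger0_norm v0) ler_wpDr//.
    by rewrite mulr_ge0 ?sqrtr_ge0// ltW.
  by rewrite ler_wpM2l.
by rewrite ler_wpDl ?mulr_ge0// ler_wpM2l ?(ltW s_gt0)// ler_wsqrtr.
Qed.

Lemma gcst_mono (M M' : R) : 0 <= M -> M <= M' -> gcst M <= gcst M'.
Proof.
move=> M0 MM'; apply: le_intR; [exact: intgR_gdom|exact/intgR_gdom/(le_trans M0)|].
move=> w; rewrite ler_wpM2r//; first by rewrite mulr_ge0 ?gam_ge0// addr_ge0// sqr_ge0.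
by rewrite ler_expR lerD// ler_wpM2r.
Qed.

Lemma hcst_ge0 L : 0 <= hcst L. Proof. exact: gcst_ge0. Qed.

Lemma hflow_le n g (D e L v z : R) : 0 <= D -> 0 <= e ->
  measurable_fun setT g -> bdd D e g -> 0 <= v -> v <= L ->
  `|hflow n g v z| <= D * hcst L * wt e z / (s * Num.sqrt v) ^+ n.
Proof.
move=> D0 e0 mg gD v0 vL; have [h1 h2] := hflow_arg z v0 vL.
have sv : 0 <= s * Num.sqrt v by rewrite mulr_ge0 ?sqrtr_ge0// ltW.
rewrite /hflow normrM normfV (ger0_norm (exprn_ge0 n sv)).
rewrite ler_wpM2r ?invr_ge0 ?exprn_ge0//.
have M0 := le_trans sv h2.
have h3 : `|s * Num.sqrt v| <= `|m| * L + s * Num.sqrt L by rewrite ger0_norm.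
apply: (le_trans (gavg_le n D0 e0 mg gD h1 h3)).
apply: (ler_wpM2r (wt_ge0 z e0)); apply: (ler_wpM2l D0).
by apply: gcst_mono => //; rewrite lerDl.
Qed.

Lemma hflow0_le g (D e L v z : R) : 0 <= D -> 0 <= e ->
  measurable_fun setT g -> bdd D e g -> 0 <= v -> v <= L ->
  `|hflow 0 g v z| <= D * hcst L * wt e z.
Proof.
by move=> D0 e0 mg gD v0 vL; have := hflow_le 0 z D0 e0 mg gD v0 vL; rewrite expr0 divr1.
Qed.

(** [Num.sqrt L] serves the undifferentiated flow, and [s^-1] the first two derivatives, which cost
    1 / (s sqrt v). *)
Definition hcst2 (L : R) : R := hcst L * (Num.sqrt L + s^-1).

Lemma hcst2_ge0 L : 0 <= hcst2 L.
Proof. by rewrite mulr_ge0 ?hcst_ge0// addr_ge0 ?sqrtr_ge0// invr_ge0 ltW. Qed.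

(* The Lipschitz bound trades one factor [1 / sqrt v] of the second derivative
   for regularity of [g], which makes the singularity at [v = 0] integrable. *)
Lemma hflow_sqrt_le n g (D e L v z : R) : (n <= 2)%N -> 0 <= D -> 0 <= e ->
  measurable_fun setT g -> bdd D e g -> wlip D e g -> 0 < v -> v <= L ->
  `|hflow n g v z| <= D * hcst2 L * wt e z * (Num.sqrt v)^-1.
Proof.
move=> n2 D0 e0 mg gD gL v0 vL.
have L0 : 0 < L := lt_le_trans v0 vL.
have sv : 0 < Num.sqrt v by rewrite sqrtr_gt0.
have ssv : 0 < s * Num.sqrt v by rewrite mulr_gt0.
have C0 : 0 <= D * hcst L * wt e z by rewrite !mulr_ge0 ?hcst_ge0 ?wt_ge0.
have H0 : D * hcst L * wt e z <= D * hcst L * Num.sqrt L * wt e z / Num.sqrt v.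
  rewrite ler_pdivlMr// (_ : D * hcst L * Num.sqrt L * wt e z =
    D * hcst L * wt e z * Num.sqrt L); last by ring.
  by apply: (ler_wpM2l C0); rewrite ler_wsqrtr.
have H1 : D * hcst L * wt e z / (s * Num.sqrt v) = D * hcst L * s^-1 * wt e z / Num.sqrt v.
  by field; rewrite !gt_eqF.
have HE : D * hcst2 L * wt e z / Num.sqrt v = D * hcst L * Num.sqrt L * wt e z / Num.sqrt v
   + D * hcst L * s^-1 * wt e z / Num.sqrt v.
  by rewrite /hcst2; ring.
have P1 : 0 <= D * hcst L * Num.sqrt L * wt e z / Num.sqrt v.
  exact: le_trans H0.
have P2 : 0 <= D * hcst L * s^-1 * wt e z / Num.sqrt v.
  by rewrite -H1 divr_ge0// ltW.
rewrite HE; case: n n2 => [|[|[|//]]] _.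
- apply: (le_trans (hflow0_le z D0 e0 mg gD (ltW v0) vL)).
  by rewrite ler_wpDr.
- apply: (le_trans (hflow_le 1 z D0 e0 mg gD (ltW v0) vL)).
  by rewrite expr1 H1 ler_wpDl.
- have [h1 h2] := hflow_arg z (ltW v0) vL.
  have h3 := gavg2_lip D0 D0 e0 mg gD gL h1 ssv h2.
  rewrite /hflow normrM normfV (gtr0_norm (exprn_gt0 2 ssv)).
  rewrite ler_wpDl// -H1 ler_pdivrMr ?exprn_gt0//.
  apply: (le_trans h3); rewrite -/(hcst L) le_eqVlt; apply/orP; left; apply/eqP.
  by field; rewrite !gt_eqF.
Qed.

Lemma hflow_derive_z n g (D e v z : R) : (n <= 1)%N -> 0 < v ->
  0 <= D -> 0 <= e <= 1 -> measurable_fun setT g -> bdd D e g ->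
  is_derive z 1 (hflow n g v) (hflow n.+1 g v z).
Proof.
move=> n1 v0 D0 e01 mg gD.
have c0 : 0 < s * Num.sqrt v by rewrite mulr_gt0// sqrtr_gt0.
have dz : is_derive z 1 (fun t => t + m * v) 1.
  by apply: (dereq (derD (derid z) (derc z (m * v)))); rewrite addr0.
case: n n1 => [|[|//]] _.
- have H := @gavg0_derive R g (fun t => t + m * v) (fun=> s * Num.sqrt v)
    (fun=> 1) (fun=> 0) z 1 (`|z| + 1 + `|m * v| + 1) (s * Num.sqrt v) (s * Num.sqrt v)
    D e ltr01 D0 e01 mg gD c0.
  have {}H := H (fun t _ => conj (dereq (derD (derid t) (derc t (m * v))) (addr0 1)) (derc t _)).
  rewrite (_ : hflow 0 g v = (fun t => gavg 0 g (t + m * v) (s * Num.sqrt v))); last first.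
    by apply/funext => t; rewrite /hflow expr0 divr1.
  apply: (dereq (H _)); last first.
    by rewrite /hflow expr1 !mul0r addr0 mul1r mulrC.
  move=> t tz; have tM : `|t| <= `|z| + 1.
    rewrite -[t](subrK z) (le_trans (ler_normD _ _))// addrC lerD2l ltW//.
  split; rewrite ?lexx//.
  + by apply: (le_trans (ler_normD _ _)); move: tM; lra.
  + by have := normr_ge0 z; have := normr_ge0 (m * v); rewrite normr1; lra.
  + by have := normr_ge0 z; have := normr_ge0 (m * v); rewrite normr0; lra.
- have H := gavg1_derive (z + m * v) c0 D0 e01 mg gD.
  have H2 := derM (@dercomp _ (fun t => t + m * v) _ z _ _ H dz) (derc z ((s * Num.sqrt v) ^+ 1)^-1).
  apply: (dereq H2); rewrite /hflow; set c := s * Num.sqrt v.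
  by field; rewrite gt_eqF.
Qed.

(** The heat equation with drift: for c = s sqrt v one has c' / c = 1 / (2v) = (s^2 / 2) / c^2,
    which is the normalisation of the second derivative. *)
Lemma hflow_derive_v g (D e v z : R) : 0 < v ->
  0 <= D -> 0 <= e <= 1 -> measurable_fun setT g -> bdd D e g ->
  is_derive v 1 (fun v => hflow 0 g v z)
    (m * hflow 1 g v z + s ^+ 2 / 2 * hflow 2 g v z).
Proof.
move=> v0 D0 e01 mg gD.
have sv : 0 < Num.sqrt v by rewrite sqrtr_gt0.
pose c1 := s * Num.sqrt (v / 2).
have c10 : 0 < c1 by rewrite mulr_gt0// sqrtr_gt0 divr_gt0.
pose M := `|z| + `|m| * (2 * v) + `|m| + s / (2 * Num.sqrt (v / 2)).
have d0 : 0 < v / 2 by rewrite divr_gt0.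
have tv (t : R) : `|t - v| < v / 2 -> v / 2 < t < 2 * v.
  by rewrite ltr_norml => /andP[? ?]; apply/andP; split; lra.
have H := @gavg0_derive R g (fun t => z + m * t) (fun t => s * Num.sqrt t)
  (fun=> m) (fun t => s * (2 * Num.sqrt t)^-1) v (v / 2) M c1 (s * Num.sqrt (2 * v))
  D e d0 D0 e01 mg gD c10.
rewrite (_ : (fun v => hflow 0 g v z) = (fun t => gavg 0 g (z + m * t) (s * Num.sqrt t))); last first.
  by apply/funext => t; rewrite /hflow expr0 divr1.
apply: (dereq (H _ _)).
- move=> t /tv /andP[t0 _]; split.
    by apply: (dereq (derD (derc t z) (derZ m (derid t)))); rewrite add0r mulr1.
  exact/derZ/is_derive1_sqrt/(lt_trans d0).
- move=> t /tv /andP[t0 t2]; have t1 := lt_trans d0 t0.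
  have st : 0 < Num.sqrt t by rewrite sqrtr_gt0.
  have hM1 : 0 <= s / (2 * Num.sqrt (v / 2)) by rewrite divr_ge0 ?mulr_ge0 ?sqrtr_ge0// ltW.
  have hM2 : 0 <= `|m| * (2 * v) by rewrite mulr_ge0// mulr_ge0// ltW.
  have hst : Num.sqrt (v / 2) <= Num.sqrt t by rewrite ler_wsqrtr// ltW.
  split.
  + apply: (le_trans (ler_normD _ _)); rewrite /M -!addrA lerD2l.
    rewrite normrM (gtr0_norm t1) ler_wpDr ?addr_ge0// ler_wpM2l// ltW//.
  + by rewrite /M addrAC lerDr !addr_ge0.
  + rewrite gtr0_norm; last by rewrite mulr_gt0// invr_gt0 mulr_gt0.
    rewrite /M ler_wpDl ?addr_ge0// ler_wpM2l ?(ltW s_gt0)//.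
    by rewrite lef_pV2 ?posrE ?mulr_gt0 ?sqrtr_gt0// ler_wpM2l.
  + by rewrite /c1 !ler_wpM2l ?(ltW s_gt0)// ?ler_wsqrtr// ltW.
- rewrite /hflow; have /eqP sE := sqr_sqrtr (ltW v0).
  by field; rewrite !gt_eqF.
Qed.

Lemma hflow_cvg (X : pseudoMetricType R) (p : X) (v z : X -> R) (G : X -> R -> R)
    n (D e : R) : 0 <= D -> 0 <= e -> (n = 0%N \/ 0 < v p) ->
  {for p, continuous v} -> {for p, continuous z} ->
  (\forall x \near p, measurable_fun setT (G x)) ->
  (\forall x \near p, bdd D e (G x)) ->
  (forall u : X -> R, {for p, continuous u} ->
     G x (u x) @[x --> p] --> G p (u p)) ->
  hflow n (G x) (v x) (z x) @[x --> p] --> hflow n (G p) (v p) (z p).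
Proof.
move=> D0 e0 nv cv cz mG GD Gc.
have cs : {for p, continuous (fun x => s * Num.sqrt (v x))}.
  apply: cvgM; first exact: cvg_cst.
  exact: (continuous_comp cv (@sqrt_continuous R _)).
apply: cvgM.
  apply: (@gavg_cvg _ _ p (fun x => z x + m * v x) (fun x => s * Num.sqrt (v x)) G n D e) => //.
  by apply: cvgD => //; apply: cvgM => //; exact: cvg_cst.
case: nv => [->|vp].
  rewrite (_ : (fun x => _) = cst 1); first by rewrite expr0 invr1; exact: cvg_cst.
  by apply/funext => x; rewrite expr0 invr1.
apply: cvgV; first by rewrite expf_eq0 negb_and mulf_eq0 negb_or !gt_eqF ?sqrtr_gt0// orbT.
exact: (continuous_comp cs (@exprn_continuous _ n _)).
Qed.

Lemma hflow_ge0 g (v z : R) : (forall x, 0 <= g x) -> 0 <= hflow 0 g v z.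
Proof. by move=> g0; rewrite /hflow expr0 divr1; exact: gavg_ge0. Qed.

Lemma hflow_at0 g z : hflow 0 g 0 z = g z.
Proof.
rewrite /hflow expr0 divr1 sqrtr0 !mulr0 addr0 /gavg.
rewrite (_ : (fun w => _) = (fun w => g z * gk 0 w)).
  exact: (gavg_cst (g z) 0 0).
by apply/funext => w; rewrite mul0r addr0.
Qed.

End heat_flow.

(** * Time integrals of Gaussian flows *)

Section time_integrals.
Context {R : realType}.
Implicit Types (g kap : R -> R -> R) (n : nat).

Definition cont_at g (u x : R) : Prop :=
  {for (u, x), continuous (fun q : R * R => g q.1 q.2)}.

Lemma cont_at_comp (X : topologicalType) (p : X) (a b : X -> R) g :
  {for p, continuous a} -> {for p, continuous b} -> cont_at g (a p) (b p) ->
  g (a x) (b x) @[x --> p] --> g (a p) (b p).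
Proof.
move=> ca cb cg.
exact: (cvg_comp (fun x => (a x, b x)) (fun q : R * R => g q.1 q.2) (cvg_pair ca cb) cg).
Qed.

Lemma cont_at_r g u : (forall x, cont_at g u x) -> continuous (g u).
Proof.
move=> cg x; by apply: (@cont_at_comp _ x (fun=> u) id) => //; exact: cvg_cst.
Qed.

Lemma cont_at_mfun g u : (forall x, cont_at g u x) -> measurable_fun setT (g u).
Proof. by move=> cg; apply: continuous_measurable_fun; exact: cont_at_r. Qed.

Lemma loc_bound kap (y0 L : R) : 0 <= L -> (forall y v, cont_at kap y v) ->
  exists2 Q, 0 <= Q & forall y v, `|y - y0| <= 1 -> 0 <= v <= L -> `|kap y v| <= Q.
Proof.
move=> L0 ck.
pose A : set (R * R) := `[y0 - 1, y0 + 1]%classic `*` `[0, L]%classic.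
have cA : compact A by apply: compact_setX; exact: segment_compact.
have ci : compact [set kap q.1 q.2 | q in A].
  apply: (@continuous_compact _ _ (fun q : R * R => kap q.1 q.2)) => //.
  by apply: continuous_subspaceT => -[y v]; exact: ck.
have /(_ ci)[M [_ HM]] := @compact_bounded R R^o [set kap q.1 q.2 | q in A].
exists (`|M| + 1) => [|y v yy vL]; first by rewrite addr_ge0.
apply: (HM (`|M| + 1)); first by rewrite (le_lt_trans (ler_norm _))// ltrDl.
exists (y, v) => //; split => /=; rewrite in_itv//=.
by move: yy; rewrite ler_distlC => /andP[? ?]; apply/andP; split; lra.
Qed.

Variables (m s L : R).
Hypotheses (s_gt0 : 0 < s) (L_gt0 : 0 < L).
Local Notation hf := (hflow m s).

(* One regime switch: [kap y v] is the density of a switch after a further time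
   [v] at age [y], and [g (t - v)] the value then, seen from log-price [z]; [n]
   counts derivatives in [z]. *)
Definition jop n kap g (y t z : R) : R :=
  intR (cut 0 t (fun v => kap y v * hf n (g (t - v)) v z)).

Lemma prod4_ge0 (a b c d : R) : 0 <= a -> 0 <= b -> 0 <= c -> 0 <= d ->
  0 <= a * b * c * d.
Proof. by move=> ? ? ? ?; rewrite !mulr_ge0. Qed.


Let h1_ge0 := hcst_ge0 m s L.
Let h2_ge0 := hcst2_ge0 m s_gt0 L.

(** Negative times are included so that continuity at time 0 is two-sided and neighbourhoods of 0
    need no special treatment; the solution is extended to them by its initial value. *)
Definition regular (D e : R) g : Prop :=
  [/\ forall u x, u < L -> cont_at g u x,
      forall u, u < L -> bdd D e (g u) &
      forall u, u < L -> wlip D e (g u)].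

(* The kink of the payoff makes time derivatives blow up like [1 / sqrt u]. *)
Definition singular (D e : R) g : Prop :=
  (forall u x, 0 < u < L -> cont_at g u x) /\
  (forall u, 0 < u < L -> bdd (D * (Num.sqrt u)^-1) e (g u)).

Lemma regular_singular D e g : 0 <= D -> 0 <= e -> regular D e g ->
  singular (D * Num.sqrt L) e g.
Proof.
move=> D0 e0 [gc gb _]; split=> [u x /andP[_ uL]|u /andP[u0 uL] x]; first exact: gc.
apply: (le_trans (gb u uL x)); rewrite ler_wpM2r ?wt_ge0//.
rewrite ler_pdivlMr ?sqrtr_gt0//; apply: ler_wpM2l => //.
by rewrite ler_wsqrtr// ltW.
Qed.

Lemma flow_cvg (X : pseudoMetricType R) (p : X) (U v z : X -> R) g n (D e : R) :
  0 <= D -> 0 <= e -> (n = 0%N \/ 0 < v p) ->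
  {for p, continuous U} -> {for p, continuous v} -> {for p, continuous z} ->
  (\forall u \near U p, (forall x, cont_at g u x) /\ bdd D e (g u)) ->
  hf n (g (U x)) (v x) (z x) @[x --> p] --> hf n (g (U p)) (v p) (z p).
Proof.
move=> D0 e0 nv cU cv cz H.
have cg := (nbhs_singleton H).1.
have H' : \forall x \near p, (forall y, cont_at g (U x) y) /\ bdd D e (g (U x)).
  exact: (cU _ H).
apply: (@hflow_cvg _ _ _ s_gt0 _ p v z (fun x => g (U x)) n D e) => //.
- by apply: filterS H' => x [? _]; exact: cont_at_mfun.
- by apply: filterS H' => x [].
- by move=> u cu; exact: (@cont_at_comp _ p U u g cU cu (cg (u p))).
Qed.

Lemma singular_near D e g (u : R) : 0 <= D -> 0 <= e -> 0 < u < L ->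
  singular D e g ->
  \forall t \near u, (forall x, cont_at g t x) /\ bdd (D * (Num.sqrt (u / 2))^-1) e (g t).
Proof.
move=> D0 e0 /andP[u0 uL] [gc gb].
have u2 : u / 2 < u by rewrite ltr_pdivrMr// ltr_pMr// ltr1n.
near=> t.
have t2 : u / 2 < t by near: t; exact: lt_nbhsr.
have tL : t < L by near: t; exact: lt_nbhsl.
have t0 : 0 < t by apply: lt_trans t2; rewrite divr_gt0.
split => [x|x]; first by apply: gc; rewrite t0.
apply: (le_trans (gb t _ x)); first by rewrite t0.
rewrite ler_wpM2r ?wt_ge0//; apply: ler_wpM2l => //.
rewrite lef_pV2 ?posrE ?sqrtr_gt0 ?divr_gt0// ler_wsqrtr// ltW//.
Unshelve. all: end_near. Qed.

Lemma regular_near D e g (u : R) : u < L -> regular D e g ->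
  \forall t \near u, (forall x, cont_at g t x) /\ bdd D e (g t).
Proof.
move=> uL [gc gb _]; near=> t.
have tL : t < L by near: t; exact: lt_nbhsl.
by split => [x|]; [exact: gc|exact: gb].
Unshelve. all: end_near. Qed.

Lemma jop_mfun n kap g D e y t z : 0 <= D -> 0 <= e ->
  (forall y v, cont_at kap y v) -> singular D e g -> t < L ->
  measurable_fun setT (cut 0 t (fun v => kap y v * hf n (g (t - v)) v z)).
Proof.
move=> D0 e0 ck gS tL; apply: mfun_cut => v /andP[v0 vt].
have u0L : 0 < t - v < L by rewrite subr_gt0 vt/= (le_lt_trans _ tL)// gerBl ltW.
apply: cvgM; first by apply: (cont_at_r (ck y)).
apply: (@flow_cvg _ v (fun v => t - v) id (fun=> z) g n
  (D * (Num.sqrt ((t - v) / 2))^-1) e) => //.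
- by rewrite mulr_ge0// invr_ge0 sqrtr_ge0.
- by right.
- by apply: cvgB; [exact: cvg_cst|exact: cvg_id].
- exact: cvg_cst.
- exact: (singular_near D0 e0 u0L gS).
Qed.

Lemma jop_int n kap g D e y t z B : 0 <= D -> 0 <= e ->
  (forall y v, cont_at kap y v) -> singular D e g -> t < L ->
  intgR (cut 0 t B) ->
  (forall v, 0 < v < t -> `|kap y v * hf n (g (t - v)) v z| <= B v) ->
  intgR (cut 0 t (fun v => kap y v * hf n (g (t - v)) v z)) /\
  `|jop n kap g y t z| <= intR (cut 0 t B).
Proof.
move=> D0 e0 ck gS tL iB HB.
have mf := jop_mfun n y z D0 e0 ck gS tL.
have le v : `|cut 0 t (fun v => kap y v * hf n (g (t - v)) v z) v| <= cut 0 t B v.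
  by rewrite /cut; case: ifP => [/HB//|_]; rewrite normr0.
by split; [exact: intgR_le iB|exact: intR_norm_le].
Qed.

Lemma regular_dom n kap g D e y t z Q : (n <= 2)%N -> 0 <= D -> 0 <= e ->
  regular D e g -> t < L -> 0 <= Q ->
  (forall v, 0 <= v <= L -> `|kap y v| <= Q) ->
  forall v, 0 < v < t -> `|kap y v * hf n (g (t - v)) v z| <=
    Q * D * hcst2 m s L * wt e z * (Num.sqrt v)^-1.
Proof.
move=> n2 D0 e0 gR tL Q0 kQ v /andP[v0 vt].
have [gc gb gl] := gR.
have uL : t - v < L by rewrite ltrBlDr (lt_trans tL)// ltrDl.
have vL : v <= L by rewrite ltW// (lt_trans vt).
have h1 : `|kap y v| <= Q by apply: kQ; rewrite (ltW v0).
have h2 := hflow_sqrt_le m s_gt0 z n2 D0 e0 (cont_at_mfun (fun x => gc _ x uL))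
  (gb _ uL) (gl _ uL) v0 vL.
rewrite normrM; apply: (le_trans (ler_pM _ _ h1 h2)) => //.
by rewrite !mulrA.
Qed.

Lemma isqrt_cut_intgR (C t : R) : 0 < t -> intgR (cut 0 t (fun v => C * (Num.sqrt v)^-1)).
Proof.
move=> t0; have [i _] := isqrt_cut_int t0.
have := intgRZ C i; congr intgR; apply/funext => v.
by rewrite /cut; case: ifP => // _; rewrite mulr0.
Qed.

Lemma isqrt_cut_le (C t : R) : 0 <= C -> 0 < t ->
  intR (cut 0 t (fun v => C * (Num.sqrt v)^-1)) <= C * (2 * Num.sqrt t).
Proof.
move=> C0 t0; have [i le] := isqrt_cut_int t0.
have -> : cut 0 t (fun v => C * (Num.sqrt v)^-1) = (fun v => C * cut 0 t (fun v => (Num.sqrt v)^-1) v).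
  by apply/funext => v; rewrite /cut; case: ifP => // _; rewrite mulr0.
by rewrite intRZ// ler_wpM2l.
Qed.

Lemma jop_regular_le n kap g D e y t z Q : (n <= 2)%N -> 0 <= D -> 0 <= e ->
  (forall y v, cont_at kap y v) -> regular D e g -> 0 < t < L -> 0 <= Q ->
  (forall v, 0 <= v <= L -> `|kap y v| <= Q) ->
  intgR (cut 0 t (fun v => kap y v * hf n (g (t - v)) v z)) /\
  `|jop n kap g y t z| <= Q * D * hcst2 m s L * wt e z * (2 * Num.sqrt t).
Proof.
move=> n2 D0 e0 ck gR /andP[t0 tL] Q0 kQ.
have D0' : 0 <= D * Num.sqrt L by rewrite mulr_ge0// sqrtr_ge0.
have C0 : 0 <= Q * D * hcst2 m s L * wt e z.
  by apply: prod4_ge0 => //; exact: wt_ge0.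
have [i le] := jop_int D0' e0 ck (regular_singular D0 e0 gR) tL
  (isqrt_cut_intgR _ t0) (regular_dom z n2 D0 e0 gR tL Q0 kQ).
by split => //; apply: (le_trans le); exact: isqrt_cut_le.
Qed.

Lemma cut_le0 (t v : R) f : t <= 0 -> cut 0 t f v = 0.
Proof.
by move=> t0; rewrite /cut; case: ifP => // /andP[v0 vt]; move: (lt_le_trans vt t0); rewrite ltNge ltW.
Qed.

Lemma jop_le0 n kap g (y t z : R) : t <= 0 -> jop n kap g y t z = 0.
Proof.
move=> t0; rewrite /jop (_ : cut _ _ _ = cst 0) ?/intR ?Rintegral_cst ?mul0r//.
by apply/funext => v; rewrite cut_le0.
Qed.

(** For regular [g] the integrand is singular at [v = 0] only, which stays put as the upper end
    moves: a single majorant on []0, L[] serves. *)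
Lemma jop_cvg_regular (X : pseudoMetricType R) (p : X) (Y t z : X -> R)
    n kap g D e : (n <= 2)%N -> 0 <= D -> 0 <= e ->
  (forall y v, cont_at kap y v) -> regular D e g -> t p < L ->
  {for p, continuous Y} -> {for p, continuous t} -> {for p, continuous z} ->
  jop n kap g (Y x) (t x) (z x) @[x --> p] --> jop n kap g (Y p) (t p) (z p).
Proof.
move=> n2 D0 e0 ck gR tL cY ct cz.
have [Q Q0 HQ] := loc_bound (Y p) (ltW L_gt0) ck.
have nY : \forall x \near p, `|Y x - Y p| <= 1.
  have : \forall x \near p, `|Y p - Y x| < 1 by move/cvgrPdist_lt : cY; apply.
  by apply: filterS => x h; rewrite distrC ltW.
have nz : \forall x \near p, `|z x - z p| <= 1.
  have : \forall x \near p, `|z p - z x| < 1 by move/cvgrPdist_lt : cz; apply.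
  by apply: filterS => x h; rewrite distrC ltW.
have nt : \forall x \near p, t x < L by exact: (cvgr_lt (t p)).
have D0' : 0 <= D * Num.sqrt L by rewrite mulr_ge0// sqrtr_ge0.
apply: (@intR_cvg _ _ p
  (fun x => cut 0 (t x) (fun v => kap (Y x) v * hf n (g (t x - v)) v (z x)))
  (cut 0 L (fun v => Q * D * hcst2 m s L * (expR 1 * wt e (z p)) * (Num.sqrt v)^-1)) (t p)).
- apply: filterS nt => x tx.
  exact: (jop_mfun n (Y x) (z x) D0' e0 ck (regular_singular D0 e0 gR) tx).
- exact: isqrt_cut_intgR.
- apply: filterS3 nY nz nt => x Yx zx tx v.
  rewrite /cut; case: ifP => [/andP[v0 vt]|_]; last first.
    rewrite normr0; case: ifP => // _.
    apply: mulr_ge0; last by rewrite invr_ge0 sqrtr_ge0.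
    by apply: prod4_ge0 => //; rewrite mulr_ge0 ?expR_ge0 ?wt_ge0.
  rewrite v0 (lt_trans vt tx)/=.
  have vin : 0 < v < t x by rewrite v0.
  have := regular_dom (z x) n2 D0 e0 gR tx Q0 (fun v => HQ (Y x) v Yx) vin.
  move=> /le_trans; apply; rewrite ler_wpM2r ?invr_ge0 ?sqrtr_ge0//.
  apply: ler_wpM2l; first by rewrite mulr_ge0// mulr_ge0.
  rewrite -[z x](subrK (z p)) addrC (le_trans (wt_shift _ _ e0))//.
  by rewrite ler_wpM2r ?wt_ge0// ler_expR.
- move=> v vt; have [v0|v0] := leP v 0.
    rewrite /cut ltNge v0/=; exact: cvg_cst.
  have [vtp|vtp|vE] := ltgtP v (t p); last by rewrite vE eqxx in vt.
    apply: (@cvg_trans _ ((kap (Y x) v * hf n (g (t x - v)) v (z x)) @[x --> p])).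
      apply: near_eq_cvg; have : \forall x \near p, v < t x by exact: (cvgr_gt (t p)).
      by apply: filterS => x vx; rewrite /cut v0 vx.
    rewrite /cut v0 vtp/=; apply: cvgM.
      by apply: (@cont_at_comp _ p Y (fun=> v)) => //; exact: cvg_cst.
    apply: (@flow_cvg _ p (fun x => t x - v) (fun=> v) z g n D e) => //.
    + by right.
    + by apply: cvgB => //; exact: cvg_cst.
    + exact: cvg_cst.
    + have uL : t p - v < L by rewrite ltrBlDr (lt_trans tL)// ltrDl.
      exact: (regular_near uL gR).
  apply: cvg_near_cst.
  have : \forall x \near p, t x < v by exact: (cvgr_lt (t p)).
  apply: filterS => x vx.
  by rewrite /cut v0 !ltNge (ltW vx) (ltW vtp).
Qed.

Lemma singular_dom kap g D e y t z Q : 0 <= D -> 0 <= e ->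
  singular D e g -> t < L -> 0 <= Q ->
  (forall v, 0 <= v <= L -> `|kap y v| <= Q) ->
  forall v, 0 < v < t -> `|kap y v * hf 0 (g (t - v)) v z| <=
    Q * D * hcst m s L * wt e z * (Num.sqrt (t - v))^-1.
Proof.
move=> D0 e0 [gc gb] tL Q0 kQ v /andP[v0 vt].
have uL : 0 < t - v < L by rewrite subr_gt0 vt/= ltrBlDr (lt_trans tL)// ltrDl.
have vL : v <= L by rewrite ltW// (lt_trans vt).
have h1 : `|kap y v| <= Q by apply: kQ; rewrite (ltW v0).
have D'0 : 0 <= D * (Num.sqrt (t - v))^-1 by rewrite mulr_ge0// invr_ge0 sqrtr_ge0.
have h2 := hflow0_le m s_gt0 z D'0 e0 (cont_at_mfun (fun x => gc _ x uL))
  (gb _ uL) (ltW v0) vL.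
rewrite normrM; apply: (le_trans (ler_pM _ _ h1 h2)) => //.
by rewrite le_eqVlt; apply/orP; left; apply/eqP; ring.
Qed.

Lemma jop_singular_int kap g D e y t z : 0 <= D -> 0 <= e ->
  (forall y v, cont_at kap y v) -> singular D e g -> 0 < t < L ->
  intgR (cut 0 t (fun v => kap y v * hf 0 (g (t - v)) v z)).
Proof.
move=> D0 e0 ck gS /andP[t0 tL].
have [Q Q0 HQ] := loc_bound y (ltW L_gt0) ck.
have kQ v : 0 <= v <= L -> `|kap y v| <= Q by apply: HQ; rewrite subrr normr0.
have [] // := jop_int D0 e0 ck gS tL _ (singular_dom z D0 e0 gS tL Q0 kQ).
exact: (intgR_cut_refl (isqrt_cut_intgR _ t0)).
Qed.

Lemma jop_refl n kap g (y t z : R) :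
  intgR (cut 0 t (fun v => kap y v * hf n (g (t - v)) v z)) ->
  jop n kap g y t z = intR (cut 0 t (fun w => kap y (t - w) * hf n (g w) (t - w) z)).
Proof.
move=> i; rewrite /jop -(intR_cut_refl i); congr intR; apply/funext => w.
by rewrite /cut; case: ifP => // _; rewrite subKr.
Qed.

(** Here the singularity of [g (t - v)] sits at the moving end [v = t]; the reflection w = t - v
    brings it to the fixed end 0. *)
Lemma jop_cvg_singular (X : pseudoMetricType R) (p : X) (Y t z : X -> R)
    kap g D e : 0 <= D -> 0 <= e ->
  (forall y v, cont_at kap y v) -> singular D e g -> 0 < t p < L ->
  {for p, continuous Y} -> {for p, continuous t} -> {for p, continuous z} ->
  jop 0 kap g (Y x) (t x) (z x) @[x --> p] --> jop 0 kap g (Y p) (t p) (z p).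
Proof.
move=> D0 e0 ck gS /andP[t0 tL] cY ct cz.
have [Q Q0 HQ] := loc_bound (Y p) (ltW L_gt0) ck.
have nY : \forall x \near p, `|Y x - Y p| <= 1.
  have : \forall x \near p, `|Y p - Y x| < 1 by move/cvgrPdist_lt : cY; apply.
  by apply: filterS => x h; rewrite distrC ltW.
have nz : \forall x \near p, `|z x - z p| <= 1.
  have : \forall x \near p, `|z p - z x| < 1 by move/cvgrPdist_lt : cz; apply.
  by apply: filterS => x h; rewrite distrC ltW.
have nt : \forall x \near p, 0 < t x < L.
  have n1 : \forall x \near p, t x < L by exact: (cvgr_lt (t p)).
  have n2 : \forall x \near p, 0 < t x by exact: (cvgr_gt (t p)).
  by apply: filterS2 n1 n2 => x ? ?; apply/andP.
have fE x : 0 < t x < L -> jop 0 kap g (Y x) (t x) (z x) =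
    intR (cut 0 (t x) (fun w => kap (Y x) (t x - w) * hf 0 (g w) (t x - w) (z x))).
  by move=> tx; rewrite jop_refl//; exact: (jop_singular_int _ _ D0 e0 ck gS tx).
rewrite fE ?t0//.
apply: (@cvg_trans _ (intR (cut 0 (t x) (fun w => kap (Y x) (t x - w) * hf 0 (g w) (t x - w) (z x))) @[x --> p])).
  by apply: near_eq_cvg; apply: filterS nt => x tx; rewrite fE.
apply: (@intR_cvg _ _ p
  (fun x => cut 0 (t x) (fun w => kap (Y x) (t x - w) * hf 0 (g w) (t x - w) (z x)))
  (cut 0 L (fun v => Q * D * hcst m s L * (expR 1 * wt e (z p)) * (Num.sqrt v)^-1)) (t p)).
- apply: filterS nt => x tx.
  have i := jop_singular_int (Y x) (z x) D0 e0 ck gS tx.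
  have := intgR_mfun (intgR_cut_refl i).
  by congr measurable_fun; apply/funext => w; rewrite /cut; case: ifP => // _; rewrite subKr.
- exact: isqrt_cut_intgR.
- apply: filterS3 nY nz nt => x Yx zx /andP[t0x tx] v.
  rewrite /cut; case: ifP => [/andP[v0 vt]|_]; last first.
    rewrite normr0; case: ifP => // _.
    apply: mulr_ge0; last by rewrite invr_ge0 sqrtr_ge0.
    by apply: prod4_ge0 => //; rewrite mulr_ge0 ?expR_ge0 ?wt_ge0.
  rewrite v0 (lt_trans vt tx)/=.
  have vin : 0 < t x - v < t x by rewrite subr_gt0 vt/= gtrBl.
  have := singular_dom (z x) D0 e0 gS tx Q0 (fun v => HQ (Y x) v Yx) vin.
  rewrite subKr.
  move=> /le_trans; apply; rewrite ler_wpM2r ?invr_ge0 ?sqrtr_ge0//.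
  apply: ler_wpM2l; first by rewrite mulr_ge0// mulr_ge0.
  rewrite -[z x](subrK (z p)) addrC (le_trans (wt_shift _ _ e0))//.
  by rewrite ler_wpM2r ?wt_ge0// ler_expR.
- move=> v vt; have [v0|v0] := leP v 0.
    rewrite /cut ltNge v0/=; exact: cvg_cst.
  have [vtp|vtp|vE] := ltgtP v (t p); last by rewrite vE eqxx in vt.
    apply: (@cvg_trans _ ((kap (Y x) (t x - v) * hf 0 (g v) (t x - v) (z x)) @[x --> p])).
      apply: near_eq_cvg; have : \forall x \near p, v < t x by exact: (cvgr_gt (t p)).
      by apply: filterS => x vx; rewrite /cut v0 vx.
    have ctv : {for p, continuous (fun x => t x - v)} by apply: cvgB => //; exact: cvg_cst.
    rewrite /cut v0 vtp/=; apply: cvgM; first exact: (@cont_at_comp _ p Y (fun x => t x - v)).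
    have vL : 0 < v < L by rewrite v0 (lt_trans vtp).
    apply: (@flow_cvg _ p (fun=> v) (fun x => t x - v) z g 0 (D * (Num.sqrt (v / 2))^-1) e) => //.
    + by rewrite mulr_ge0// invr_ge0 sqrtr_ge0.
    + by left.
    + exact: cvg_cst.
    + exact: (singular_near D0 e0 vL gS).
  apply: cvg_near_cst.
  have : \forall x \near p, t x < v by exact: (cvgr_lt (t p)).
  apply: filterS => x vx.
  by rewrite /cut v0 !ltNge (ltW vx) (ltW vtp).
Qed.

Lemma jop_derive_z n kap g D e (y t z : R) : (n <= 1)%N -> 0 <= D -> 0 <= e <= 1 ->
  (forall y v, cont_at kap y v) -> regular D e g -> 0 < t < L ->
  is_derive z 1 (jop n kap g y t) (jop n.+1 kap g y t z).
Proof.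
move=> n1 D0 e01 ck gR /andP[t0 tL]; have [e0 _] := andP e01.
have [gc gb gl] := gR.
have n2 : (n <= 2)%N by apply: leq_trans n1 _.
have [Q Q0 HQ] := loc_bound y (ltW L_gt0) ck.
have kQ v : 0 <= v <= L -> `|kap y v| <= Q by apply: HQ; rewrite subrr normr0.
have t0L : 0 < t < L by rewrite t0.
pose G := cut 0 t (fun v => Q * D * hcst2 m s L * (expR 1 * wt e z) * (Num.sqrt v)^-1).
have [||||H _] := @intR_derive _
  (fun z => cut 0 t (fun v => kap y v * hf n (g (t - v)) v z))
  (cut 0 t (fun v => kap y v * hf n.+1 (g (t - v)) v z)) G z 0.
- exists 1 => //= x _.
  by have [] := jop_regular_le x n2 D0 e0 ck gR t0L Q0 kQ.
- exact: isqrt_cut_intgR.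
- exists 1 => //= x; rewrite /= distrC => xz v _; rewrite /G /cut.
  case: ifP => [v0t|_]; last by rewrite subrr normr0 mulr0.
  have [v0 vt] := andP v0t.
  have uL : t - v < L by rewrite ltrBlDr (lt_trans tL)// ltrDl.
  apply: (@der_lip _ (fun z => kap y v * hf n (g (t - v)) v z)
    (fun z => kap y v * hf n.+1 (g (t - v)) v z) z x 1) => // w wz.
    apply: derZ.
    exact: (hflow_derive_z m s_gt0 w n1 v0 D0 e01 (cont_at_mfun (fun x => gc _ x uL)) (gb _ uL)).
  have := regular_dom w (n1 : (n.+1 <= 2)%N) D0 e0 gR tL Q0 kQ v0t.
  move=> /le_trans; apply; rewrite ler_wpM2r ?invr_ge0 ?sqrtr_ge0//.
  apply: ler_wpM2l; first by rewrite mulr_ge0// mulr_ge0.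
  rewrite -[w](subrK z) addrC (le_trans (wt_shift _ _ e0))//.
  by rewrite ler_wpM2r ?wt_ge0// ler_expR ltW.
- move=> v _; rewrite /cut; case: ifP => [/andP[v0 vt]|_]; last exact: derc.
  have uL : t - v < L by rewrite ltrBlDr (lt_trans tL)// ltrDl.
  apply: derZ.
  exact: (hflow_derive_z m s_gt0 z n1 v0 D0 e01 (cont_at_mfun (fun x => gc _ x uL)) (gb _ uL)).
exact: H.
Qed.

End time_integrals.

(** * Differentiating a convolution with respect to its upper limit *)

Section moving_integral.
Context {R : realType}.
Implicit Types f g : R -> R.

(** Both g - f and g + f are nondecreasing. Derivatives are asked for in the open interval only, so
    that [g] may be a multiple of the square root on an interval starting at 0. *)
Lemma increment_le f g df dg (a b : R) : a <= b ->
  {within `[a, b], continuous f} -> {within `[a, b], continuous g} ->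
  (forall x, a < x < b -> is_derive x 1 f (df x)) ->
  (forall x, a < x < b -> is_derive x 1 g (dg x)) ->
  (forall x, a < x < b -> `|df x| <= dg x) ->
  `|f b - f a| <= g b - g a.
Proof.
rewrite le_eqVlt => /predU1P[<- *|ab cf cg fd gd fg]; first by rewrite !subrr normr0.
have H (h dh : R -> R) : {within `[a, b], continuous h} ->
    (forall x, a < x < b -> is_derive x 1 h (dh x)) ->
    (forall x, a < x < b -> 0 <= dh x) -> h a <= h b.
  move=> ch hd h0; have [c] := @MVT R h dh a b ab (fun x => hd x) ch.
  rewrite in_itv/= => /h0 dhc E.
  by rewrite -subr_ge0 E mulr_ge0// subr_ge0 ltW.
have cB : {within `[a, b], continuous (fun x => g x - f x)}.
  by move=> x; apply: cvgB; [exact: cg|exact: cf].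
have cD : {within `[a, b], continuous (fun x => g x + f x)}.
  by move=> x; apply: cvgD; [exact: cg|exact: cf].
have h1 : g a - f a <= g b - f b.
  apply: (H _ (fun x => dg x - df x) cB).
    by move=> x xab; apply: derB; [exact: gd|exact: fd].
  by move=> x xab; rewrite subr_ge0 (le_trans (ler_norm _))// fg.
have h2 : g a + f a <= g b + f b.
  apply: (H _ (fun x => dg x + df x) cD).
    by move=> x xab; apply: derD; [exact: gd|exact: fd].
  move=> x xab; rewrite -[df x]opprK subr_ge0 (le_trans (ler_norm _))// normrN.
  exact: fg.
rewrite ler_norml; apply/andP; split; lra.
Qed.

(** The singular factor is taken at the base point [b], which in the application is [t - v] with [t]
    fixed, so that the bound does not depend on the moving point [a]. Both signs occur because
    [Num.sqrt] vanishes on negative numbers. *)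
Lemma sqrt_lip (a b : R) : b != 0 ->
  `|Num.sqrt a - Num.sqrt b| <= `|a - b| * (Num.sqrt `|b|)^-1.
Proof.
move=> b0; have sb : 0 < Num.sqrt `|b| by rewrite sqrtr_gt0 normr_gt0.
rewrite ler_pdivlMr//.
have sa := sqrtr_ge0 a.
have [bp|bn|] := ltgtP 0 b; last by move=> E; rewrite -E eqxx in b0.
  have bE := sqr_sqrtr (ltW bp); rewrite (gtr0_norm bp) in sb *.
  have [a0|a0] := leP 0 a.
    have aE := sqr_sqrtr a0.
    have -> : a - b = (Num.sqrt a - Num.sqrt b) * (Num.sqrt a + Num.sqrt b).
      by rewrite -[in LHS]aE -[in LHS]bE; ring.
    by rewrite normrM ler_wpM2l// (le_trans _ (ler_norm _))// lerDr.
  rewrite (ler0_sqrtr (ltW a0)) sub0r normrN (gtr0_norm sb) -expr2 bE.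
  by rewrite distrC (le_trans _ (ler_norm _))// lerDl oppr_ge0 ltW.
rewrite (ler0_sqrtr (ltW bn)) subr0 (ger0_norm sa).
have [a0|a0] := leP 0 a; last by rewrite (ler0_sqrtr (ltW a0)) mul0r.
have aE := sqr_sqrtr a0; have bE := sqr_sqrtr (normr_ge0 b).
have : 0 <= (Num.sqrt a - Num.sqrt `|b|) ^+ 2 by rewrite sqr_ge0.
rewrite sqrrB aE bE (ltr0_norm bn) => H.
apply: (le_trans _ (ler_norm _)).
have := mulr_ge0 sa (ltW sb); rewrite (ltr0_norm bn) -mulr_natr in H *; lra.
Qed.

Lemma intgR_cont_cut f (a b : R) : (forall x, a <= x <= b -> {for x, continuous f}) ->
  intgR (cut a b f).
Proof.
move=> cf; apply/intgR_cut.
have : (@lebesgue_measure R).-integrable `[a, b] (EFin \o f).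
  apply: continuous_compact_integrable; first exact: segment_compact.
  apply: continuous_in_subspaceT => x; rewrite inE/= in_itv/=; exact: cf.
by apply: integrableS => //; exact: subset_itv_oo_cc.
Qed.

(* The substitution freezes the domain of integration: with [U] extended by
   [U 0] to negative times, [U (t - v) v - U 0 v] vanishes for [v >= t].  The
   bound on [V] makes [U] Lipschitz in [sqrt u], which dominates the difference
   quotients by [|t - v|^(-1/2)] on both sides of [v = t]. *)
Lemma moving_integral_derive (k : R -> R) (U V : R -> R -> R) (L t C : R) :
  0 < t < L -> 0 <= C -> continuous k ->
  (forall u v, u < L -> v < L -> cont_at U u v) ->
  (forall u v, 0 < u < L -> 0 < v < L -> is_derive u 1 (U ^~ v) (V u v)) ->
  (forall u v, 0 < u < L -> 0 < v < L -> `|V u v| <= C * (Num.sqrt u)^-1) ->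
  is_derive t 1 (fun t => intR (cut 0 t (fun v => k v * U (t - v) v)))
    (k t * U 0 t + intR (cut 0 t (fun v => k v * V (t - v) v))).
Proof.
move=> /andP[t0 tL] C0 ck cU dU VC.
pose W u v := U (Num.max u 0) v.
(* A fixed right end beyond [t], which all points close to [t] stay below. *)
pose l := (t + L) / 2.
have tl : t < l by rewrite midf_lt.
have lL : l < L by rewrite midf_lt.
have l0 : 0 < l := lt_trans t0 tl.
have L0 : 0 < L := lt_trans l0 lL.
have cUu u v : u < L -> v < L -> {for u, continuous (U ^~ v)}.
  move=> uL vL; apply: (@cont_at_comp _ _ u id (fun=> v) U) => //; last exact: cU.
  exact: cvg_cst.
have Uinc u1 u2 v : 0 <= u1 <= u2 -> u2 < L -> 0 < v < L ->
    `|U u2 v - U u1 v| <= 2 * C * `|Num.sqrt u2 - Num.sqrt u1|.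
  move=> /andP[u10 u12] u2L /andP[v0 vL].
  have inL x : u1 < x < u2 -> 0 < x < L.
    by move=> /andP[? ?]; apply/andP; split; [exact: (le_lt_trans u10)|exact: lt_trans u2L].
  apply: (le_trans (@increment_le (U ^~ v) (fun u => 2 * C * Num.sqrt u)
    (V ^~ v) (fun u => 2 * C * (2 * Num.sqrt u)^-1) u1 u2 u12 _ _ _ _ _)).
  - apply: continuous_in_subspaceT => x; rewrite inE/= in_itv/= => /andP[_ xu].
    by apply: cUu => //; exact: le_lt_trans u2L.
  - apply: continuous_subspaceT => x; apply: cvgM; first exact: cvg_cst.
    exact: sqrt_continuous.
  - by move=> x /inL xL; apply: dU => //; rewrite v0.
  - by move=> x /inL/andP[x0 _]; exact/derZ/is_derive1_sqrt.
  - move=> x /inL xL; apply: (le_trans (VC x v xL _)); first by rewrite v0.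
    rewrite le_eqVlt; apply/orP; left; apply/eqP.
    by field; rewrite gt_eqF// sqrtr_gt0; case/andP: xL.
  - by rewrite -mulrBr ler_wpM2l ?mulr_ge0// ler_norm.
have sqrtmax u : Num.sqrt (Num.max u 0) = Num.sqrt u :> R.
  by case: (leP u 0) => // u0; rewrite (ler0_sqrtr u0) sqrtr0.
have Winc u1 u2 v : u1 < L -> u2 < L -> 0 < v < L ->
    `|W u2 v - W u1 v| <= 2 * C * `|Num.sqrt u2 - Num.sqrt u1|.
  move=> u1L u2L vL; rewrite /W -(sqrtmax u1) -(sqrtmax u2).
  have m1 : 0 <= Num.max u1 0 by rewrite le_max lexx orbT.
  have m2 : 0 <= Num.max u2 0 by rewrite le_max lexx orbT.
  have M1 : Num.max u1 0 < L by rewrite gt_max u1L.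
  have M2 : Num.max u2 0 < L by rewrite gt_max u2L.
  have [le12|/ltW le21] := leP (Num.max u1 0) (Num.max u2 0).
    by apply: Uinc => //; rewrite m1.
  by rewrite distrC (distrC (Num.sqrt _)); apply: Uinc => //; rewrite m2.
have [Q Q0 HQ] : exists2 Q, 0 <= Q & forall v, 0 <= v <= L -> `|k v| <= Q.
  have [|Q Q0 HQ] := @loc_bound R (fun _ v => k v) 0 L (ltW L0).
    by move=> y v; apply: (cvg_comp snd k cvg_snd); exact: ck.
  by exists Q => // v vL; apply: (HQ 0 v) => //; rewrite subrr normr0.
(* The integral over []0, x[] is that of [b1 x] over the fixed []0, l[] plus that of [k v * U 0 v]
   over []0, x[]. The former is differentiated under the integral; the latter contributes the
   boundary term [k t * U 0 t]. *)
pose b1 x := cut 0 l (fun v => k v * (W (x - v) v - U 0 v)).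
have cW x v : x - v < L -> v < L -> {for v, continuous (fun v => W (x - v) v)}.
  move=> xL vL; apply: (@cont_at_comp _ _ v (fun v => Num.max (x - v) 0) id U) => //.
    apply: continuous_max; last exact: cvg_cst.
    by apply: cvgB; [exact: cvg_cst|exact: cvg_id].
  by apply: cU => //; rewrite gt_max xL.
have cU0 v : v < L -> {for v, continuous (U 0)}.
  move=> vL; apply: (@cont_at_comp _ _ v (fun=> 0) id U) => //; last exact: cU.
  exact: cvg_cst.
have ib1 x : x < L -> intgR (b1 x).
  move=> xL; apply: intgR_cont_cut => v /andP[v0 vl].
  have vL : v < L := le_lt_trans vl lL.
  apply: cvgM; first exact: ck.
  apply: cvgB; last exact: cU0.
  by apply: cW => //; rewrite ltrBlDr (lt_le_trans xL)// lerDl.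
pose G v := 2 * C * Q * (cut 0 t (fun v => (Num.sqrt (t - v))^-1) v
  + cut 0 L (fun v => (Num.sqrt v)^-1) (- t + 1 * v)).
have iG : intgR G.
  apply: intgRZ; apply: intgRD.
    exact: (intgR_cut_refl (isqrt_cut_int t0).1).
  exact: (intgR_affine (- t) (oner_neq0 _) (isqrt_cut_int L0).1).
have G0 v : 0 <= G v.
  by rewrite mulr_ge0// ?mulr_ge0// addr_ge0// /cut; case: ifP => // _; rewrite invr_ge0 sqrtr_ge0.
have nl : \forall x \near t, 0 < x < l.
  near=> x; apply/andP; split; near: x; [exact: lt_nbhsr|exact: lt_nbhsl].
have [||||D1 _] := @intR_derive _ b1 (cut 0 t (fun v => k v * V (t - v) v)) G t t.
- by apply: filterS nl => x /andP[_ xl]; apply: ib1; exact: lt_trans lL.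
- exact: iG.
- apply: filterS nl => x /andP[x0 xl] v vt; rewrite /b1 {1 2}/cut.
  case: ifP => [/andP[v0 vl]|_]; last by rewrite subrr normr0 mulr_ge0.
  have vL : 0 < v < L by rewrite v0 (lt_trans vl).
  rewrite -mulrBr normrM opprB addrA subrK.
  have xvL : x - v < L by rewrite ltrBlDr (lt_trans (lt_trans xl lL))// ltrDl.
  have tvL : t - v < L by rewrite ltrBlDr (lt_trans tL)// ltrDl.
  have h1 : `|k v| <= Q by apply: HQ; rewrite (ltW v0) (ltW (lt_trans vl lL)).
  apply: (le_trans (ler_pM _ _ h1 (Winc _ _ _ tvL xvL vL))) => //.
  have tv0 : t - v != 0 by rewrite subr_eq0 eq_sym.
  have := sqrt_lip (x - v) tv0.
  have -> : x - v - (t - v) = x - t by ring.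
  move=> h2; have CQ : 0 <= 2 * C * Q by rewrite !mulr_ge0.
  rewrite mulrA (mulrC Q); apply: (le_trans (ler_wpM2l CQ h2)).
  rewrite /G mulrCA; apply: ler_wpM2l => //; apply: ler_wpM2l => //.
  rewrite /cut mul1r; have [vlt|vlt|vE] := ltgtP v t; last by rewrite vE eqxx in vt.
    rewrite v0/= gtr0_norm ?subr_gt0// lerDl.
    by case: ifP => // _; rewrite invr_ge0 sqrtr_ge0.
  have vtL : v - t < L by rewrite ltrBlDr (lt_trans (lt_trans vl lL))// ltrDl.
  have -> : - t + v = v - t by rewrite addrC.
  rewrite andbF add0r subr_gt0 vlt vtL/=.
  by rewrite ltr0_norm ?subr_lt0// opprB.
- move=> v vt; rewrite /b1 /cut; have [v0|v0] := leP v 0.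
    by rewrite (_ : (fun x => _) = cst 0) //; exact: derc.
  have [vlt|vlt|vE] := ltgtP v t; last by rewrite vE eqxx in vt.
    rewrite (lt_trans vlt tl)/=.
    have vL : 0 < v < L by rewrite v0 (lt_trans vlt).
    have tvL : 0 < t - v < L by rewrite subr_gt0 vlt/= ltrBlDr (lt_trans tL)// ltrDl.
    have dt : is_derive t 1 (fun x => x - v) 1.
      by apply: (dereq (derB (derid t) (derc t v))); rewrite subr0.
    have D := derZ (k v) (derB (@dercomp _ (fun x => x - v) (U ^~ v) t _ _ (dU _ v tvL vL) dt) (derc t (U 0 v))).
    have D' : is_derive t 1 (fun x => k v * (U (x - v) v - U 0 v)) (k v * V (t - v) v).
      by apply: (dereq D); rewrite mulr1 subr0.
    apply: near_eq_is_derive D'; near=> x.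
    rewrite /W max_l// subr_ge0 ltW//; near: x; exact: lt_nbhsr.
  rewrite /=; apply: near_eq_is_derive (derc t 0).
  near=> x; case: ifP => // _.
  rewrite /W max_r ?subrr ?mulr0// subr_le0 ltW//; near: x; exact: lt_nbhsl.
have ib2 : intgR (cut 0 l (fun v => k v * U 0 v)).
  apply: intgR_cont_cut => v /andP[v0 vl].
  by apply: cvgM; [exact: ck|apply: cU0; exact: le_lt_trans lL].
have D2 : is_derive t 1 (fun x => intR (cut 0 x (fun v => k v * U 0 v))) (k t * U 0 t).
  apply: (@cut_derive _ 0 l t (fun v => k v * U 0 v)) => //; first by rewrite t0.
  by apply: cvgM; [exact: ck|apply: cU0].
rewrite addrC; apply: near_eq_is_derive (derD D1 D2).
apply: filterS nl => x /andP[x0 xl].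
have xL := lt_trans xl lL.
rewrite -intRD; first last.
- apply: intgR_le (intgR_norm ib2).
    apply: mfun_cut => v /andP[v0 vx].
    by apply: cvgM; [exact: ck|apply: cU0; exact: lt_trans xL].
  move=> v; rewrite /cut; case: ifP => [/andP[v0 vx]|_]; last by rewrite normr0.
  by rewrite v0 (lt_trans vx xl).
- exact: ib1.
congr intR; apply/funext => v; rewrite /b1 /cut.
have [v0|v0] := leP v 0; first by rewrite addr0.
have [vx|xv] := ltP v x.
  by rewrite (lt_trans vx xl)/= /W max_l ?subr_ge0 ?(ltW vx)//; ring.
by rewrite /= addr0; case: ifP => // _; rewrite /W max_r ?subr_le0// subrr mulr0.
Unshelve. all: end_near. Qed.

End moving_integral.

(** * Time and age derivatives of the contribution of one switch *)

Section integral_derivatives.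
Context {R : realType}.
Variables (m s L : R).
Hypotheses (s_gt0 : 0 < s) (L_gt0 : 0 < L).
Implicit Types (g dg kap : R -> R -> R).
Local Notation hf := (hflow m s).
Local Notation jp := (jop m s).

Lemma hflow0E (g : R -> R) v z : hf 0 g v z = gavg 0 g (z + m * v) (s * Num.sqrt v).
Proof. by rewrite /hflow expr0 divr1. Qed.

Lemma hflow_derive_param g dg (D C e u v z : R) : 0 <= D -> 0 <= C -> 0 <= e ->
  (forall u x, u < L -> cont_at g u x) -> (forall u, u < L -> bdd D e (g u)) ->
  (forall u x, 0 < u < L -> is_derive u 1 (g ^~ x) (dg u x)) ->
  (forall u, 0 < u < L -> bdd (C * (Num.sqrt u)^-1) e (dg u)) ->
  0 < u < L -> is_derive u 1 (fun u => hf 0 (g u) v z) (hf 0 (dg u) v z).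
Proof.
move=> D0 C0 e0 gc gb gd dgb /andP[u0 uL].
pose b := z + m * v; pose c := s * Num.sqrt v.
(* Within this radius times stay in []u / 2, L[], where the singular bound on [dg] is uniform. *)
pose d := Num.min (u / 2) (L - u).
have d0 : 0 < d by rewrite lt_min divr_gt0// subr_gt0.
have inL t : `|t - u| < d -> u / 2 < t < L.
  rewrite lt_min !ltr_norml => /andP[/andP[? ?] /andP[? ?]].
  by apply/andP; split; lra.
pose C2 := C * (Num.sqrt (u / 2))^-1.
have C20 : 0 <= C2 by rewrite mulr_ge0// invr_ge0 sqrtr_ge0.
have u20 : 0 < u / 2 by rewrite divr_gt0.
have [||||H _] := @intR_derive _ (fun u w => g u (b + c * w) * gk 0 w)
  (fun w => dg u (b + c * w) * gk 0 w) (fun w => C2 * wt e b * gdom `|c| w) u 0.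
- exists d => //= t; rewrite /= distrC => /inL/andP[_ tL].
  by apply: (gavg_int 0 b c D0 e0 _ (gb t tL)); apply: cont_at_mfun => x; exact: gc.
- exact/intgRZ/intgR_gdom.
- exists d => //= t; rewrite /= distrC => td w _.
  rewrite -mulrBl normrM.
  have h : `|g t (b + c * w) - g u (b + c * w)| <= `|t - u| * (C2 * wt e (b + c * w)).
    apply: (@der_lip _ (g ^~ (b + c * w)) (dg ^~ (b + c * w)) u t d) => // x /inL/andP[x2 xL].
      by apply: gd; rewrite (lt_trans u20 x2).
    have x0 := lt_trans u20 x2.
    apply: (le_trans (dgb x _ _)); first by rewrite x0.
    rewrite ler_wpM2r ?wt_ge0//; apply: ler_wpM2l => //.
    by rewrite lef_pV2 ?posrE ?sqrtr_gt0// ler_wsqrtr// ltW.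
  have wS : wt e (b + c * w) <= expR (`|c| + `|c| * `|w|) * wt e b.
    apply: (le_trans (wt_shift _ _ e0)); rewrite ler_wpM2r ?wt_ge0// ler_expR normrM.
    by rewrite lerDr.
  have k0 := gk_le 0 w.
  apply: (le_trans (ler_pM _ _ h k0)) => //.
  rewrite -[leLHS]mulrA; apply: ler_wpM2l => //.
  rewrite /gdom [leRHS](_ : _ = C2 * (expR (`|c| + `|c| * `|w|) * wt e b) * ((1 + w ^+ 2) * gam w)); last by ring.
  rewrite ler_wpM2r//; first by rewrite mulr_ge0 ?gam_ge0// addr_ge0// sqr_ge0.
  exact: ler_wpM2l.
- move=> w _; have Dw := derM (gd u (b + c * w) _) (derc u (gk 0 w)).
  by apply: (dereq (Dw _)); rewrite ?u0// mulr0 addr0.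
rewrite hflow0E (_ : (fun u => _) = fun u => gavg 0 (g u) b c) //.
by apply/funext => t; rewrite hflow0E.
Qed.

Lemma jop_derive_t kap g dg (D C e y t z : R) : 0 <= D -> 0 <= C -> 0 <= e ->
  (forall y v, cont_at kap y v) ->
  (forall u x, u < L -> cont_at g u x) -> (forall u, u < L -> bdd D e (g u)) ->
  (forall u x, 0 < u < L -> is_derive u 1 (g ^~ x) (dg u x)) ->
  singular L C e dg -> 0 < t < L ->
  is_derive t 1 (fun t => jp 0 kap g y t z)
    (kap y t * hf 0 (g 0) t z + jp 0 kap dg y t z).
Proof.
move=> D0 C0 e0 ck gc gb gd [dgc dgb] tL.
have hc0 := hcst_ge0 m s L.
apply: (@moving_integral_derive _ (kap y) (fun u v => hf 0 (g u) v z)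
  (fun u v => hf 0 (dg u) v z) L t (C * hcst m s L * wt e z)) => //.
- by rewrite mulr_ge0 ?wt_ge0// mulr_ge0.
- exact: (cont_at_r (ck y)).
- move=> u v uL vL; rewrite /cont_at.
  apply: (@flow_cvg _ _ _ s_gt0 _ (u, v) fst snd (fun=> z) g 0 D e D0 e0 (or_introl erefl)).
  + exact: cvg_fst.
  + exact: cvg_snd.
  + exact: cvg_cst.
  + near=> t'.
    have t'L : t' < L by near: t'; exact: lt_nbhsl.
    by split => [x|]; [exact: gc|exact: gb].
- by move=> u v uL vL; exact: (hflow_derive_param v z D0 C0 e0 gc gb gd dgb uL).
- move=> u v uL /andP[v0 vL].
  have Cu0 : 0 <= C * (Num.sqrt u)^-1 by rewrite mulr_ge0// invr_ge0 sqrtr_ge0.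
  apply: (le_trans (hflow0_le m s_gt0 z Cu0 e0 (cont_at_mfun (fun x => dgc u x uL)) (dgb u uL) (ltW v0) (ltW vL))).
  by rewrite le_eqVlt; apply/orP; left; apply/eqP; ring.
Unshelve. all: end_near. Qed.

(** The operator - r + m d/dz + (s^2 / 2) d^2/dz^2 applied to [jop 0], with its [z]-derivatives
    written as [jop 1] and [jop 2]. *)
Definition drift_gen (r : R) kap g (y t z : R) : R :=
  - r * jp 0 kap g y t z + m * jp 1 kap g y t z + s ^+ 2 / 2 * jp 2 kap g y t z.

Variables (r : R) (K : R -> R).
Hypotheses (r_ge0 : 0 <= r) (cK : continuous K).
Local Notation kK := (fun y v => K (y + v) * expR (- r * v)).

Lemma cont_kK y v : cont_at kK y v.
Proof.
have c1 : {for (y, v), continuous (fun q : R * R => q.1 + q.2)}.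
  by apply: cvgD; [exact: cvg_fst|exact: cvg_snd].
have c2 : {for (y, v), continuous (fun q : R * R => - r * q.2)}.
  by apply: cvgM; [exact: cvg_cst|exact: cvg_snd].
have H1 : {for (y, v), continuous (fun q : R * R => K (q.1 + q.2))}.
  by apply: (@continuous_comp _ _ _ (fun q : R * R => q.1 + q.2) K); [exact: c1|exact: cK].
have H2 : {for (y, v), continuous (fun q : R * R => expR (- r * q.2))}.
  apply: (@continuous_comp _ _ _ (fun q : R * R => - r * q.2) expR); first exact: c2.
  exact: continuous_expR.
exact: (cvgM H1 H2).
Qed.

(** After the substitution w = t - v the age at the switch is (c - t) + (t - w) = c - w and the
    function is taken at time w. Hence [t] is left only in the discount factor and in the duration
    of the flow, and neither [K] nor [g] is differentiated. *)
Lemma jop_diag_derive g (D e c t z : R) : 0 <= D -> 0 <= e <= 1 ->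
  regular L D e g -> 0 < t < L ->
  is_derive t 1 (fun t => jp 0 kK g (c - t) t z)
    (K (c - t) * g t z + drift_gen r kK g (c - t) t z).
Proof.
move=> D0 e01 gR /andP[t0 tL]; have [e0 _] := andP e01.
have t0L : 0 < t < L by rewrite t0.
have [gc gb gl] := gR.
have hc0 := hcst2_ge0 m s_gt0 L.
pose V u w := expR (- r * u) * (- r * hf 0 (g w) u z + m * hf 1 (g w) u z + s ^+ 2 / 2 * hf 2 (g w) u z).
have intJ n y u : (n <= 2)%N -> 0 < u < L -> intgR (cut 0 u (fun v => kK y v * hf n (g (u - v)) v z)).
  move=> n2 uL; have [Q Q0 HQ] := loc_bound y (ltW L_gt0) cont_kK.
  have kQ v : 0 <= v <= L -> `|kK y v| <= Q by apply: HQ; rewrite subrr normr0.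
  by have [] := jop_regular_le m s_gt0 z n2 D0 e0 cont_kK gR uL Q0 kQ.
have H : is_derive t 1 (fun t => intR (cut 0 t (fun w => K (c - w) * (expR (- r * (t - w)) * hf 0 (g w) (t - w) z))))
   (K (c - t) * (expR (- r * 0) * hf 0 (g t) 0 z) + intR (cut 0 t (fun w => K (c - w) * V (t - w) w))).
  apply: (@moving_integral_derive _ (fun w => K (c - w)) (fun u w => expR (- r * u) * hf 0 (g w) u z) V
    L t (D * hcst2 m s L * wt e z * (r + `|m| + s ^+ 2 / 2))) => //.
  - apply: mulr_ge0; first by apply: mulr_ge0; [exact: mulr_ge0|exact: wt_ge0].
    apply: addr_ge0; first exact: addr_ge0.
    by rewrite divr_ge0// sqr_ge0.
  - move=> w; apply: (cvg_comp (fun w => c - w) K); last exact: cK.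
    by apply: cvgB; [exact: cvg_cst|exact: cvg_id].
  - move=> u w uL wL; rewrite /cont_at; apply: cvgM.
      apply: (cvg_comp (fun q : R * R => - r * q.1) expR); last exact: continuous_expR.
      by apply: cvgM; [exact: cvg_cst|exact: cvg_fst].
    apply: (@flow_cvg _ _ _ s_gt0 _ (u, w) snd fst (fun=> z) g 0 D e D0 e0 (or_introl erefl)).
    + exact: cvg_snd.
    + exact: cvg_fst.
    + exact: cvg_cst.
    + exact: (regular_near wL gR).
  - move=> u w /andP[u0 uL] /andP[w0 wL].
    have dE : is_derive u 1 (fun u => expR (- r * u)) (expR (- r * u) * - r).
      by apply: derexp; apply: (dereq (derZ (- r) (derid u))); rewrite mulr1.
    have := derM dE (hflow_derive_v m s_gt0 z u0 D0 e01 (cont_at_mfun (fun x => gc w x wL)) (gb w wL)).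
    by move/dereq; apply; rewrite /V; ring.
  - move=> u w /andP[u0 uL] /andP[w0 wL].
    have B n : (n <= 2)%N -> `|hf n (g w) u z| <= D * hcst2 m s L * wt e z * (Num.sqrt u)^-1.
      by move=> n2; exact: (hflow_sqrt_le m s_gt0 z n2 D0 e0 (cont_at_mfun (fun x => gc w x wL)) (gb w wL) (gl w wL) u0 (ltW uL)).
    set B0 := D * _ * _ * _ in B.
    rewrite /V normrM ger0_norm ?expR_ge0//.
    have ru : expR (- r * u) <= 1 by rewrite -expR0 ler_expR mulNr oppr_le0 mulr_ge0// ltW.
    apply: (@le_trans _ _ ((r + `|m| + s ^+ 2 / 2) * B0)); last first.
      by rewrite le_eqVlt; apply/orP; left; apply/eqP; rewrite /B0; ring.
    apply: (le_trans (ler_piMl (normr_ge0 _) ru)).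
    apply: (le_trans (ler_normD _ _)); rewrite mulrDl lerD//; last first.
      by rewrite normrM ger0_norm ?divr_ge0 ?sqr_ge0// ler_wpM2l ?B// divr_ge0// sqr_ge0.
    apply: (le_trans (ler_normD _ _)); rewrite mulrDl lerD//.
      by rewrite normrM normrN (ger0_norm r_ge0) ler_wpM2l// B.
    by rewrite normrM ler_wpM2l// B.
have H' := near_eq_is_derive _ H.
have {}H' := H' (fun t => jp 0 kK g (c - t) t z).
have nt : \forall x \near t, 0 < x < L.
  near=> x; apply/andP; split; near: x; [exact: lt_nbhsr|exact: lt_nbhsl].
apply: (dereq (H' _)).
  apply: filterS nt => x xL; rewrite jop_refl; last exact: intJ.
  congr intR; apply/funext => w; rewrite /cut; case: ifP => // _.
  by rewrite addrA subrK mulrA.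
rewrite mulr0 expR0 mul1r (hflow_at0 m s); congr (_ + _).
have E : drift_gen r kK g (c - t) t z = intR (cut 0 t (fun v => K (c - t + v) * V v (t - v))).
  rewrite /drift_gen /jop.
  rewrite -(intRZ (- r) (intJ 0 (c - t) t isT t0L)) -(intRZ m (intJ 1 (c - t) t isT t0L)).
  rewrite -(intRZ (s ^+ 2 / 2) (intJ 2 (c - t) t isT t0L)).
  rewrite -intRD; [|exact/intgRZ/intJ|exact/intgRZ/intJ].
  rewrite -intRD; [|by apply: intgRD; exact/intgRZ/intJ|exact/intgRZ/intJ].
  congr intR; apply/funext => v; rewrite /cut; case: ifP => _; last by rewrite !mulr0 !addr0.
  by rewrite /V; ring.
have iV : intgR (cut 0 t (fun v => K (c - t + v) * V v (t - v))).
  have := intgRD (intgRD (intgRZ (- r) (intJ 0 (c - t) t isT t0L)) (intgRZ m (intJ 1 (c - t) t isT t0L)))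
     (intgRZ (s ^+ 2 / 2) (intJ 2 (c - t) t isT t0L)).
  congr intgR; apply/funext => v; rewrite /cut; case: ifP => _; last by rewrite !mulr0 !addr0.
  by rewrite /V; ring.
rewrite E -(intR_cut_refl iV); congr intR; apply/funext => w; rewrite /cut; case: ifP => // _.
by rewrite subKr addrA subrK.
Unshelve. all: end_near. Qed.

Lemma drift_gen_cvg (X : pseudoMetricType R) (p : X) (Y t z : X -> R) g D e :
  0 <= D -> 0 <= e -> regular L D e g -> t p < L ->
  {for p, continuous Y} -> {for p, continuous t} -> {for p, continuous z} ->
  drift_gen r kK g (Y x) (t x) (z x) @[x --> p] --> drift_gen r kK g (Y p) (t p) (z p).
Proof.
move=> D0 e0 gR tL cY ct cz.
have J n : (n <= 2)%N -> jp n kK g (Y x) (t x) (z x) @[x --> p] --> jp n kK g (Y p) (t p) (z p).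
  by move=> n2; exact: (jop_cvg_regular s_gt0 L_gt0 n2 D0 e0 cont_kK gR tL cY ct cz).
apply: cvgD; last by apply: cvgM; [exact: cvg_cst|exact: J].
by apply: cvgD; apply: cvgM; [exact: cvg_cst|exact: J|exact: cvg_cst|exact: J].
Qed.

(** An increment in [y] is an increment in time minus one along a line y + t = const. The first is
    governed by [a]; the mean value theorem turns the second into a value of [b] at a nearby point,
    and [b] is continuous. *)
Lemma mixed_derive (F b : R -> R -> R) (y t a : R) : 0 < t < L ->
  is_derive t 1 (F y) a ->
  (forall c u, 0 < u < L -> is_derive u 1 (fun u => F (c - u) u) (b (c - u) u)) ->
  cont_at b y t ->
  is_derive y 1 (F ^~ t) (a - b y t).
Proof.
move=> t0L Fa Fb cb; apply/is_derive1P.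
have Fq : (F y (t + (x - y)) - F y t) / (x - y) @[x --> y^'] --> a.
  have D1 : is_derive y 1 (fun x => F y (t + (x - y))) a.
    have dx : is_derive y 1 (fun x => t + (x - y)) 1.
      by apply: (dereq (derD (derc y t) (derB (derid y) (derc y y)))); rewrite subr0 add0r.
    have := @dercomp _ (fun x => t + (x - y)) (F y) y 1 a.
    rewrite subrr addr0 => /(_ Fa dx); rewrite mulr1; exact.
  by move/is_derive1P : D1; rewrite subrr addr0.
apply/cvgrPdist_lt => e e0.
have e2 : 0 < e / 2 by rewrite divr_gt0.
have /nbhs_ballP[d /= d0 Hd] : nbhs (y, t) (fun q : R * R => `|b y t - b q.1 q.2| < e / 2).
  by move/cvgrPdist_lt : cb; apply.
have {}Hd u v : `|y - u| < d -> `|t - v| < d -> `|b y t - b u v| < e / 2.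
  by move=> yu tv; exact: (Hd (u, v)).
have [d' /= d'0 Hd'] : nbhs t (fun u => 0 < u < L).
  near=> x; apply/andP; split; near: x; [apply: lt_nbhsr|apply: lt_nbhsl]; by case/andP: t0L.
have nx : \forall x \near y^', x != y by exact: nbhs_dnbhs_neq.
have nd : \forall x \near y^', `|y - x| < Num.min d d'.
  by apply: nbhs_dnbhs; exists (Num.min d d') => //=; rewrite lt_min d0.
have nF : \forall x \near y^', `|a - (F y (t + (x - y)) - F y t) / (x - y)| < e / 2.
  by move/cvgrPdist_lt : Fq; apply.
apply: filterS3 nx nd nF => x xy; rewrite lt_min => /andP[xd xd'] xF.
pose c := y + t + (x - y).
have inL u : `|t - u| <= `|y - x| -> 0 < u < L.
  by move=> tu; apply: Hd' => /=; exact: le_lt_trans xd'.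
(* The line y + t = c passes through (x, t) and (y, t + (x - y)). *)
have FE : F x t - F y t = (F y (t + (x - y)) - F y t) - (F (c - (t + (x - y))) (t + (x - y)) - F (c - t) t).
  rewrite (_ : c - (t + (x - y)) = y); last by rewrite /c; ring.
  rewrite (_ : c - t = x); last by rewrite /c; ring.
  by ring.
have [u [ut uc] uE] : exists2 u, `|t - u| <= `|y - x| /\ `|y - (c - u)| <= `|y - x| &
    F (c - (t + (x - y))) (t + (x - y)) - F (c - t) t = b (c - u) u * (x - y).
  have cF u : `|t - u| <= `|y - x| -> derivable (fun u => F (c - u) u) u 1.
    by move=> /inL uL; have [] := Fb c u uL.
  have xy' : y - x != 0 by rewrite subr_eq0 eq_sym.
  have [lxy|lxy|E] := ltgtP y x; last by rewrite E eqxx in xy.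
    have tt : t < t + (x - y) by rewrite ltrDl subr_gt0.
    have nyx : `|y - x| = x - y by rewrite ltr0_norm ?subr_lt0// opprB.
    have [||u] := @MVT R (fun u => F (c - u) u) (fun u => b (c - u) u) t (t + (x - y)) tt.
    - move=> u; rewrite in_itv/= => /andP[u1 u2]; apply/Fb/inL.
      by rewrite nyx ltr0_norm ?subr_lt0//; lra.
    - apply: derivable_within_continuous => u; rewrite in_itv/= => /andP[u1 u2].
      by apply: cF; rewrite nyx ler0_norm ?subr_le0//; lra.
    rewrite in_itv/= => /andP[u1 u2] ->; exists u; last by congr (_ * _); ring.
    by rewrite nyx /c; split; rewrite ler_norml; apply/andP; split; lra.
  have tt : t + (x - y) < t by rewrite gtrDl subr_lt0.
  have nyx : `|y - x| = y - x by rewrite gtr0_norm ?subr_gt0.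
  have [||u] := @MVT R (fun u => F (c - u) u) (fun u => b (c - u) u) (t + (x - y)) t tt.
  - move=> u; rewrite in_itv/= => /andP[u1 u2]; apply/Fb/inL.
    by rewrite nyx gtr0_norm ?subr_gt0//; lra.
  - apply: derivable_within_continuous => u; rewrite in_itv/= => /andP[u1 u2].
    by apply: cF; rewrite nyx ger0_norm ?subr_ge0//; lra.
  rewrite in_itv/= => /andP[u1 u2] E; exists u.
    by rewrite nyx /c; split; rewrite ler_norml; apply/andP; split; lra.
  by rewrite -opprB E; ring.
have xy0 : x - y != 0 by rewrite subr_eq0.
rewrite FE uE mulrBl mulfK//.
have bu : `|b y t - b (c - u) u| < e / 2.
  by apply: Hd; apply: le_lt_trans xd.
rewrite (_ : _ - _ = (a - (F y (t + (x - y)) - F y t) / (x - y)) - (b y t - b (c - u) u)); last by ring.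
apply: (le_lt_trans (ler_normB _ _)).
by rewrite (splitr e) ltrD.
Unshelve. all: end_near. Qed.

End integral_derivatives.

(** * The Volterra equation *)

Section volterra.
Context {R : realType} (n : nat).
Variables (m s : 'I_n -> R) (L : R) (kap : 'I_n -> 'I_n -> R -> R -> R).
Hypotheses (s_gt0 : forall i, 0 < s i) (L_gt0 : 0 < L).
Hypothesis ckap : forall i j y v, cont_at (kap i j) y v.
Implicit Types (Psi S : 'I_n -> R -> R -> R).

Definition vop Psi (i : 'I_n) (y t z : R) : R :=
  \sum_(j < n | j != i) jop (m i) (s i) 0 (kap i j) (Psi j) y t z.

(* For large [c] this weight makes the Volterra operator a contraction on all of
   ]0, L[ at once; the factor [1 / sqrt u] accommodates singular functions. *)
Definition om (c u : R) : R := expR (c * u) * (Num.sqrt u)^-1.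

Lemma om_ge0 c u : 0 <= om c u.
Proof. by rewrite mulr_ge0 ?expR_ge0// invr_ge0 sqrtr_ge0. Qed.

Lemma isqrt_le_om c u : 0 <= c -> 0 <= u -> (Num.sqrt u)^-1 <= om c u.
Proof.
move=> c0 u0; rewrite /om ler_peMl ?invr_ge0 ?sqrtr_ge0//.
by rewrite -expR0 ler_expR mulr_ge0.
Qed.

Lemma om_le_isqrt c u : 0 <= c -> u <= L -> om c u <= expR (c * L) * (Num.sqrt u)^-1.
Proof.
by move=> c0 uL; rewrite /om ler_wpM2r ?invr_ge0 ?sqrtr_ge0// ler_expR ler_wpM2l.
Qed.

(** The gain c^(-1/2) comes from exp(- c v) <= 1 / sqrt(c v). The product of the two singularities 1
    / sqrt v and 1 / sqrt(t - v) is split into a sum divided by sqrt t, because sqrt t <= sqrt v +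
    sqrt(t - v). *)
Lemma om_conv_dom c t v : 0 < c -> 0 < v < t ->
  om c (t - v) <= om c t * (Num.sqrt c)^-1 * (Num.sqrt v)^-1 +
                  om c t * (Num.sqrt c)^-1 * (Num.sqrt (t - v))^-1.
Proof.
move=> c0 /andP[v0 vt]; have u0 : 0 < t - v by rewrite subr_gt0.
have t0 := lt_trans v0 vt.
set a := Num.sqrt v; set b := Num.sqrt (t - v); set d := Num.sqrt t; set h := Num.sqrt c.
have a0 : 0 < a by rewrite sqrtr_gt0.
have b0 : 0 < b by rewrite sqrtr_gt0.
have d0 : 0 < d by rewrite sqrtr_gt0.
have h0 : 0 < h by rewrite sqrtr_gt0.
have dab : d <= a + b.
  have ab : 0 <= a * b by rewrite mulr_ge0// ltW.
  have nd : d \is Num.nneg by rewrite nnegrE ltW.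
  have nab : a + b \is Num.nneg by rewrite nnegrE addr_ge0// ltW.
  rewrite -(@ler_pXn2r _ 2)// sqrrD (sqr_sqrtr (ltW t0)) (sqr_sqrtr (ltW v0)).
  rewrite (sqr_sqrtr (ltW u0)) -mulr_natr; lra.
have e1 : expR (- (c * v)) <= (h * a)^-1.
  rewrite expRN lef_pV2 ?posrE ?expR_gt0 ?mulr_gt0// /h /a -sqrtrM; last exact: ltW.
  have cv0 : 0 <= c * v by rewrite mulr_ge0// ltW.
  apply: le_trans (expR_ge1Dx _).
  have := sqr_sqrtr cv0; have := sqr_ge0 (Num.sqrt (c * v) - 1); rewrite sqrrB1.
  have := sqrtr_ge0 (c * v); lra.
rewrite /om -/a -/b -/d.
have -> : expR (c * (t - v)) = expR (c * t) * expR (- (c * v)).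
  by rewrite -expRD; congr expR; ring.
rewrite (_ : _ + _ = expR (c * t) / b * ((h * a)^-1 * ((a + b) / d))); last first.
  by field; rewrite !gt_eqF.
rewrite mulrAC; apply: ler_wpM2l; first by rewrite divr_ge0 ?expR_ge0// ltW.
apply: (le_trans e1); rewrite ler_peMr//; first by rewrite invr_ge0 mulr_ge0// ltW.
by rewrite ler_pdivlMr// mul1r.
Qed.

(** Each of the two terms of [om_conv_dom] integrates to at most a factor 2 sqrt L, whence 4 sqrt L;
    the factor (sqrt c)^-1 is what makes a large [c] contract. *)
Lemma jop_om_le (i : 'I_n) k g (D e y t z Q M c : R) : 0 <= D -> 0 <= e -> 0 < c ->
  (forall y v, cont_at k y v) -> singular L D e g -> 0 < t < L -> 0 <= Q -> 0 <= M ->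
  (forall v, 0 <= v <= L -> `|k y v| <= Q) ->
  (forall u x, 0 < u < t -> `|g u x| <= M * om c u * wt e x) ->
  `|jop (m i) (s i) 0 k g y t z| <=
    Q * hcst (m i) (s i) L * (4 * Num.sqrt L * (Num.sqrt c)^-1) * (M * om c t * wt e z).
Proof.
move=> D0 e0 c0 ck gS /andP[t0 tL] Q0 M0 kQ gM.
have hc0 := hcst_ge0 (m i) (s i) L.
have [gc _] := gS.
pose A := Q * M * hcst (m i) (s i) L * wt e z * (om c t * (Num.sqrt c)^-1).
have A0 : 0 <= A.
  apply: mulr_ge0; first by apply: prod4_ge0 => //; exact: wt_ge0.
  by rewrite mulr_ge0 ?om_ge0// invr_ge0 sqrtr_ge0.
pose B v := A * (Num.sqrt v)^-1 + A * (Num.sqrt (t - v))^-1.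
have i1 := @isqrt_cut_intgR _ A t t0.
have i2 := intgR_cut_refl i1.
have BE : cut 0 t B = (fun v => cut 0 t (fun v => A * (Num.sqrt v)^-1) v
   + cut 0 t (fun v => A * (Num.sqrt (t - v))^-1) v).
  by apply/funext => v; rewrite /cut; case: ifP => // _; rewrite addr0.
have iB : intgR (cut 0 t B) by rewrite BE; exact: intgRD.
have [|_ le] := @jop_int _ (m i) (s i) L (s_gt0 i) 0 k g D e y t z B D0 e0 ck gS tL iB.
  move=> v /andP[v0 vt].
  have utL : 0 < t - v < t by rewrite subr_gt0 vt/= gtrBl.
  have uL : 0 < t - v < L by case/andP: utL => -> /lt_trans; apply.
  have vL : v <= L by rewrite ltW// (lt_trans vt).
  have h1 : `|k y v| <= Q by apply: kQ; rewrite (ltW v0).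
  have M'0 : 0 <= M * om c (t - v) by rewrite mulr_ge0// om_ge0.
  have h2 := hflow0_le (m i) (s_gt0 i) z M'0 e0 (cont_at_mfun (fun x => gc _ x uL))
    (fun x => gM _ x utL) (ltW v0) vL.
  rewrite normrM; apply: (le_trans (ler_pM _ _ h1 h2)) => //.
  have v0t : 0 < v < t by rewrite v0.
  have C0 : 0 <= Q * M * hcst (m i) (s i) L * wt e z.
    by apply: prod4_ge0 => //; exact: wt_ge0.
  have := ler_wpM2l C0 (om_conv_dom c0 v0t).
  rewrite /B /A => h3.
  rewrite [leLHS](_ : _ = Q * M * hcst (m i) (s i) L * wt e z * om c (t - v)); last by ring.
  apply: (le_trans h3); rewrite le_eqVlt; apply/orP; left; apply/eqP; ring.
apply: (le_trans le); rewrite BE intRD// (intR_cut_refl i1).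
have h := isqrt_cut_le A0 t0.
have tl : Num.sqrt t <= Num.sqrt L by rewrite ler_wsqrtr// ltW.
have h2 : A * (2 * Num.sqrt t) <= A * (2 * Num.sqrt L).
  by apply: ler_wpM2l => //; rewrite ler_pM2l.
apply: (@le_trans _ _ (A * (2 * Num.sqrt L) + A * (2 * Num.sqrt L))).
  by apply: lerD; exact: le_trans h2.
by rewrite /A le_eqVlt; apply/orP; left; apply/eqP; ring.
Qed.

Lemma vop_contraction : exists2 c, 0 < c &
  forall Psi (i : 'I_n) (D e M t z : R), 0 <= D -> 0 <= e -> 0 <= M ->
    (forall j, singular L D e (Psi j)) -> 0 < t < L ->
    (forall j u x, 0 < u < t -> `|Psi j u x| <= M * om c u * wt e x) ->
    `|vop Psi i 0 t z| <= M / 2 * om c t * wt e z.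
Proof.
have Qex i j : {Q | 0 <= Q /\ forall v, 0 <= v <= L -> `|kap i j 0 v| <= Q}.
  apply: cid; have [Q Q0 HQ] := loc_bound 0 (ltW L_gt0) (@ckap i j).
  by exists Q; split => // v vL; apply: HQ => //; rewrite subrr normr0.
pose Q i j := sval (Qex i j).
have Q0 i j : 0 <= Q i j by have [] := svalP (Qex i j).
have HQ i j v : 0 <= v <= L -> `|kap i j 0 v| <= Q i j.
  by have [_] := svalP (Qex i j); apply.
pose H i := \sum_(j < n) Q i j * hcst (m i) (s i) L.
have H0 i : 0 <= H i by apply: sumr_ge0 => j _; rewrite mulr_ge0// hcst_ge0.
pose B := \sum_(i < n) H i.
have HB i : H i <= B by rewrite /B (bigD1 i)//= lerDl sumr_ge0.
have B0 : 0 <= B by apply: sumr_ge0.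
(* For c = sc^2 the factor in [jop_om_le] is 4 sqrt L / sc, and summed over the regimes it is at
   most 4 sqrt L B / sc <= 1/2; the summand 1 keeps [sc] positive. *)
pose sc := 8 * Num.sqrt L * B + 1.
have sc0 : 0 < sc by rewrite ltr_wpDl// !mulr_ge0// sqrtr_ge0.
exists (sc ^+ 2); first by rewrite exprn_gt0.
move=> Psi i D e M t z D0 e0 M0 PS tL PM.
have scE : Num.sqrt (sc ^+ 2) = sc by rewrite sqrtr_sqr gtr0_norm.
set W := M * om (sc ^+ 2) t * wt e z.
have W0 : 0 <= W by rewrite mulr_ge0 ?wt_ge0// mulr_ge0// om_ge0.
have q0 : 0 <= 4 * Num.sqrt L * sc^-1.
  by apply: mulr_ge0; [rewrite mulr_ge0// sqrtr_ge0|rewrite invr_ge0 ltW].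
have term j : `|jop (m i) (s i) 0 (kap i j) (Psi j) 0 t z| <=
    Q i j * hcst (m i) (s i) L * (4 * Num.sqrt L * sc^-1) * W.
  rewrite -[in sc^-1]scE; apply: (jop_om_le i z D0 e0 _ (@ckap i j) (PS j) tL (Q0 i j) M0 (HQ i j)).
    by rewrite exprn_gt0.
  by move=> u x ut; exact: PM.
apply: (le_trans (ler_norm_sum _ _ _)).
apply: (@le_trans _ _ (\sum_(j < n | j != i) Q i j * hcst (m i) (s i) L * (4 * Num.sqrt L * sc^-1) * W)).
  by apply: ler_sum => j _; exact: term.
rewrite -mulr_suml -mulr_suml.
have le1 : \sum_(j < n | j != i) Q i j * hcst (m i) (s i) L <= B.
  apply: le_trans (HB i); rewrite /H [leRHS](bigD1 i)//= lerDr.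
  by rewrite mulr_ge0// hcst_ge0.
have -> : M / 2 * om (sc ^+ 2) t * wt e z = 2^-1 * W by rewrite /W; ring.
apply: ler_wpM2r => //; apply: (le_trans (ler_wpM2r q0 le1)).
rewrite mulrA ler_pdivrMr// /sc.
have := sqrtr_ge0 L; lra.
Qed.

Lemma hflow_sub (i : 'I_n) (f g : R -> R) (D e v z : R) : 0 <= D -> 0 <= e ->
  measurable_fun setT f -> measurable_fun setT g -> bdd D e f -> bdd D e g ->
  hflow (m i) (s i) 0 (fun x => f x - g x) v z =
  hflow (m i) (s i) 0 f v z - hflow (m i) (s i) 0 g v z.
Proof.
move=> D0 e0 mf mg fD gD; rewrite !hflow0E /gavg -intRB.
- by congr intR; apply/funext => w; rewrite mulrBl.
- exact: gavg_int fD.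
- exact: gavg_int gD.
Qed.

Lemma singular_sub (f g : R -> R -> R) (D1 D2 e : R) : singular L D1 e f -> singular L D2 e g ->
  singular L (D1 + D2) e (fun u x => f u x - g u x).
Proof.
move=> [fc fb] [gc gb]; split => [u x uL|u uL x].
  by apply: cvgB; [exact: fc|exact: gc].
apply: (le_trans (ler_normB _ _)); rewrite !mulrDl.
by apply: lerD; [exact: fb|exact: gb].
Qed.

Lemma singular_le (f : R -> R -> R) (D1 D2 e : R) : 0 <= e -> D1 <= D2 ->
  singular L D1 e f -> singular L D2 e f.
Proof.
move=> e0 D12 [fc fb]; split => // u uL x; apply: (le_trans (fb u uL x)).
by rewrite ler_wpM2r ?wt_ge0// ler_wpM2r// invr_ge0 sqrtr_ge0.
Qed.

Lemma vop_sub Psi Xi (i : 'I_n) (D e t z : R) : 0 <= D -> 0 <= e ->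
  (forall j, singular L D e (Psi j)) -> (forall j, singular L D e (Xi j)) ->
  0 < t < L ->
  vop (fun j u x => Psi j u x - Xi j u x) i 0 t z = vop Psi i 0 t z - vop Xi i 0 t z.
Proof.
move=> D0 e0 PS XS tL; rewrite /vop -sumrB; apply: eq_bigr => j _.
have [t0 tL'] := andP tL.
rewrite /jop -intRB; first last.
- exact: (jop_singular_int (m i) (s_gt0 i) L_gt0 0 z D0 e0 (@ckap i j) (XS j) tL).
- exact: (jop_singular_int (m i) (s_gt0 i) L_gt0 0 z D0 e0 (@ckap i j) (PS j) tL).
congr intR; apply/funext => v; rewrite /cut; case: ifP => [/andP[v0 vt]|_]; last by rewrite subrr.
have uL : 0 < t - v < L by rewrite subr_gt0 vt/= ltrBlDr (lt_trans tL')// ltrDl.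
have D'0 : 0 <= D * (Num.sqrt (t - v))^-1 by rewrite mulr_ge0// invr_ge0 sqrtr_ge0.
have [pc pb] := PS j; have [xc xb] := XS j.
rewrite -mulrBr (hflow_sub i v z D'0 e0 _ _ (pb _ uL) (xb _ uL))//.
- by apply: cont_at_mfun => x; exact: pc.
- by apply: cont_at_mfun => x; exact: xc.
Qed.

Lemma vop_cvg_singular (X : pseudoMetricType R) (p : X) (Y t z : X -> R)
    Psi (i : 'I_n) (D e : R) : 0 <= D -> 0 <= e ->
  (forall j, singular L D e (Psi j)) -> 0 < t p < L ->
  {for p, continuous Y} -> {for p, continuous t} -> {for p, continuous z} ->
  vop Psi i (Y x) (t x) (z x) @[x --> p] --> vop Psi i (Y p) (t p) (z p).
Proof.
move=> D0 e0 PS tL cY ct cz; apply: cvg_big; first exact: add_continuous.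
move=> j _; exact: (jop_cvg_singular (s_gt0 i) L_gt0 D0 e0 (@ckap i j) (PS j) tL cY ct cz).
Qed.

Lemma cvg_half_pow (C : R) : C / 2 ^+ l @[l --> \oo] --> 0.
Proof.
rewrite -(mulr0 C); apply: cvgM; first exact: cvg_cst.
rewrite (_ : (fun l : nat => (2 ^+ l)^-1) = (fun l => (2^-1 : R) ^+ l)); last first.
  by apply/funext => l; rewrite exprVn.
by apply: cvg_expr; rewrite gtr0_norm ?invr_gt0// invf_lt1// ltr1n.
Qed.

Lemma half_pow_bound (x a b : R) : (forall l : nat, x <= a + b / 2 ^+ l) -> x <= a.
Proof.
move=> H; have h : a + b / 2 ^+ l @[l --> \oo] --> a.
  by rewrite -[X in _ --> X]addr0; apply: cvgD (cvg_half_pow b); exact: cvg_cst.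
rewrite -(cvg_lim _ h)//; apply: limr_ge; first by apply/cvg_ex; exists a.
exact: nearW.
Qed.

(** Subtracting the remaining tail 2K / 2^l makes the sequence nondecreasing and bounded, so that
    monotone convergence provides the limit. *)
Lemma geometric_limit (u : nat -> R) K : (forall l, `|u l.+1 - u l| <= K / 2 ^+ l) ->
  exists x, u l @[l --> \oo] --> x /\ forall l, `|x - u l| <= 2 * K / 2 ^+ l.
Proof.
move=> Hu.
have h (l : nat) : 2 * K / 2 ^+ l.+1 = K / 2 ^+ l.
  by rewrite exprS; field; rewrite expf_neq0.
have K0 : 0 <= K by have := le_trans (normr_ge0 _) (Hu 0%N); rewrite expr0 divr1.
have dist l p : `|u (l + p)%N - u l| <= 2 * K / 2 ^+ l - 2 * K / 2 ^+ (l + p).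
  elim: p => [|p IH]; first by rewrite addn0 !subrr normr0.
  rewrite addnS h; have := Hu (l + p)%N.
  have -> : u (l + p).+1 - u l = (u (l + p).+1 - u (l + p)%N) + (u (l + p)%N - u l) by ring.
  move=> H; apply: (le_trans (ler_normD _ _)).
  have : 2 * K / 2 ^+ (l + p) = 2 * (K / 2 ^+ (l + p)) by rewrite mulrA.
  lra.
pose a l := u l - 2 * K / 2 ^+ l.
have na : nondecreasing_seq a.
  apply/nondecreasing_seqP => l; rewrite /a h.
  have := Hu l; rewrite ler_norml => /andP[H _].
  have : 2 * K / 2 ^+ l = 2 * (K / 2 ^+ l) by rewrite mulrA.
  lra.
have ba : has_ubound (range a).
  exists (u 0%N + 2 * K) => _ [l _ <-]; rewrite /a.
  have := dist 0%N l; rewrite add0n expr0 divr1 ler_norml => /andP[_ H].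
  have : 0 <= 2 * K / 2 ^+ l by rewrite divr_ge0 ?mulr_ge0// exprn_ge0.
  lra.
have ca : a l @[l --> \oo] --> limn a by exact: nondecreasing_is_cvgn.
have cu : u l @[l --> \oo] --> limn a.
  rewrite -[X in _ --> X]addr0.
  rewrite (_ : u = (fun l => a l + 2 * K / 2 ^+ l)).
    by apply: cvgD ca _; exact: cvg_half_pow.
  by apply/funext => l; rewrite /a subrK.
exists (limn a); split => // l.
have c2 : `|u (l + p)%N - u l| @[p --> \oo] --> `|limn a - u l|.
  apply: cvg_norm; apply: cvgB; last exact: cvg_cst.
  rewrite (_ : (fun p => u (l + p)%N) = [sequence u (p + l)%N]_p); last first.
    by apply/funext => p; rewrite /= addnC.
  by rewrite cvg_shiftn.
rewrite -(cvg_lim _ c2)//; apply: limr_le; first by apply/cvg_ex; eexists; exact: c2.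
apply: nearW => p; apply: (le_trans (dist l p)).
by rewrite gerBl divr_ge0 ?mulr_ge0// exprn_ge0.
Qed.

(** Iterating the contraction replaces an initial bound D by 2M + D / 2^l. The constant [D] of the
    class disappears in the limit, so [A] depends on the data of the operator alone. *)
Lemma volterra_apriori : exists2 A, 0 <= A &
  forall Psi (D e M t1 : R), 0 <= D -> 0 <= e -> 0 <= M -> t1 < L ->
    (forall j, singular L D e (Psi j)) ->
    (forall i t z, 0 < t <= t1 ->
      `|Psi i t z| <= M * (Num.sqrt t)^-1 * wt e z + `|vop Psi i 0 t z|) ->
    forall i t z, 0 < t <= t1 -> `|Psi i t z| <= A * M * (Num.sqrt t)^-1 * wt e z.
Proof.
have [c c0 Hc] := vop_contraction.
exists (2 * expR (c * L)); first by rewrite mulr_ge0// expR_ge0.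
move=> Psi D e M t1 D0 e0 M0 t1L PS PM.
have step N : 0 <= N -> (forall j u x, 0 < u <= t1 -> `|Psi j u x| <= N * om c u * wt e x) ->
    forall j u x, 0 < u <= t1 -> `|Psi j u x| <= (M + N / 2) * om c u * wt e x.
  move=> N0 HN j u x /andP[u0 ut]; apply: (le_trans (PM _ _ _ _)); first by rewrite u0.
  have uL : 0 < u < L by rewrite u0 (le_lt_trans ut).
  rewrite !mulrDl; apply: lerD.
    rewrite ler_wpM2r ?wt_ge0//; apply: ler_wpM2l => //.
    by apply: isqrt_le_om; rewrite ltW.
  apply: (Hc Psi j D e N u x D0 e0 N0 PS uL) => j' u' x' /andP[u'0 u'u].
  by apply: HN; rewrite u'0 (le_trans (ltW u'u)).
have it l : forall j u x, 0 < u <= t1 -> `|Psi j u x| <= (2 * M + D / 2 ^+ l) * om c u * wt e x.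
  elim: l => [|l IH] j u x ut.
    have [u0 ut1] := andP ut.
    have uL : 0 < u < L by rewrite u0 (le_lt_trans ut1).
    have [_ pb] := PS j; apply: (le_trans (pb u uL x)); rewrite ler_wpM2r ?wt_ge0//.
    rewrite expr0 divr1; apply: ler_pM.
    - exact: D0.
    - by rewrite invr_ge0 sqrtr_ge0.
    - by rewrite lerDr mulr_ge0.
    - by apply: isqrt_le_om; rewrite ltW.
  have N0 : 0 <= 2 * M + D / 2 ^+ l.
    by apply: addr_ge0; [exact: mulr_ge0|rewrite divr_ge0// exprn_ge0].
  have := step _ N0 IH j u x ut; rewrite (_ : M + _ / 2 = 2 * M + D / 2 ^+ l.+1)//.
  by rewrite exprS; field; rewrite expf_neq0.
move=> i t z tt1; have [t0 tl] := andP tt1.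
have tL : t <= L by rewrite ltW// (le_lt_trans tl).
have : `|Psi i t z| <= 2 * M * om c t * wt e z.
  apply: (@half_pow_bound _ _ (D * om c t * wt e z)) => l.
  have := it l i t z tt1; rewrite !mulrDl => /le_trans; apply.
  by rewrite le_eqVlt; apply/orP; left; apply/eqP; ring.
move=> /le_trans; apply; rewrite ler_wpM2r ?wt_ge0//.
have M20 : 0 <= 2 * M by rewrite mulr_ge0.
apply: (le_trans (ler_wpM2l M20 (om_le_isqrt (ltW c0) tL))).
by rewrite le_eqVlt; apply/orP; left; apply/eqP; ring.
Qed.

Lemma volterra_exists S (C e : R) : 0 <= C -> 0 <= e ->
  (forall i, singular L C e (S i)) ->
  exists Psi, exists2 C', 0 <= C' &
    [/\ forall i, singular L C' e (Psi i),
        forall i t z, 0 < t < L -> Psi i t z = S i t z + vop Psi i 0 t z &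
        (forall i t z, 0 < t < L -> 0 <= S i t z) ->
        (forall i j v, 0 <= v -> 0 <= kap i j 0 v) ->
        forall i t z, 0 < t < L -> 0 <= Psi i t z].
Proof.
move=> C0 e0 SS.
have [c c0 Hc] := vop_contraction.
pose pic := fix pic (l : nat) : 'I_n -> R -> R -> R :=
  if l is l'.+1 then fun i t z => S i t z + vop (pic l') i 0 t z else fun _ _ _ => 0.
pose C' := 2 * C * expR (c * L).
have C'0 : 0 <= C' by rewrite !mulr_ge0// expR_ge0.
have SM i u x : 0 < u < L -> `|S i u x| <= C * om c u * wt e x.
  move=> uL; have [_ sb] := SS i; apply: (le_trans (sb u uL x)).
  rewrite ler_wpM2r ?wt_ge0//; apply: ler_wpM2l => //.
  by apply: isqrt_le_om; rewrite ?ltW//; case/andP: uL.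
have sing_of f : (forall u x, 0 < u < L -> cont_at f u x) ->
    (forall u x, 0 < u < L -> `|f u x| <= 2 * C * om c u * wt e x) -> singular L C' e f.
  move=> cf fM; split => // u uL x; apply: (le_trans (fM u x uL)).
  rewrite ler_wpM2r ?wt_ge0// /C' -[leRHS]mulrA; apply: ler_wpM2l; first by rewrite mulr_ge0.
  by apply: om_le_isqrt; rewrite ltW//; case/andP: uL.
(* The bound 2C reproduces itself: C from the source plus half of 2C from the operator. *)
have picS l : (forall i, singular L C' e (pic l i)) /\
    forall i u x, 0 < u < L -> `|pic l i u x| <= 2 * C * om c u * wt e x.
  elim: l => [|l [IH1 IH2]].
    have b i u x : 0 < u < L -> `|pic 0 i u x| <= 2 * C * om c u * wt e x.
      by move=> _; rewrite normr0 mulr_ge0 ?wt_ge0// mulr_ge0 ?om_ge0// mulr_ge0.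
    split => // i; apply: sing_of; last exact: b.
    by move=> u x _; exact: cvg_cst.
  have b i u x : 0 < u < L -> `|pic l.+1 i u x| <= 2 * C * om c u * wt e x.
    move=> uL /=; apply: (le_trans (ler_normD _ _)).
    have v := Hc (pic l) i C' e (2 * C) u x C'0 e0 (mulr_ge0 (ler0n _ 2) C0) IH1 uL.
    rewrite [leRHS](_ : _ = C * om c u * wt e x + 2 * C / 2 * om c u * wt e x); last by field.
    apply: lerD; first exact: SM.
    apply: v => j u' x' /andP[u'0 u'u]; apply: IH2; rewrite u'0 (lt_trans u'u)//.
    by case/andP: uL.
  split => // i; apply: sing_of; last exact: b.
  move=> u x uL; apply: cvgD; first by have [sc _] := SS i; exact: sc.
  apply: (@vop_cvg_singular _ (u, x) (fun=> 0) fst snd (pic l) i C' e C'0 e0 IH1 uL).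
  - exact: cvg_cst.
  - exact: cvg_fst.
  - exact: cvg_snd.
have C20 : 0 <= C' + C' by rewrite addr_ge0.
have diff l : forall i u x, 0 < u < L ->
    `|pic l.+1 i u x - pic l i u x| <= (C / 2 ^+ l) * om c u * wt e x.
  elim: l => [|l IH] i u x uL.
    rewrite expr0 divr1 subr0.
    have -> : pic 1 i u x = S i u x.
      rewrite /= (_ : vop _ _ _ _ _ = 0) ?addr0// /vop big1// => j _.
      rewrite /jop (_ : cut _ _ _ = cst 0) ?/intR ?Rintegral_cst ?mul0r//.
      apply/funext => v; rewrite /cut; case: ifP => // _.
      rewrite hflow0E /gavg (_ : (fun w => _) = cst 0) ?/intR ?Rintegral_cst ?mul0r ?mulr0//.
      by apply/funext => w; rewrite mul0r.
    exact: SM.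
  have -> : pic l.+2 i u x - pic l.+1 i u x = vop (fun j u x => pic l.+1 j u x - pic l j u x) i 0 u x.
    rewrite (vop_sub i x C'0 e0 (picS l.+1).1 (picS l).1 uL).
    by rewrite -[pic l.+2 i u x]/(S i u x + vop (pic l.+1) i 0 u x) -[X in _ - X = _]/(S i u x + vop (pic l) i 0 u x) opprD addrACA subrr add0r.
  have Cl0 : 0 <= C / 2 ^+ l by rewrite divr_ge0// exprn_ge0.
  have H := Hc (fun j u x => pic l.+1 j u x - pic l j u x) i (C' + C') e (C / 2 ^+ l) u x C20 e0 Cl0
    (fun j => singular_sub ((picS l.+1).1 j) ((picS l).1 j)) uL.
  rewrite (_ : C / 2 ^+ l.+1 = C / 2 ^+ l / 2); last first.
    by rewrite exprS; field; rewrite expf_neq0.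
  apply: H => j u' x' /andP[u'0 u'u].
  by apply: IH; rewrite u'0 (lt_trans u'u)//; case/andP: uL.
have lim i u x : {y | 0 < u < L ->
    pic l i u x @[l --> \oo] --> y /\
    forall l, `|y - pic l i u x| <= 2 * (C * om c u * wt e x) / 2 ^+ l}.
  apply: cid; have [uL|uL] := boolP (0 < u < L); last by exists 0.
  have [|y Hy] := @geometric_limit (fun l => pic l i u x) (C * om c u * wt e x); last by exists y.
  move=> l; apply: (le_trans (diff l i u x uL)).
  by rewrite le_eqVlt; apply/orP; left; apply/eqP; ring.
pose Psi i u x := sval (lim i u x).
have Pl i u x : 0 < u < L -> pic l i u x @[l --> \oo] --> Psi i u x.
  by move=> uL; have [] := svalP (lim i u x) uL.
have Pd i u x l : 0 < u < L -> `|Psi i u x - pic l i u x| <= (2 * C / 2 ^+ l) * om c u * wt e x.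
  move=> uL; have [_] := svalP (lim i u x) uL => /(_ l) /le_trans; apply.
  by rewrite le_eqVlt; apply/orP; left; apply/eqP; ring.
have PM i u x : 0 < u < L -> `|Psi i u x| <= 2 * C * om c u * wt e x.
  by move=> uL; have := Pd i u x 0%N uL; rewrite expr0 divr1 subr0.
have com u x : 0 < u < L -> cont_at (fun u x => 2 * C * om c u * wt e x) u x.
  move=> /andP[u0 _].
  have c1 : {for (u, x), continuous (fun q : R * R => c * q.1)}.
    by apply: cvgM; [exact: cvg_cst|exact: cvg_fst].
  have c2 : {for (u, x), continuous (fun q : R * R => expR (c * q.1))}.
    by apply: (@continuous_comp _ _ _ (fun q : R * R => c * q.1) expR); [exact: c1|exact: continuous_expR].
  have c3 : {for (u, x), continuous (fun q : R * R => Num.sqrt q.1)}.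
    by apply: (@continuous_comp _ _ _ fst Num.sqrt); [exact: cvg_fst|exact: sqrt_continuous].
  have c4 : {for (u, x), continuous (fun q : R * R => (Num.sqrt q.1)^-1)}.
    by apply: cvgV c3; rewrite gt_eqF// sqrtr_gt0.
  have c5 : {for (u, x), continuous (fun q : R * R => expR q.2)}.
    by apply: (@continuous_comp _ _ _ snd expR); [exact: cvg_snd|exact: continuous_expR].
  apply: cvgM; last by apply: cvgD c5; exact: cvg_cst.
  by apply: cvgM; [exact: cvg_cst|exact: cvgM c2 c4].
(* Convergence is locally uniform: near (u, x) the weight stays below B + 1, so that a single
   iterate is within ep / 3 of the limit. *)
have Pc i u x : 0 < u < L -> cont_at (Psi i) u x.
  move=> uL; apply/cvgrPdist_lt => ep ep0.
  pose B := 2 * C * om c u * wt e x.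
  have B0 : 0 <= B by rewrite mulr_ge0 ?wt_ge0// mulr_ge0 ?om_ge0// mulr_ge0.
  have [l Hl] : exists l : nat, (B + 1) / 2 ^+ l < ep / 3.
    have ep3 : 0 < ep / 3 by rewrite divr_gt0.
    have /cvgrPdist_lt/(_ _ ep3)[l _ /(_ l (leqnn _))] := cvg_half_pow (B + 1).
    by rewrite sub0r normrN => /(le_lt_trans (ler_norm _)) h; exists l.
  have n1 : \forall q \near (u, x), 2 * C * om c q.1 * wt e q.2 < B + 1.
    have cm : 2 * C * om c q.1 * wt e q.2 @[q --> (u, x)] --> B by exact: (com u x uL).
    by apply: (cvgr_lt _ cm); rewrite ltrDl.
  have n2 : \forall q \near (u, x), 0 < q.1 < L.
    have cf : {for (u, x), continuous (fst : R * R -> R)} by exact: cvg_fst.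
    have [u0 uL'] := andP uL.
    have a1 : \forall q \near (u, x), 0 < q.1 by exact: (cvgr_gt _ cf).
    have a2 : \forall q \near (u, x), q.1 < L by exact: (cvgr_lt _ cf).
    by apply: filterS2 a1 a2 => q ? ?; apply/andP.
  have n3 : \forall q \near (u, x), `|pic l i u x - pic l i q.1 q.2| < ep / 3.
    have [pc _] := (picS l).1 i.
    have := pc u x uL; rewrite /cont_at => /cvgrPdist_lt; apply.
    by rewrite divr_gt0.
  apply: filterS3 n1 n2 n3 => q q1 q2 q3.
  have l0 : 0 < (2 ^+ l)^-1 :> R by rewrite invr_gt0 exprn_gt0.
  have h1 : `|Psi i q.1 q.2 - pic l i q.1 q.2| < ep / 3.
    apply: le_lt_trans Hl; apply: (le_trans (Pd i _ _ l q2)).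
    rewrite [leLHS](_ : _ = 2 * C * om c q.1 * wt e q.2 / 2 ^+ l); last by ring.
    by rewrite ler_pM2r// ltW.
  have h2 : `|Psi i u x - pic l i u x| < ep / 3.
    apply: le_lt_trans Hl; apply: (le_trans (Pd i _ _ l uL)).
    rewrite [leLHS](_ : _ = B / 2 ^+ l); last by rewrite /B; ring.
    by rewrite ler_pM2r// lerDl.
  rewrite /= (_ : Psi i u x - Psi i q.1 q.2 = (Psi i u x - pic l i u x) +
    (pic l i u x - pic l i q.1 q.2) - (Psi i q.1 q.2 - pic l i q.1 q.2)); last by ring.
  apply: (le_lt_trans (ler_normB _ _)).
  apply: (le_lt_trans (lerD (ler_normD _ _) (lexx _))).
  lra.
have PS i : singular L C' e (Psi i).
  by apply: sing_of; [exact: Pc|exact: PM].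
exists Psi, C' => //; split => // [i t z tL|S0 k0 i t z tL].
  apply/eqP; rewrite -subr_eq0 -normr_le0.
  apply: (@half_pow_bound _ _ (2 * C * om c t * wt e z)) => l.
  rewrite add0r.
  have -> : Psi i t z - (S i t z + vop Psi i 0 t z) = (Psi i t z - pic l.+1 i t z)
     - vop (fun j u x => Psi j u x - pic l j u x) i 0 t z.
    rewrite (vop_sub i z C'0 e0 PS (picS l).1 tL).
    rewrite -[pic l.+1 i t z]/(S i t z + vop (pic l) i 0 t z).
    move: (Psi i t z) (S i t z) (vop Psi i 0 t z) (vop (pic l) i 0 t z) => p1 p2 p3 p4.
    by ring.
  apply: (le_trans (ler_normB _ _)).
  have Cl0 : 0 <= 2 * C / 2 ^+ l by rewrite divr_ge0 ?mulr_ge0// exprn_ge0.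
  have H := Hc (fun j u x => Psi j u x - pic l j u x) i (C' + C') e (2 * C / 2 ^+ l) t z C20 e0 Cl0
    (fun j => singular_sub (PS j) ((picS l).1 j)) tL.
  have {}H := H _.
  apply: (le_trans (lerD (Pd i t z l.+1 tL) (H _))).
    move=> j u x /andP[u0 ut]; apply: Pd; rewrite u0 (lt_trans ut)//.
    by case/andP: tL.
  by rewrite exprS le_eqVlt; apply/orP; left; apply/eqP; field; rewrite expf_neq0.
have pic0 l : forall i t z, 0 < t < L -> 0 <= pic l i t z.
  elim: l => [//|l IH] i' t' z' tL'; rewrite /= addr_ge0// ?S0//.
  apply: sumr_ge0 => j _; apply: intR_ge0 => v; rewrite /cut.
  case: ifP => // /andP[v0 vt]; apply: mulr_ge0; first by apply: k0; exact: ltW.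
  apply: hflow_ge0 => x; apply: IH.
  by rewrite subr_gt0 vt/= ltrBlDr (lt_trans (proj2 (andP tL')))// ltrDl.
rewrite -(cvg_lim _ (Pl i t z tL))//; apply: limr_ge.
  by apply/cvg_ex; eexists; exact: Pl.
by apply: nearW => l; exact: pic0.
Qed.

End volterra.

(** * Solutions regular up to time 0, and uniqueness *)

Section regularity.
Context {R : realType} (n : nat).
Variables (m s : 'I_n -> R) (L : R) (kap : 'I_n -> 'I_n -> R -> R -> R).
Hypotheses (s_gt0 : forall i, 0 < s i) (L_gt0 : 0 < L).
Hypothesis ckap : forall i j y v, cont_at (kap i j) y v.
Implicit Types (Psi S : 'I_n -> R -> R -> R).
Local Notation vp := (vop m s kap).

Lemma eq_vop Psi Xi i y t z :
  (forall j u x, 0 < u < t -> Psi j u x = Xi j u x) -> vp Psi i y t z = vp Xi i y t z.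
Proof.
move=> E; apply: eq_bigr => j _; congr intR; apply/funext => v; rewrite /cut.
case: ifP => // /andP[v0 vt]; rewrite (_ : Psi j (t - v) = Xi j (t - v))//.
by apply/funext => x; apply: E; rewrite subr_gt0 vt/= gtrBl.
Qed.

Lemma vop_le0 Psi i y t z : t <= 0 -> vp Psi i y t z = 0.
Proof. by move=> t0; rewrite /vop big1// => j _; exact: jop_le0. Qed.

Lemma vop_shift Psi i y t z a :
  vp (fun j u x => Psi j u (x + a)) i y t z = vp Psi i y t (z + a).
Proof.
apply: eq_bigr => j _; congr intR; apply/funext => v; rewrite /cut.
case: ifP => // _; rewrite !hflow0E /gavg; congr (_ * intR _); apply/funext => w.
by congr (Psi _ _ _ * _); ring.
Qed.

(** The singularity integrates to 2 sqrt t. One application of the operator thus turns a singular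
    function into a bounded one that vanishes at time 0, which is how singular bounds are upgraded
    below. *)
Lemma vop_singular_le : exists2 B, 0 <= B &
  forall Psi i (D e t z : R), 0 <= D -> 0 <= e -> (forall j, singular L D e (Psi j)) ->
    0 < t < L -> `|vp Psi i 0 t z| <= B * D * Num.sqrt t * wt e z.
Proof.
have Qex i j : {Q | 0 <= Q /\ forall v, 0 <= v <= L -> `|kap i j 0 v| <= Q}.
  apply: cid; have [Q Q0 HQ] := loc_bound 0 (ltW L_gt0) (@ckap i j).
  by exists Q; split => // v vL; apply: HQ => //; rewrite subrr normr0.
pose Q i j := sval (Qex i j).
have Q0 i j : 0 <= Q i j by have [] := svalP (Qex i j).
have HQ i j v : 0 <= v <= L -> `|kap i j 0 v| <= Q i j.
  by have [_] := svalP (Qex i j); apply.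
have h0 i : 0 <= hcst (m i) (s i) L by exact: hcst_ge0.
pose H i := \sum_(j < n) Q i j * hcst (m i) (s i) L.
have H0 i : 0 <= H i by apply: sumr_ge0 => j _; rewrite mulr_ge0.
pose B := \sum_(i < n) H i.
have HB i : H i <= B by rewrite /B (bigD1 i)//= lerDl sumr_ge0.
have B0 : 0 <= B by apply: sumr_ge0.
exists (2 * B); first by rewrite mulr_ge0.
move=> Psi i D e t z D0 e0 PS tL; have [t0 tL'] := andP tL.
set W := D * wt e z * (2 * Num.sqrt t).
have W0 : 0 <= W by rewrite mulr_ge0 ?mulr_ge0 ?wt_ge0 ?sqrtr_ge0.
have term j : `|jop (m i) (s i) 0 (kap i j) (Psi j) 0 t z| <= Q i j * hcst (m i) (s i) L * W.
  pose C := Q i j * D * hcst (m i) (s i) L * wt e z.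
  have C0 : 0 <= C by apply: prod4_ge0 => //; exact: wt_ge0.
  have i1 := @isqrt_cut_intgR _ C t t0.
  have [|_ le] := @jop_int _ (m i) (s i) L (s_gt0 i) 0 (kap i j) (Psi j) D e 0 t z
    (fun v => C * (Num.sqrt (t - v))^-1) D0 e0 (@ckap i j) (PS j) tL' (intgR_cut_refl i1).
    exact: (singular_dom (m i) (s_gt0 i) z D0 e0 (PS j) tL' (Q0 i j) (HQ i j)).
  apply: (le_trans le); rewrite (intR_cut_refl i1).
  apply: (le_trans (isqrt_cut_le C0 t0)).
  by rewrite /C /W le_eqVlt; apply/orP; left; apply/eqP; ring.
apply: (le_trans (ler_norm_sum _ _ _)).
apply: (@le_trans _ _ (\sum_(j < n | j != i) Q i j * hcst (m i) (s i) L * W)).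
  by apply: ler_sum => j _; exact: term.
rewrite -mulr_suml.
have le1 : \sum_(j < n | j != i) Q i j * hcst (m i) (s i) L <= B.
  apply: le_trans (HB i); rewrite /H [leRHS](bigD1 i)//= lerDr.
  by rewrite mulr_ge0.
apply: (le_trans (ler_wpM2r W0 le1)).
by rewrite /W le_eqVlt; apply/orP; left; apply/eqP; ring.
Qed.

(** Across [t = 0] the bound by a multiple of sqrt t squeezes the operator to 0, its value at
    negative times. *)
Lemma vop_cont Psi i (D e t z : R) : 0 <= D -> 0 <= e ->
  (forall j, singular L D e (Psi j)) -> t < L -> cont_at (fun t z => vp Psi i 0 t z) t z.
Proof.
move=> D0 e0 PS tL; have cf : {for (t, z), continuous (fst : R * R -> R)} by exact: cvg_fst.
have cs : {for (t, z), continuous (snd : R * R -> R)} by exact: cvg_snd.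
have [t0|t0] := ltP 0 t.
  apply: (@vop_cvg_singular _ _ m s L kap s_gt0 L_gt0 ckap _ (t, z) (fun=> 0) fst snd Psi i D e D0 e0 PS) => //.
    by rewrite t0.
  exact: cvg_cst.
have [B B0 HB] := vop_singular_le.
rewrite /cont_at /prop_for /continuous_at vop_le0//.
have n1 : \forall q \near (t, z), q.1 < L by exact: (cvgr_lt _ cf).
have n2 : \forall q \near (t, z), `|vp Psi i 0 q.1 q.2| <= B * D * Num.sqrt q.1 * wt e q.2.
  apply: filterS n1 => q q1; have [q0|q0] := ltP 0 q.1.
    by apply: HB => //; rewrite q0.
  by rewrite vop_le0// normr0 (ler0_sqrtr q0) mulr0 mul0r.
have c1 : B * D * Num.sqrt q.1 * wt e q.2 @[q --> (t, z)] --> 0.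
  have -> : 0 = B * D * Num.sqrt t * wt e z by rewrite (ler0_sqrtr t0) mulr0 mul0r.
  have c1 : {for (t, z), continuous (fun q : R * R => Num.sqrt q.1)}.
    by apply: (@continuous_comp _ _ _ fst Num.sqrt); [exact: cf|exact: sqrt_continuous].
  have c2 : {for (t, z), continuous (fun q : R * R => expR q.2)}.
    by apply: (@continuous_comp _ _ _ snd expR); [exact: cs|exact: continuous_expR].
  apply: cvgM; first by apply: cvgM c1; exact: cvg_cst.
  by apply: cvgD c2; exact: cvg_cst.
apply: norm_cvg0; apply: (squeeze_cvgr _ (cvg_cst 0) c1).
by apply: filterS n2 => q -> /=; rewrite normr_ge0.
Qed.

Lemma singular_shift (f : R -> R -> R) (D e a : R) : 0 <= D -> 0 <= e -> singular L D e f ->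
  singular L (D * expR `|a|) e (fun u x => f u (x + a)).
Proof.
move=> D0 e0 [fc fb]; split => [u x uL|u uL x].
  apply: (@cont_at_comp _ _ (u, x) fst (fun q => q.2 + a) f).
  - exact: cvg_fst.
  - by apply: cvgD; [exact: cvg_snd|exact: cvg_cst].
  - exact: fc.
apply: (le_trans (fb u uL _)).
have Du : 0 <= D * (Num.sqrt u)^-1 by rewrite mulr_ge0// invr_ge0 sqrtr_ge0.
apply: (le_trans (ler_wpM2l Du (wt_shift x a e0))).
by rewrite le_eqVlt; apply/orP; left; apply/eqP; ring.
Qed.

(* A source that is bounded and Lipschitz in [z] up to [t = 0] has a solution
   of the same kind: translations in [z] commute with the operator, so the
   increments solve the same equation. *)
Lemma volterra_regular S (C e : R) : 0 <= C -> 0 <= e ->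
  (forall i u x, u < L -> cont_at (S i) u x) ->
  (forall i u, u < L -> bdd C e (S i u)) ->
  (forall i u, u < L -> wlip C e (S i u)) ->
  exists Psi, exists2 D, 0 <= D &
    [/\ forall i, regular L D e (Psi i),
        forall i t z, t < L -> Psi i t z = S i t z + vp Psi i 0 t z &
        (forall i t z, 0 < t < L -> 0 <= S i t z) ->
        (forall i j v, 0 <= v -> 0 <= kap i j 0 v) ->
        forall i t z, 0 < t < L -> 0 <= Psi i t z].
Proof.
move=> C0 e0 Sc Sb Sl.
have sqL : 0 <= C * Num.sqrt L by rewrite mulr_ge0// sqrtr_ge0.
have [Xi [D' D'0 [XS XE Xpos]]] := volterra_exists m s_gt0 L_gt0 ckap sqL e0
  (fun i => regular_singular C0 e0 (And3 (Sc i) (Sb i) (Sl i))).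
(* [Xi] is controlled at positive times only. The right-hand side of its equation agrees with it
   there, and is in addition bounded, continuous across 0 and meaningful at negative times. *)
pose Psi i t z := S i t z + vp Xi i 0 t z.
have Pdef i t z : Psi i t z = S i t z + vp Xi i 0 t z by [].
clearbody Psi.
have PX i t z : 0 < t < L -> Psi i t z = Xi i t z by move=> tL; rewrite Pdef XE.
have PE i t z : t < L -> Psi i t z = S i t z + vp Psi i 0 t z.
  move=> tL; rewrite Pdef (@eq_vop Xi Psi)// => j u x /andP[u0 ut].
  by apply/esym/PX; rewrite u0 (lt_trans ut).
have [B B0 HB] := vop_singular_le.
have [A A0 HA] := volterra_apriori m s_gt0 L_gt0 ckap.
have Pc i u x : u < L -> cont_at (Psi i) u x.
  move=> uL; have H := @vop_cont Xi i D' e u x D'0 e0 XS uL.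
  rewrite (_ : Psi i = fun t z => S i t z + vp Xi i 0 t z); last first.
    by apply/funext => t; apply/funext => z; rewrite Pdef.
  exact: (cvgD (Sc i u x uL) H).
have sqL2 u : u < L -> Num.sqrt u <= Num.sqrt L by move=> uL; rewrite ler_wsqrtr// ltW.
pose D1 := C + B * D' * Num.sqrt L.
have D10 : 0 <= D1 by rewrite addr_ge0// !mulr_ge0// sqrtr_ge0.
have Pb i u : u < L -> bdd D1 e (Psi i u).
  move=> uL x; have [u0|u0] := leP u 0.
    rewrite Pdef vop_le0// addr0; apply: (le_trans (Sb i u uL x)).
    by rewrite ler_wpM2r ?wt_ge0// lerDl !mulr_ge0// sqrtr_ge0.
  rewrite Pdef; apply: (le_trans (ler_normD _ _)).
  rewrite mulrDl; apply: lerD; first exact: Sb.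
  have uL' : 0 < u < L by rewrite u0.
  apply: (le_trans (HB Xi i D' e u x D'0 e0 XS uL')).
  by rewrite ler_wpM2r ?wt_ge0// ler_wpM2l ?mulr_ge0 ?sqL2.
pose D2 := A * (C * Num.sqrt L).
have D20 : 0 <= D2 by rewrite mulr_ge0.
pose D3 := C + B * D2 * Num.sqrt L.
have D30 : 0 <= D3 by rewrite addr_ge0// !mulr_ge0// sqrtr_ge0.
have Pl i u : u < L -> wlip D3 e (Psi i u).
  move=> uL x a; set al := `|a| * expR `|a|.
  have al0 : 0 <= al by rewrite mulr_ge0// expR_ge0.
  have [u0|u0] := leP u 0.
    rewrite !Pdef !vop_le0// !addr0; apply: (le_trans (Sl i u uL x a)).
    rewrite ler_wpM2r ?wt_ge0//; apply: ler_wpM2r => //.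
    by rewrite lerDl !mulr_ge0// sqrtr_ge0.
  pose Da j t z := Psi j t (z + a) - Psi j t z.
  have PS j : singular L (D1 * Num.sqrt L) e (Psi j).
    split => [t z /andP[_ tL]|t /andP[t0 tL] z]; first exact: Pc.
    apply: (le_trans (Pb j t tL z)); rewrite ler_wpM2r ?wt_ge0// ler_pdivlMr ?sqrtr_gt0//.
    by apply: ler_wpM2l => //; exact: sqL2.
  have DL0 : 0 <= D1 * Num.sqrt L by rewrite mulr_ge0// sqrtr_ge0.
  have DL1 : 0 <= D1 * Num.sqrt L * expR `|a| by rewrite mulr_ge0// expR_ge0.
  have PSa j := singular_shift a DL0 e0 (PS j).
  have DS j := singular_sub (PSa j) (PS j).
  have Dsum : 0 <= D1 * Num.sqrt L * expR `|a| + D1 * Num.sqrt L by rewrite addr_ge0.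
  have DE j t z : 0 < t < L -> Da j t z = (S j t (z + a) - S j t z) + vp Da j 0 t z.
    move=> tL; have [_ tL'] := andP tL.
    pose DD := D1 * Num.sqrt L * expR `|a|.
    have le1 : D1 * Num.sqrt L <= DD.
      by rewrite /DD ler_peMr// -expR0 ler_expR.
    have PS' k := singular_le e0 le1 (PS k).
    rewrite /Da (vop_sub m s_gt0 L_gt0 ckap j z DL1 e0 PSa PS' tL).
    rewrite vop_shift !(PE j t _ tL').
    by move: (S j t (z + a)) (S j t z) (vp Psi j 0 t (z + a)) (vp Psi j 0 t z) => p1 p2 p3 p4; ring.
  (* The a priori bound makes the increments proportional to [al], but still with a factor 1 / sqrt
     t; inserting it once more into [DE] removes this factor. *)
  have DA t1 : t1 < L -> forall j t z, 0 < t <= t1 ->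
      `|Da j t z| <= A * (C * Num.sqrt L * al) * (Num.sqrt t)^-1 * wt e z.
    move=> t1L; have M0 : 0 <= C * Num.sqrt L * al by rewrite mulr_ge0.
    apply: (HA Da _ e _ t1 Dsum e0 M0 t1L DS) => j t z /andP[t0 tt1].
    have tL := le_lt_trans tt1 t1L.
    rewrite DE ?t0//; apply: (le_trans (ler_normD _ _)); rewrite lerD2r.
    apply: (le_trans (Sl j t tL z a)); rewrite ler_wpM2r ?wt_ge0//.
    rewrite ler_pdivlMr ?sqrtr_gt0// mulrAC; apply: ler_wpM2r => //.
    by apply: ler_wpM2l => //; exact: sqL2.
  have D2al : 0 <= D2 * al by rewrite mulr_ge0.
  have DS2 j : singular L (D2 * al) e (Da j).
    have [dc _] := DS j; split => // t tL z; have [t0 tL'] := andP tL.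
    have := DA t tL' j t z; rewrite t0 lexx => /(_ isT) /le_trans; apply.
    by rewrite /D2 le_eqVlt; apply/orP; left; apply/eqP; ring.
  have uL' : 0 < u < L by rewrite u0.
  rewrite -/(Da i u x) DE//; apply: (le_trans (ler_normD _ _)).
  rewrite /D3 !mulrDl; apply: lerD; first exact: Sl.
  apply: (le_trans (HB Da i (D2 * al) e u x D2al e0 DS2 uL')).
  rewrite ler_wpM2r ?wt_ge0//.
  apply: (@le_trans _ _ (B * (D2 * al) * Num.sqrt L)).
    by apply: ler_wpM2l; [rewrite mulr_ge0|exact: sqL2].
  by rewrite le_eqVlt; apply/orP; left; apply/eqP; ring.
exists Psi, (D1 + D3); first by rewrite addr_ge0.
split => //.
  move=> i; split; first exact: Pc.
    move=> u uL x; apply: (le_trans (Pb i u uL x)).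
    by rewrite ler_wpM2r ?wt_ge0// lerDl.
  move=> u uL x a; apply: (le_trans (Pl i u uL x a)).
  by rewrite ler_wpM2r ?wt_ge0// ler_wpM2r ?mulr_ge0 ?expR_ge0// lerDr.
by move=> S0 k0 i t z tL; rewrite PX//; exact: Xpos.
Qed.

(** The difference satisfies the hypothesis of [volterra_apriori] with [M = 0]. The growth weight
    [e] is left free: regular solutions are compared with [e = 0], elements of B with [e = 1]. *)
Lemma volterra_unique (Psi Xi : 'I_n -> R -> R -> R) (D e t1 : R) :
  0 <= D -> 0 <= e -> t1 < L ->
  (forall i, singular L D e (Psi i)) -> (forall i, singular L D e (Xi i)) ->
  (forall i t z, 0 < t <= t1 -> Psi i t z - vp Psi i 0 t z = Xi i t z - vp Xi i 0 t z) ->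
  forall i t z, 0 < t <= t1 -> Psi i t z = Xi i t z.
Proof.
move=> D0 e0 t1L PS XS E i t z tt1.
have [A A0 HA] := volterra_apriori m s_gt0 L_gt0 ckap.
have H := HA (fun j u x => Psi j u x - Xi j u x) (D + D) e 0 t1 (addr_ge0 D0 D0) e0 (lexx 0) t1L
  (fun j => singular_sub (PS j) (XS j)).
have {}H := H _ i t z tt1.
apply/eqP; rewrite -subr_eq0 -normr_le0; move: H; rewrite mulr0 !mul0r; apply.
move=> j u x /andP[u0 ut]; rewrite !mul0r add0r.
rewrite (vop_sub m s_gt0 L_gt0 ckap j x D0 e0 PS XS); last by rewrite u0 (le_lt_trans ut).
have := E j u x; rewrite u0 ut => /(_ isT) => Ej.
suff -> : Psi j u x - Xi j u x = vp Psi j 0 u x - vp Xi j 0 u x by exact: lexx.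
by apply/eqP; rewrite subr_eq addrAC -addrA -Ej addrC subrK.
Qed.

End regularity.

(** * The equation at age 0 *)

Section singular_closure.
Context {R : realType}.
Variable L : R.
Hypothesis L_gt0 : 0 < L.
Implicit Types f g : R -> R -> R.

(** The constant is hidden because for the source of the differentiated equation, a long sum of
    products, only its existence matters. *)
Definition singular_ex (e : R) f : Prop := exists2 C, 0 <= C & singular L C e f.

Lemma singular_exD e f g : singular_ex e f -> singular_ex e g ->
  singular_ex e (fun t z => f t z + g t z).
Proof.
move=> [C C0 [fc fb]] [D D0 [gc gb]]; exists (C + D); first exact: addr_ge0.
split => [u x uL|u uL x]; first by apply: cvgD; [exact: fc|exact: gc].
apply: (le_trans (ler_normD _ _)); rewrite !mulrDl.
by apply: lerD; [exact: fb|exact: gb].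
Qed.

Lemma singular_exM e (k : R -> R) f : 0 <= e -> continuous k -> singular_ex e f ->
  singular_ex e (fun t z => k t * f t z).
Proof.
move=> e0 ck [C C0 [fc fb]].
have [|Q Q0 HQ] := @loc_bound R (fun _ v => k v) 0 L (ltW L_gt0).
  by move=> y v; apply: (cvg_comp snd k cvg_snd); exact: ck.
exists (Q * C); first exact: mulr_ge0.
split => [u x uL|u uL x].
  have h : {for (u, x), continuous (fun q : R * R => k q.1)}.
    by apply: (@continuous_comp _ _ _ fst k); [exact: cvg_fst|exact: ck].
  exact: (cvgM h (fc u x uL)).
rewrite normrM; have kQ : `|k u| <= Q.
  apply: (HQ 0 u); first by rewrite subrr normr0.
  by case/andP: uL => ? ?; rewrite !ltW.
apply: (le_trans (ler_pM _ _ kQ (fb u uL x))) => //.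
by rewrite le_eqVlt; apply/orP; left; apply/eqP; ring.
Qed.

Lemma singular_ex_sum e (I : finType) (P : pred I) (f : I -> R -> R -> R) :
  (forall i, P i -> singular_ex e (f i)) ->
  singular_ex e (fun t z => \sum_(i | P i) f i t z).
Proof.
move=> H.
have E : forall l : seq I, singular_ex e (fun t z => \sum_(i <- l | P i) f i t z).
  elim=> [|i l IH].
    exists 0 => //; split => [u x _|u _ x].
      rewrite /cont_at /prop_for /continuous_at big_nil.
      by under eq_fun do rewrite big_nil; exact: cvg_cst.
    by rewrite big_nil normr0 !mul0r.
  have [Pi|nPi] := boolP (P i); last first.
    rewrite (_ : (fun t z => _) = (fun t z => \sum_(i <- l | P i) f i t z))//.
    by apply/funext => t; apply/funext => z; rewrite big_cons (negbTE nPi).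
  rewrite (_ : (fun t z => _) = (fun t z => f i t z + \sum_(i <- l | P i) f i t z)).
    exact: singular_exD (H i Pi) IH.
  by apply/funext => t; apply/funext => z; rewrite big_cons Pi.
exact: E.
Qed.

Lemma singular_uniform e (n : nat) (f : 'I_n -> R -> R -> R) : 0 <= e ->
  (forall i, singular_ex e (f i)) -> exists2 C, 0 <= C & forall i, singular L C e (f i).
Proof.
move=> e0 H.
apply: (@fin_bound R _ (fun i C => singular L C e (f i))) => // i a b.
exact: singular_le.
Qed.

Definition primitive (h : R -> R) f (t z : R) : R := h z + intR (cut 0 t (f ^~ z)).

Lemma cont_at_l f u x : cont_at f u x -> {for u, continuous (f ^~ x)}.
Proof.
move=> cf; apply: (@cont_at_comp _ _ u id (fun=> x) f) => //.
exact: cvg_cst.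
Qed.

Lemma primitive_dom (C e z t : R) f : 0 <= C -> 0 <= e -> singular L C e f -> t < L ->
  measurable_fun setT (cut 0 t (f ^~ z)) /\
  forall u, `|cut 0 t (f ^~ z) u| <= cut 0 L (fun u => C * wt e z * (Num.sqrt u)^-1) u.
Proof.
move=> C0 e0 [fc fb] tL; split.
  apply: mfun_cut => u /andP[u0 ut]; apply: cont_at_l; apply: fc.
  by rewrite u0 (lt_trans ut).
move=> u; rewrite /cut; case: ifP => [/andP[u0 ut]|_].
  have uL : 0 < u < L by rewrite u0 (lt_trans ut).
  by rewrite uL; apply: (le_trans (fb u uL z)); rewrite mulrAC.
rewrite normr0; case: ifP => // _.
by rewrite mulr_ge0 ?mulr_ge0 ?wt_ge0// invr_ge0 sqrtr_ge0.
Qed.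

Lemma primitive_derive h f (C e t z : R) : 0 <= C -> 0 <= e -> singular L C e f ->
  0 < t < L -> is_derive t 1 (primitive h f ^~ z) (f t z).
Proof.
move=> C0 e0 fS /andP[t0 tL].
pose l := (t + L) / 2.
have tl : t < l by rewrite midf_lt.
have lL : l < L by rewrite midf_lt.
have [mf le] := primitive_dom z C0 e0 fS lL.
have i : intgR (cut 0 l (f ^~ z)) by exact: intgR_le mf le (isqrt_cut_intgR _ L_gt0).
have [fc _] := fS.
have tl0 : 0 < t < l by rewrite t0.
have cz : {for t, continuous (f ^~ z)} by apply: cont_at_l; apply: fc; rewrite t0.
exact: (dereq (derD (derc t (h z)) (cut_derive i tl0 cz)) (add0r _)).
Qed.

Lemma primitive_cont h f (C e t z : R) : continuous h -> 0 <= C -> 0 <= e ->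
  singular L C e f -> t < L -> cont_at (primitive h f) t z.
Proof.
move=> ch C0 e0 fS tL; have [fc fb] := fS.
have cf : {for (t, z), continuous (fst : R * R -> R)} by exact: cvg_fst.
have cs : {for (t, z), continuous (snd : R * R -> R)} by exact: cvg_snd.
have c1 : {for (t, z), continuous (fun q : R * R => h q.2)}.
  by apply: (@continuous_comp _ _ _ snd h); [exact: cs|exact: ch].
apply: (cvgD c1).
have nt : \forall q \near (t, z), q.1 < L by exact: (cvgr_lt _ cf).
have nz : \forall q \near (t, z), `|q.2 - z| <= 1.
  have : \forall q \near (t, z), `|z - q.2| < 1 by move/cvgrPdist_lt : cs; apply.
  by apply: filterS => q hq; rewrite distrC ltW.
apply: (@intR_cvg _ _ (t, z) (fun q : R * R => cut 0 q.1 (f ^~ q.2))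
  (cut 0 L (fun u => C * (expR 1 * wt e z) * (Num.sqrt u)^-1)) t).
- by apply: filterS nt => q qL; have [] := primitive_dom q.2 C0 e0 fS qL.
- exact: isqrt_cut_intgR.
- apply: filterS2 nt nz => q qL qz u; have [_ le] := primitive_dom q.2 C0 e0 fS qL.
  apply: (le_trans (le u)); rewrite /cut; case: ifP => // _.
  rewrite ler_wpM2r ?invr_ge0 ?sqrtr_ge0//; apply: ler_wpM2l => //.
  rewrite -[q.2](subrK z) addrC (le_trans (wt_shift _ _ e0))//.
  by rewrite ler_wpM2r ?wt_ge0// ler_expR.
- move=> u ut; have [u0|u0] := leP u 0.
    rewrite /cut ltNge u0/=; exact: cvg_cst.
  have [utp|utp|uE] := ltgtP u t; last by rewrite uE eqxx in ut.
    have uL : 0 < u < L by rewrite u0 (lt_trans utp).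
    apply: (@cvg_trans _ (f u q.2 @[q --> (t, z)])).
      apply: near_eq_cvg; have : \forall q \near (t, z), u < q.1 by exact: (cvgr_gt _ cf).
      by apply: filterS => q uq; rewrite /cut u0 uq.
    rewrite /cut u0 utp/=.
    apply: (@cont_at_comp _ _ (t, z) (fun=> u) snd f) => //; first exact: cvg_cst.
    exact: fc.
  apply: cvg_near_cst.
  have : \forall q \near (t, z), q.1 < u by exact: (cvgr_lt _ cf).
  by apply: filterS => q uq; rewrite /cut u0 !ltNge (ltW uq) (ltW utp).
Qed.

Lemma primitive_bdd h f (C D e t : R) : 0 <= C -> 0 <= D -> 0 <= e -> bdd D e h ->
  singular L C e f -> t < L -> bdd (D + C * (2 * Num.sqrt L)) e (primitive h f t).
Proof.
move=> C0 D0 e0 hD fS tL z.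
apply: (le_trans (ler_normD _ _)); rewrite mulrDl; apply: lerD; first exact: hD.
have [mf le] := primitive_dom z C0 e0 fS tL.
apply: (le_trans (intR_norm_le mf le (isqrt_cut_intgR _ L_gt0))).
have Cw : 0 <= C * wt e z by rewrite mulr_ge0 ?wt_ge0.
apply: (le_trans (isqrt_cut_le Cw L_gt0)).
by rewrite mulrAC.
Qed.

Lemma primitive0 h f (t z : R) : t <= 0 -> primitive h f t z = h z.
Proof.
move=> t0; rewrite /primitive (_ : cut _ _ _ = cst 0) ?/intR ?Rintegral_cst ?mul0r ?addr0//.
by apply/funext => u; rewrite cut_le0.
Qed.

End singular_closure.

Section payoff.
Context {R : realType}.
Variable K : R.
Hypothesis K_gt0 : 0 < K.

Definition payoff (z : R) : R := Num.max (expR z - K) 0.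

Lemma payoff_ge0 z : 0 <= payoff z. Proof. by rewrite le_max lexx orbT. Qed.

Lemma payoff_bdd : bdd 1 0 payoff.
Proof.
move=> z; rewrite mul1r /wt add0r ger0_norm ?payoff_ge0// ge_max expR_ge0 andbT.
by rewrite gerBl ltW.
Qed.

(** The positive part is 1-Lipschitz, and |exp a - 1| <= |a| exp|a| follows from exp a >= 1 + a and
    exp(- a) >= 1 - a. *)
Lemma payoff_lip : wlip 1 0 payoff.
Proof.
move=> x a; rewrite mul1r /wt add0r.
have H (p q : R) : `|Num.max p 0 - Num.max q 0| <= `|p - q|.
  rewrite ler_norml; have := ler_norm (p - q); have := ler_norm (q - p).
  rewrite (distrC q) => h1 h2; apply/andP; split.
    by case: (leP p 0); case: (leP q 0); lra.
  by case: (leP p 0); case: (leP q 0); lra.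
apply: (le_trans (H _ _)); rewrite opprB addrA subrK expRD.
rewrite (_ : expR x * expR a - expR x = expR x * (expR a - 1)); last by ring.
rewrite normrM (ger0_norm (expR_ge0 x)) mulrC ler_wpM2r ?expR_ge0//.
have ea := expR_ge1Dx a; have ena := expR_ge1Dx (- a).
have [a0|a0] := leP 0 a.
  rewrite (ger0_norm a0) ger0_norm; last by rewrite subr_ge0 -expR0 ler_expR.
  have : expR a * (1 - a) <= expR a * expR (- a) by rewrite ler_wpM2l// expR_ge0.
  rewrite expRN divff ?gt_eqF ?expR_gt0//; lra.
rewrite (ltr0_norm a0) ltr0_norm; last by rewrite subr_lt0 -expR0 ltr_expR.
have : 1 <= expR (- a) by rewrite -expR0 ler_expR oppr_ge0 ltW.
move=> h; have : - a * 1 <= - a * expR (- a) by rewrite ler_wpM2l// oppr_ge0 ltW.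
lra.
Qed.

Lemma payoff_cont : continuous payoff.
Proof.
move=> z.
have c1 : {for z, continuous (fun z => expR z - K)}.
  by apply: cvgB; [exact: continuous_expR|exact: cvg_cst].
have c2 : {for z, continuous (fun _ : R => 0 : R)} by exact: cvg_cst.
exact: (continuous_max c1 c2).
Qed.

End payoff.

(** * Source, kernel and solution for given rates and payoff *)

Section model.
Context {R : realType} (n : nat).
Variables (r s : 'I_n -> R) (L : R) (h : R -> R).
Variables (lam : 'I_n -> 'I_n -> R -> R) (Lam ell : 'I_n -> R -> R).
Hypotheses (r_ge0 : forall i, 0 <= r i) (s_gt0 : forall i, 0 < s i) (L_gt0 : 0 < L).
Hypotheses (ch : continuous h) (h_ge0 : forall x, 0 <= h x)
  (hb : bdd 1 0 h) (hl : wlip 1 0 h).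
Hypotheses (clam : forall i j, continuous (lam i j))
  (lam_ge0 : forall i j y, 0 <= lam i j y)
  (cLam : forall i, continuous (Lam i)) (cell : forall i, continuous (ell i))
  (dLam : forall i (y : R), -1 < y -> is_derive y 1 (Lam i) (ell i y)).

Definition drift i : R := r i - s i ^+ 2 / 2.
Local Notation m := drift.

(** The density of a switch to [j] at age [x], counted from age 0: the survival factor is
    included. *)
Definition hazard i j (x : R) : R := expR (- Lam i x) * lam i j x.
(** Without the normalisation by survival up to age [y], the kernel depends on ages through y + v
    only, the form required by [jop_diag_derive]. *)
Definition jker0 i j (y v : R) : R := hazard i j (y + v) * expR (- r i * v).
Definition jker i j (y v : R) : R := expR (Lam i y) * jker0 i j y v.
Definition disc i (y t : R) : R := expR (Lam i y - Lam i (y + t)) * expR (- r i * t).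
(* [src 0] is the expected discounted payment when no switch occurs before
   maturity. *)
Definition src k i (y t z : R) : R := disc i y t * hflow (m i) (s i) k h t z.

Lemma chazard i j : continuous (hazard i j).
Proof.
move=> x; apply: cvgM; last exact: clam.
have c : {for x, continuous (fun x => - Lam i x)} by apply: cvgN; exact: cLam.
by apply: (@continuous_comp _ _ _ (fun x => - Lam i x) expR); [exact: c|exact: continuous_expR].
Qed.

Lemma cjker0 i j y v : cont_at (jker0 i j) y v.
Proof. by have H := @cont_kK _ (r i) (hazard i j) (@chazard i j) y v; exact: H. Qed.

Lemma cjker i j y v : cont_at (jker i j) y v.
Proof.
have c0 : {for (y, v), continuous (fun q : R * R => Lam i q.1)}.
  by apply: (@continuous_comp _ _ _ fst (Lam i)); [exact: cvg_fst|exact: cLam].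
have c1 : {for (y, v), continuous (fun q : R * R => expR (Lam i q.1))}.
  by apply: (@continuous_comp _ _ _ (fun q : R * R => Lam i q.1) expR); [exact: c0|exact: continuous_expR].
exact: (cvgM c1 (@cjker0 i j y v)).
Qed.

Lemma jker_ge0 i j y v : 0 <= jker i j y v.
Proof. by rewrite mulr_ge0 ?expR_ge0// mulr_ge0 ?expR_ge0// mulr_ge0 ?expR_ge0. Qed.

Lemma disc_ge0 i y t : 0 <= disc i y t. Proof. by rewrite mulr_ge0 ?expR_ge0. Qed.

Lemma cdisc i y t : cont_at (disc i) y t.
Proof.
have c1 : {for (y, t), continuous (fun q : R * R => q.1 + q.2)}.
  by apply: cvgD; [exact: cvg_fst|exact: cvg_snd].
have c0 : {for (y, t), continuous (fun q : R * R => Lam i q.1)}.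
  by apply: (@continuous_comp _ _ _ fst (Lam i)); [exact: cvg_fst|exact: cLam].
have c2 : {for (y, t), continuous (fun q : R * R => Lam i (q.1 + q.2))}.
  by apply: (@continuous_comp _ _ _ (fun q : R * R => q.1 + q.2) (Lam i)); [exact: c1|exact: cLam].
have c3 : {for (y, t), continuous (fun q : R * R => Lam i q.1 - Lam i (q.1 + q.2))}.
  exact: (cvgB c0 c2).
have c4 : {for (y, t), continuous (fun q : R * R => - r i * q.2)}.
  by apply: cvgM; [exact: cvg_cst|exact: cvg_snd].
have c5 : {for (y, t), continuous (fun q : R * R => expR (Lam i q.1 - Lam i (q.1 + q.2)))}.
  by apply: (@continuous_comp _ _ _ (fun q : R * R => Lam i q.1 - Lam i (q.1 + q.2)) expR); [exact: c3|exact: continuous_expR].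
have c6 : {for (y, t), continuous (fun q : R * R => expR (- r i * q.2))}.
  by apply: (@continuous_comp _ _ _ (fun q : R * R => - r i * q.2) expR); [exact: c4|exact: continuous_expR].
exact: (cvgM c5 c6).
Qed.

Lemma disc_derive_t i (y t : R) : -1 < y + t ->
  is_derive t 1 (disc i y) (- (ell i (y + t) + r i) * disc i y t).
Proof.
move=> yt; have d1 : is_derive t 1 (fun t => y + t) 1.
  by apply: (dereq (derD (derc t y) (derid t))); rewrite add0r.
have d2 := derexp (derB (derc t (Lam i y)) (@dercomp _ (fun t => y + t) (Lam i) t _ _ (dLam i yt) d1)).
have d3 := derexp (derZ (- r i) (derid t)).
by apply: (dereq (derM d2 d3)); rewrite /disc; ring.
Qed.

Lemma disc_derive_y i (y t : R) : -1 < y -> -1 < y + t ->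
  is_derive y 1 (disc i ^~ t) ((ell i y - ell i (y + t)) * disc i y t).
Proof.
move=> y1 yt; have d1 : is_derive y 1 (fun y => y + t) 1.
  by apply: (dereq (derD (derid y) (derc y t))); rewrite addr0.
have d2 := derexp (derB (dLam i y1) (@dercomp _ (fun y => y + t) (Lam i) y _ _ (dLam i yt) d1)).
by apply: (dereq (derM d2 (derc y (expR (- r i * t))))); rewrite /disc; ring.
Qed.

Lemma mh : measurable_fun setT h. Proof. exact: continuous_measurable_fun. Qed.

Lemma hflow_h_cvg (X : pseudoMetricType R) (p : X) (t z : X -> R) k i :
  (k = 0%N \/ 0 < t p) -> {for p, continuous t} -> {for p, continuous z} ->
  hflow (m i) (s i) k h (t x) (z x) @[x --> p] --> hflow (m i) (s i) k h (t p) (z p).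
Proof.
move=> kt ct cz.
apply: (@hflow_cvg _ (m i) (s i) (s_gt0 i) _ p t z (fun=> h) k 1 0 ler01 (lexx 0) kt ct cz).
- by apply: nearW => x; exact: mh.
- by apply: nearW => x; exact: hb.
- move=> u cu; exact: (@continuous_comp _ _ _ u h p cu (@ch _)).
Qed.

Lemma src_cvg (X : pseudoMetricType R) (p : X) (Y t z : X -> R) k i :
  (k = 0%N \/ 0 < t p) ->
  {for p, continuous Y} -> {for p, continuous t} -> {for p, continuous z} ->
  src k i (Y x) (t x) (z x) @[x --> p] --> src k i (Y p) (t p) (z p).
Proof.
move=> kt cY ct cz; apply: cvgM.
  exact: (@cont_at_comp _ _ p Y t (disc i) cY ct (@cdisc i (Y p) (t p))).
exact: (@hflow_h_cvg X p t z k i kt ct cz).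
Qed.

Lemma src_derive_z k i (y t z : R) : (k <= 1)%N -> 0 < t ->
  is_derive z 1 (src k i y t) (src k.+1 i y t z).
Proof.
move=> k1 t0; apply: derZ.
have e01 : 0 <= (0 : R) <= 1 by rewrite lexx ler01.
exact: (hflow_derive_z (m i) (s_gt0 i) z k1 t0 ler01 e01 mh hb).
Qed.

Definition src_t i (y t z : R) : R := - (ell i (y + t) + r i) * src 0 i y t z
  + m i * src 1 i y t z + s i ^+ 2 / 2 * src 2 i y t z.

Lemma src_derive_t i (y t z : R) : -1 < y + t -> 0 < t ->
  is_derive t 1 (fun t => src 0 i y t z) (src_t i y t z).
Proof.
move=> yt t0; have e01 : 0 <= (0 : R) <= 1 by rewrite lexx ler01.
have := derM (disc_derive_t i yt) (hflow_derive_v (m i) (s_gt0 i) z t0 ler01 e01 mh hb).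
by move/dereq; apply; rewrite /src_t /src; ring.
Qed.

Lemma src_derive_y i (y t z : R) : -1 < y -> -1 < y + t ->
  is_derive y 1 (fun y => src 0 i y t z) ((ell i y - ell i (y + t)) * src 0 i y t z).
Proof.
move=> y1 yt; have := derM (disc_derive_y i y1 yt) (derc y (hflow (m i) (s i) 0 h t z)).
by move/dereq; apply; rewrite /src; ring.
Qed.

Lemma src_singular k i : (k <= 2)%N -> singular_ex L 0 (src k i 0).
Proof.
move=> k2; have e0 := lexx (0 : R).
have kd : continuous (disc i 0) by exact: (cont_at_r (fun x => @cdisc i 0 x)).
apply: (singular_exM L_gt0 e0 kd).
exists (1 * hcst2 (m i) (s i) L); first by rewrite mul1r hcst2_ge0.
split => [u x /andP[u0 uL]|u /andP[u0 uL] x].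
  rewrite /cont_at.
  exact: (@hflow_h_cvg _ (u, x) fst snd k i (or_intror u0) cvg_fst cvg_snd).
apply: (le_trans (hflow_sqrt_le (m i) (s_gt0 i) x k2 ler01 e0 mh hb hl u0 (ltW uL))).
by rewrite mulrAC.
Qed.

Local Notation vp := (vop m s jker).

(* [psi] is found first, as the solution of the equation differentiated in time;
   its primitive starting from [h] then solves the original equation. *)
Lemma model_solution : exists Phi, exists2 D, 0 <= D &
  [/\ forall i, regular L D 0 (Phi i),
      forall i t z, 0 <= t < L -> Phi i t z = src 0 i 0 t z + vp Phi i 0 t z,
      forall i t z, t <= 0 -> Phi i t z = h z,
      forall i t z, t < L -> 0 <= Phi i t z &
      exists psi, exists2 C, 0 <= C &
        (forall i, singular L C 0 (psi i)) /\
        forall i t z, 0 < t < L -> is_derive t 1 (Phi i ^~ z) (psi i t z)].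
Proof.
have e0 := lexx (0 : R).
(* Frozen at negative times, so as to be continuous across 0, where the source equals [h]. *)
pose S i (t : R) z := src 0 i 0 (Num.max t 0) z.
have [C C0 HC] : exists2 C, 0 <= C & forall i u, 0 <= u <= L -> disc i 0 u * hcst (m i) (s i) L <= C.
  apply: (@fin_bound R _ (fun i C => forall u, 0 <= u <= L -> disc i 0 u * hcst (m i) (s i) L <= C)).
    by move=> i a b ab H u uL; exact: le_trans (H u uL) ab.
  move=> i; have [Q Q0 HQ] := loc_bound 0 (ltW L_gt0) (fun y v => @cdisc i y v).
  exists (Q * hcst (m i) (s i) L); first by rewrite mulr_ge0// hcst_ge0.
  move=> u uL; rewrite ler_wpM2r ?hcst_ge0//.
  by apply: (le_trans (ler_norm _)); apply: HQ => //; rewrite subrr normr0.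
have mL t : t < L -> 0 <= Num.max t 0 <= L.
  by move=> tL; rewrite le_max lexx orbT ge_max (ltW tL) (ltW L_gt0).
have Sc i u x : u < L -> cont_at (S i) u x.
  move=> uL; apply: (@src_cvg _ (u, x) (fun=> 0) (fun q => Num.max q.1 0) snd 0 i); [by left|exact: cvg_cst| |exact: cvg_snd].
  by apply: continuous_max; [exact: cvg_fst|exact: cvg_cst].
have Sb i u : u < L -> bdd C 0 (S i u).
  move=> uL x; have [m0 m1] := andP (mL u uL).
  rewrite /S /src normrM (ger0_norm (disc_ge0 _ _ _)).
  apply: (le_trans (ler_wpM2l (disc_ge0 _ _ _) (hflow0_le (m i) (s_gt0 i) x ler01 e0 mh hb m0 m1))).
  by rewrite mul1r mulrA ler_wpM2r ?wt_ge0// HC// mL.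
have Sl i u : u < L -> wlip C 0 (S i u).
  move=> uL x a; have [m0 m1] := andP (mL u uL).
  rewrite /S /src -mulrBr normrM (ger0_norm (disc_ge0 _ _ _)).
  set al := `|a| * expR `|a|; have al0 : 0 <= al by rewrite mulr_ge0// expR_ge0.
  have mha : measurable_fun setT (fun x : R => h (x + a)).
    by apply: measurableT_comp; [exact: mh|exact: measurable_funD].
  have hba : bdd (expR `|a|) 0 (fun x : R => h (x + a)).
    move=> y; apply: (le_trans (hb _)); rewrite mul1r; exact: wt_shift.
  have -> : hflow (m i) (s i) 0 h (Num.max u 0) (x + a) - hflow (m i) (s i) 0 h (Num.max u 0) x
     = hflow (m i) (s i) 0 (fun x : R => h (x + a) - h x) (Num.max u 0) x.
    have hb' : bdd (expR `|a|) 0 h.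
      by move=> y; apply: (le_trans (hb y)); rewrite ler_wpM2r ?wt_ge0// -expR0 ler_expR.
    rewrite (hflow_sub m s i _ _ (expR_ge0 _) e0 mha mh hba hb'); congr (_ - _).
    by rewrite !hflow0E /gavg; congr intR; apply/funext => w; congr (h _ * _); ring.
  have hd : bdd al 0 (fun x : R => h (x + a) - h x).
    by move=> y; apply: (le_trans (hl y a)); rewrite mul1r.
  have md : measurable_fun setT (fun x : R => h (x + a) - h x).
    by apply: measurable_funB; [exact: mha|exact: mh].
  apply: (le_trans (ler_wpM2l (disc_ge0 _ _ _) (hflow0_le (m i) (s_gt0 i) x al0 e0 md hd m0 m1))).
  rewrite [leLHS](_ : _ = disc i 0 (Num.max u 0) * hcst (m i) (s i) L * al * wt 0 x); last by ring.
  by rewrite ler_wpM2r ?wt_ge0// ler_wpM2r// HC// mL.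
have [Phi [D D0 [PR PE Ppos]]] := volterra_regular m s_gt0 L_gt0 cjker C0 e0 Sc Sb Sl.
have SE i t z : 0 <= t -> S i t z = src 0 i 0 t z by move=> t0; rewrite /S max_l.
have S0 i z : src 0 i 0 0 z = h z.
  by rewrite /src /disc addr0 subrr mulr0 expR0 !mul1r hflow_at0.
have Pneg i t z : t <= 0 -> Phi i t z = h z.
  by move=> t0; rewrite PE ?(le_lt_trans t0)// vop_le0// addr0 /S max_r.
have Ppos' i t z : 0 < t < L -> 0 <= Phi i t z.
  apply: Ppos.
    move=> i' t' z' _; rewrite /S mulr_ge0 ?disc_ge0//.
    by apply: hflow_ge0 => x; exact: h_ge0.
  by move=> i' j v _; exact: jker_ge0.
exists Phi, D => //; split => //.
- by move=> i t z /andP[t0 tL]; rewrite PE// SE.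
- move=> i t z tL; have [t0|t0] := leP t 0; first by rewrite Pneg.
  by apply: Ppos'; rewrite t0.
(* Differentiating the operator in time leaves boundary terms at [v = t], where the solution takes
   its initial value [h]. They are known and join the source. *)
pose S' i t z := src_t i 0 t z + \sum_(j < n | j != i) jker i j 0 t * hflow (m i) (s i) 0 h t z.
have cel i : continuous (fun t => - (ell i (0 + t) + r i)).
  move=> t; apply: cvgN; apply: cvgD; last exact: cvg_cst.
  rewrite (_ : (fun t => ell i (0 + t)) = ell i); last by apply/funext => x; rewrite add0r.
  by rewrite add0r; exact: cell.
have hS i : singular_ex L 0 (fun t z => hflow (m i) (s i) 0 h t z).
  exists (1 * hcst2 (m i) (s i) L); first by rewrite mul1r hcst2_ge0.
  split => [u x /andP[u0 uL]|u /andP[u0 uL] x].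
    rewrite /cont_at.
    exact: (@hflow_h_cvg _ (u, x) fst snd 0 i (or_intror u0) cvg_fst cvg_snd).
  apply: (le_trans (@hflow_sqrt_le _ (m i) (s i) (s_gt0 i) 0 h 1 0 L u x isT ler01 e0 mh hb hl u0 (ltW uL))).
  by rewrite mulrAC.
have S'S i : singular_ex L 0 (S' i).
  apply: singular_exD; last first.
    apply: singular_ex_sum => j _; apply: (singular_exM L_gt0 e0); last exact: hS.
    by exact: (cont_at_r (fun x => @cjker i j 0 x)).
  apply: singular_exD; last first.
    by apply: (singular_exM L_gt0 e0 (k := fun=> s i ^+ 2 / 2)); [move=> x; exact: cvg_cst|exact: src_singular].
  apply: singular_exD.
    by apply: (singular_exM L_gt0 e0 (cel i)); exact: src_singular.
  by apply: (singular_exM L_gt0 e0 (k := fun=> m i)); [move=> x; exact: cvg_cst|exact: src_singular].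
have [C1 C10 S'C] := singular_uniform e0 S'S.
have [psi [C2 C20 [psS psE _]]] := volterra_exists m s_gt0 L_gt0 cjker C10 e0 S'C.
exists psi, C2 => //; split => //.
pose Xi i := primitive h (psi i).
pose D1 := 1 + C2 * (2 * Num.sqrt L).
have D10 : 0 <= D1 by rewrite addr_ge0// mulr_ge0// mulr_ge0// sqrtr_ge0.
have Xc i u x : u < L -> cont_at (Xi i) u x.
  by move=> uL; exact: (@primitive_cont _ L L_gt0 h (psi i) C2 0 u x ch C20 e0 (psS i) uL).
have Xb i u : u < L -> bdd D1 0 (Xi i u).
  by move=> uL; exact: (@primitive_bdd _ L L_gt0 h (psi i) C2 1 0 u C20 ler01 e0 hb (psS i) uL).
have Xd i u x : 0 < u < L -> is_derive u 1 (Xi i ^~ x) (psi i u x).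
  by move=> uL; exact: (@primitive_derive _ L L_gt0 h (psi i) C2 0 u x C20 e0 (psS i) uL).
have X0 i x : Xi i 0 x = h x by exact: primitive0.
have X0f i : Xi i 0 = h by apply/funext => x; exact: X0.
have sqL2 u : u < L -> Num.sqrt u <= Num.sqrt L by move=> uL; rewrite ler_wsqrtr// ltW.
have XS i : singular L (D1 * Num.sqrt L) 0 (Xi i).
  split => [u x /andP[_ uL]|u /andP[u0 uL] x]; first exact: Xc.
  apply: (le_trans (Xb i u uL x)); rewrite ler_wpM2r ?wt_ge0// ler_pdivlMr ?sqrtr_gt0//.
  by apply: ler_wpM2l => //; exact: sqL2.
have DL0 : 0 <= D1 * Num.sqrt L by rewrite mulr_ge0// sqrtr_ge0.
have XE i t z : 0 < t < L -> Xi i t z = src 0 i 0 t z + vp Xi i 0 t z.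
  move=> /andP[t0 tL].
  (* The defect of the primitive in the original equation: it vanishes at 0 and its derivative is
     the defect of [psi] in the differentiated equation, which is 0. *)
  pose N u := Xi i u z - (src 0 i 0 u z + vp Xi i 0 u z).
  have dN u : 0 < u < L -> is_derive u 1 N 0.
    move=> uL; have [u0 _] := andP uL.
    have u1 : -1 < 0 + u by rewrite add0r (lt_trans _ u0).
    have dv : is_derive u 1 (fun u => vp Xi i 0 u z)
        (\sum_(j < n | j != i) (jker i j 0 u * hflow (m i) (s i) 0 (Xi j 0) u z
          + jop (m i) (s i) 0 (jker i j) (psi j) 0 u z)).
      apply: der_sum => j _.
      exact: (jop_derive_t (m i) (s_gt0 i) 0 z D10 C20 e0 (fun y v => @cjker i j y v) (Xc j) (Xb j) (Xd j) (psS j) uL).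
    apply: (dereq (derB (Xd i u z uL) (derD (src_derive_t i z u1 u0) dv))).
    rewrite psE// /S' /vop -(addrA (src_t i 0 u z)) -big_split/=.
    rewrite (eq_bigr (fun j => jker i j 0 u * hflow (m i) (s i) 0 (Xi j 0) u z + jop (m i) (s i) 0 (jker i j) (psi j) 0 u z)); first by rewrite subrr.
    by move=> j _; rewrite X0f.
  have cN : {within `[0, t], continuous N}.
    apply: continuous_in_subspaceT => u; rewrite inE/= in_itv/= => /andP[u0 ut].
    have uL : u < L := le_lt_trans ut tL.
    apply: cvgB; first exact: (cont_at_l (Xc i u z uL)).
    apply: cvgD.
      by apply: (@src_cvg _ u (fun=> 0) id (fun=> z) 0 i (or_introl erefl)); [exact: cvg_cst|exact: cvg_id|exact: cvg_cst].
    exact: (cont_at_l (@vop_cont _ _ m s L jker s_gt0 L_gt0 cjker Xi i (D1 * Num.sqrt L) 0 u z DL0 e0 XS uL)).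
  have [|c _] := @MVT R N (fun=> 0) 0 t t0 _ cN.
    by move=> u; rewrite in_itv/= => /andP[u0 ut]; apply: dN; rewrite u0 (lt_trans ut).
  have N0 : N 0 = 0 by rewrite /N X0 S0 vop_le0// addr0 subrr.
  by rewrite mul0r N0 subr0 => /eqP; rewrite subr_eq0 => /eqP.
have PS i : singular L (D * Num.sqrt L) 0 (Phi i) by exact: regular_singular.
pose D2 := D1 * Num.sqrt L + D * Num.sqrt L.
have D2a : D1 * Num.sqrt L <= D2 by rewrite lerDl mulr_ge0// sqrtr_ge0.
have D2b : D * Num.sqrt L <= D2 by rewrite lerDr.
(* Both solve the original equation, so the derivative [psi] of the primitive is that of [Phi]. *)
have XP i t z : 0 < t < L -> Xi i t z = Phi i t z.
  move=> /andP[t0 tL].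
  apply: (volterra_unique (m := m) s_gt0 L_gt0 cjker (le_trans DL0 D2a) e0 tL
    (fun i => singular_le e0 D2a (XS i)) (fun i => singular_le e0 D2b (PS i))).
    move=> j u x /andP[u0 ut]; have uL := le_lt_trans ut tL.
    have uL' : 0 < u < L by rewrite u0.
    have sub (A B C' : R) : A = B + C' -> A - C' = B by move=> ->; rewrite addrK.
    by apply: (etrans (sub _ _ _ (XE j u x uL'))); rewrite -(SE j u x (ltW u0)); apply: esym; exact: (sub _ _ _ (PE j u x uL)).
  by rewrite t0 lexx.
move=> i t z tL; apply: near_eq_is_derive (Xd i t z tL).
have [t0 tL'] := andP tL.
near=> u; apply: XP; apply/andP; split; near: u; [exact: lt_nbhsr|exact: lt_nbhsl].
Unshelve. all: end_near. Qed.

End model.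

(** * The value as a function of age, time to go and log-price *)

Section value_function.
Context {R : realType} (n : nat).
Variables (r s : 'I_n -> R) (L : R) (h : R -> R).
Variables (lam : 'I_n -> 'I_n -> R -> R) (Lam ell : 'I_n -> R -> R).
Hypotheses (r_ge0 : forall i, 0 <= r i) (s_gt0 : forall i, 0 < s i) (L_gt0 : 0 < L).
Hypotheses (ch : continuous h) (hb : bdd 1 0 h).
Hypotheses (clam : forall i j, continuous (lam i j))
  (cLam : forall i, continuous (Lam i)) (cell : forall i, continuous (ell i))
  (dLam : forall i (y : R), -1 < y -> is_derive y 1 (Lam i) (ell i y)).
Variables (Phi psi : 'I_n -> R -> R -> R) (D C : R).
Hypotheses (D_ge0 : 0 <= D) (C_ge0 : 0 <= C)
  (PhiR : forall i, regular L D 0 (Phi i)) (psiS : forall i, singular L C 0 (psi i))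
  (Phi0 : forall i, Phi i 0 = h)
  (dPhi : forall i (t z : R), 0 < t < L -> is_derive t 1 (Phi i ^~ z) (psi i t z)).
Let m := drift r s.
Let kj := jker r lam Lam.
Let k0 := jker0 r lam Lam.
Let e0 : 0 <= (0 : R) := lexx 0.
Let e01 : 0 <= (0 : R) <= 1. Proof. by rewrite lexx ler01. Qed.

Definition value k i y t z := src r s h Lam k i y t z +
  \sum_(j < n | j != i) jop (drift r s i) (s i) k (jker r lam Lam i j) (Phi j) y t z.

Definition value_t i (y t z : R) := src_t r s h Lam ell i y t z +
  \sum_(j < n | j != i) (jker r lam Lam i j y t * hflow (drift r s i) (s i) 0 h t z
    + jop (drift r s i) (s i) 0 (jker r lam Lam i j) (psi j) y t z).

(* The hazard depends on age and time to go through their sum only, so d/dy is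
   d/dt minus the derivative along the lines y + t = const, along which the
   kernel is frozen and the Gaussian flow is differentiated instead. *)
Definition jump_y i j (y t z : R) :=
  ell i y * jop (drift r s i) (s i) 0 (jker r lam Lam i j) (Phi j) y t z
  + expR (Lam i y) * ((jker0 r lam Lam i j y t * hflow (drift r s i) (s i) 0 h t z
      + jop (drift r s i) (s i) 0 (jker0 r lam Lam i j) (psi j) y t z)
    - (hazard lam Lam i j y * Phi j t z
      + drift_gen (drift r s i) (s i) (r i) (jker0 r lam Lam i j) (Phi j) y t z)).

Definition value_y i (y t z : R) := (ell i y - ell i (y + t)) * src r s h Lam 0 i y t z +
  \sum_(j < n | j != i) jump_y i j y t z.

Let ckj i j y v : cont_at (kj i j) y v. Proof. exact: cjker. Qed.
Let ck0 i j y v : cont_at (k0 i j) y v. Proof. exact: cjker0. Qed.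
Let chz i j : continuous (hazard lam Lam i j). Proof. exact: chazard. Qed.
Let Phic i u x : u < L -> cont_at (Phi i) u x. Proof. by have [H _ _] := PhiR i; exact: H. Qed.
Let Phib i u : u < L -> bdd D 0 (Phi i u). Proof. by have [_ H _] := PhiR i; exact: H. Qed.

Lemma value_derive_z k i (y t z : R) : (k <= 1)%N -> 0 < t < L ->
  is_derive z 1 (value k i y t) (value k.+1 i y t z).
Proof.
move=> k1 tL; have [t0 _] := andP tL.
apply: derD; first exact: src_derive_z.
apply: der_sum => j _.
exact: (jop_derive_z (m i) (s_gt0 i) L_gt0 y z k1 D_ge0 e01 (@ckj i j) (PhiR j) tL).
Qed.

Lemma value_derive_t i (y t z : R) : -1 < y + t -> 0 < t < L ->
  is_derive t 1 (fun t => value 0 i y t z) (value_t i y t z).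
Proof.
move=> yt tL; have [t0 _] := andP tL.
apply: derD; first exact: src_derive_t.
apply: der_sum => j _; rewrite -(Phi0 j).
exact: (jop_derive_t (m i) (s_gt0 i) y z D_ge0 C_ge0 e0 (@ckj i j) (@Phic j) (@Phib j) (@dPhi j) (psiS j) tL).
Qed.

Lemma jop_jker i j g (E y t z : R) : 0 <= E -> singular L E 0 g -> 0 < t < L -> jop (m i) (s i) 0 (kj i j) g y t z
  = expR (Lam i y) * jop (m i) (s i) 0 (k0 i j) g y t z.
Proof.
move=> E0 gS tL; rewrite /jop -intRZ; last exact: (@jop_singular_int _ (m i) (s i) L (s_gt0 i) L_gt0 (k0 i j) g E 0 y t z E0 e0 (@ck0 i j) gS tL).
congr intR; apply/funext => v; rewrite /cut.
by case: ifP => _; rewrite ?mulr0// mulrA.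
Qed.

Lemma jop_derive_y i j (y t z : R) : -1 < y -> 0 < t < L ->
  is_derive y 1 (fun y => jop (m i) (s i) 0 (kj i j) (Phi j) y t z) (jump_y i j y t z).
Proof.
move=> y1 tL.
have dE : is_derive y 1 (fun y => expR (Lam i y)) (expR (Lam i y) * ell i y).
  by apply: (dereq (derexp (dLam i y1))).
have dt : is_derive t 1 (fun t => jop (m i) (s i) 0 (k0 i j) (Phi j) y t z)
    (k0 i j y t * hflow (m i) (s i) 0 h t z + jop (m i) (s i) 0 (k0 i j) (psi j) y t z).
  rewrite -(Phi0 j).
  exact: (jop_derive_t (m i) (s_gt0 i) y z D_ge0 C_ge0 e0 (@ck0 i j) (@Phic j) (@Phib j) (@dPhi j) (psiS j) tL).
pose b y t := hazard lam Lam i j y * Phi j t z + drift_gen (m i) (s i) (r i) (k0 i j) (Phi j) y t z.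
have dc c u : 0 < u < L -> is_derive u 1 (fun u => jop (m i) (s i) 0 (k0 i j) (Phi j) (c - u) u z) (b (c - u) u).
  exact: (@jop_diag_derive _ (m i) (s i) L (s_gt0 i) L_gt0 (r i) _ (r_ge0 i) (@chz i j) (Phi j) D 0 c u z D_ge0 e01 (PhiR j)).
have cb : cont_at b y t.
  have tL' : t < L by case/andP: tL.
  have c1 : {for (y, t), continuous (fun q : R * R => hazard lam Lam i j q.1)}.
    by apply: (@continuous_comp _ _ _ fst (hazard lam Lam i j)); [exact: cvg_fst|exact: chz].
  have c2 : {for (y, t), continuous (fun q : R * R => Phi j q.2 z)}.
    apply: (@cont_at_comp _ _ (y, t) snd (fun=> z) (Phi j)); [exact: cvg_snd|exact: cvg_cst|exact: Phic].
  have c3 : {for (y, t), continuous (fun q : R * R => drift_gen (m i) (s i) (r i) (k0 i j) (Phi j) q.1 q.2 z)}.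
    exact: (@drift_gen_cvg _ (m i) (s i) L (s_gt0 i) L_gt0 (r i) _ (@chz i j) _ (y, t) fst snd (fun=> z) (Phi j) D 0 D_ge0 e0 (PhiR j) tL' cvg_fst cvg_snd (cvg_cst _)).
  exact: (cvgD (cvgM c1 c2) c3).
have dy := @mixed_derive _ L (fun y t => jop (m i) (s i) 0 (k0 i j) (Phi j) y t z) b y t _ tL dt dc cb.
have DL : 0 <= D * Num.sqrt L by rewrite mulr_ge0// sqrtr_ge0.
have PS : singular L (D * Num.sqrt L) 0 (Phi j) by exact: regular_singular.
under eq_fun do rewrite (jop_jker _ _ _ _ DL PS tL).
apply: (dereq (derM dE dy)); rewrite /jump_y -/m -/kj -/k0 (jop_jker _ _ _ _ DL PS tL) /b.
move: (jop _ _ _ _ (Phi j) _ _ _) (jop _ _ _ _ (psi j) _ _ _) (hflow _ _ _ _ _ _) (drift_gen _ _ _ _ _ _ _ _) (k0 i j y t) (expR _) (hazard _ _ _ _ _) (Phi _ _ _) (ell _ _).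
by move=> *; ring.
Qed.

Lemma value_derive_y i (y t z : R) : -1 < y -> 0 < t < L ->
  is_derive y 1 (fun y => value 0 i y t z) (value_y i y t z).
Proof.
move=> y1 tL; have [t0 _] := andP tL.
have yt : -1 < y + t by rewrite (lt_trans y1)// ltrDl.
apply: derD; first exact: src_derive_y.
by apply: der_sum => j _; exact: jop_derive_y.
Qed.

Section continuity.
Variables (X : pseudoMetricType R) (p : X) (Y t z : X -> R).
Hypotheses (cY : {for p, continuous Y}) (ct : {for p, continuous t})
  (cz : {for p, continuous z}).

Lemma value_cvg k i : (k <= 2)%N -> (k = 0%N \/ 0 < t p) -> t p < L ->
  value k i (Y x) (t x) (z x) @[x --> p] --> value k i (Y p) (t p) (z p).
Proof.
move=> k2 kt tL; apply: cvgD; first exact: src_cvg.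
apply: cvg_big => [|j ji]; first exact: add_continuous.
exact: (@jop_cvg_regular _ (m i) (s i) L (s_gt0 i) L_gt0 X p Y t z k _ _ D 0 k2 D_ge0 e0 (@ckj i j) (PhiR j) tL cY ct cz).
Qed.

Let cc (f : R -> R) (g : X -> R) : continuous f -> {for p, continuous g} -> f (g x) @[x --> p] --> f (g p).
Proof. by move=> cf cg; exact: (@continuous_comp _ _ _ g f p cg (@cf _)). Qed.

Let c2 (f : R -> R -> R) (a b : X -> R) : {for p, continuous a} -> {for p, continuous b} ->
  cont_at f (a p) (b p) -> f (a x) (b x) @[x --> p] --> f (a p) (b p).
Proof. exact: cont_at_comp. Qed.

Let cYt : {for p, continuous (fun x => Y x + t x)}. Proof. exact: cvgD. Qed.

Lemma value_t_cvg i : 0 < t p < L ->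
  value_t i (Y x) (t x) (z x) @[x --> p] --> value_t i (Y p) (t p) (z p).
Proof.
move=> tL; have [t0 _] := andP tL.
have S k : src r s h Lam k i (Y x) (t x) (z x) @[x --> p] --> src r s h Lam k i (Y p) (t p) (z p).
  by apply: src_cvg => //; right.
apply: cvgD.
  apply: cvgD; last by apply: cvgM; [exact: cvg_cst|exact: S].
  apply: cvgD; last by apply: cvgM; [exact: cvg_cst|exact: S].
  apply: cvgM; last exact: S.
  by apply: cvgN; apply: cvgD; [exact: (cc (@cell i) cYt)|exact: cvg_cst].
apply: cvg_big => [|j ji]; first exact: add_continuous.
apply: cvgD.
  apply: cvgM; first exact: (c2 cY ct (@ckj i j _ _)).
  exact: (@hflow_h_cvg _ _ r s h s_gt0 ch hb X p t z 0 i (or_introl erefl) ct cz).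
exact: (@jop_cvg_singular _ (m i) (s i) L (s_gt0 i) L_gt0 X p Y t z _ _ C 0 C_ge0 e0 (@ckj i j) (psiS j) tL cY ct cz).
Qed.

Lemma value_y_cvg i : 0 < t p < L ->
  value_y i (Y x) (t x) (z x) @[x --> p] --> value_y i (Y p) (t p) (z p).
Proof.
move=> tL; have [t0 tL'] := andP tL.
have cl : ell i (Y x) @[x --> p] --> ell i (Y p) by exact: (cc (@cell i) cY).
apply: cvgD.
  apply: cvgM; last by apply: src_cvg => //; right.
  by apply: cvgB; [exact: cl|exact: (cc (@cell i) cYt)].
apply: cvg_big => [|j ji]; first exact: add_continuous.
apply: cvgD.
  apply: cvgM; first exact: cl.
  exact: (@jop_cvg_regular _ (m i) (s i) L (s_gt0 i) L_gt0 X p Y t z 0 _ _ D 0 isT D_ge0 e0 (@ckj i j) (PhiR j) tL' cY ct cz).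
apply: cvgM.
  have cE : continuous (fun y => expR (Lam i y)).
    by move=> y; apply: (@continuous_comp _ _ _ (Lam i) expR); [exact: cLam|exact: continuous_expR].
  exact: (cc cE cY).
apply: cvgB.
  apply: cvgD.
    apply: cvgM; first exact: (c2 cY ct (@ck0 i j _ _)).
    exact: (@hflow_h_cvg _ _ r s h s_gt0 ch hb X p t z 0 i (or_introl erefl) ct cz).
  exact: (@jop_cvg_singular _ (m i) (s i) L (s_gt0 i) L_gt0 X p Y t z _ _ C 0 C_ge0 e0 (@ck0 i j) (psiS j) tL cY ct cz).
apply: cvgD.
  by apply: cvgM; [exact: (cc (@chz i j) cY)|exact: (@c2 (Phi j) t z ct cz (@Phic j (t p) (z p) tL'))].
exact: (@drift_gen_cvg _ (m i) (s i) L (s_gt0 i) L_gt0 (r i) _ (@chz i j) X p Y t z (Phi j) D 0 D_ge0 e0 (PhiR j) tL' cY ct cz).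
Qed.

End continuity.

End value_function.

(** * The Black-Scholes-Merton problem *)

Section second_derivative_test.
Context {R : realType}.
Implicit Types f df : R -> R.

Lemma pos_derive_gt f (x d : R) : is_derive x 1 f d -> 0 < d ->
  \forall y \near x^'+, f x < f y.
Proof.
move=> /is_derive1P fd d0; rewrite near_withinE.
have : \forall y \near x, y != x -> 0 < (f y - f x) / (y - x) by exact: (cvgr_gt _ fd).
apply: filterS => y H xy; have := H (negbT (gt_eqF xy)).
by rewrite pmulr_lgt0 ?subr_gt0// invr_gt0 subr_gt0.
Qed.

(** One-sided, because the maximum over a time interval [[t, T]] may be attained at its left end. *)
Lemma right_max_derive f (x b d : R) : x < b -> is_derive x 1 f d ->
  (forall y, x <= y < b -> f y <= f x) -> d <= 0.
Proof.
move=> xb fd fm; rewrite leNgt; apply/negP => d0.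
have H := pos_derive_gt fd d0.
have : \forall y \near x^'+, False.
  near=> y.
  have xy : x < y by near: y; exact: nbhs_right_gt.
  have yb : y < b by near: y; exact: nbhs_right_lt.
  have := fm y; rewrite (ltW xy) yb => /(_ isT).
  by apply/negP; rewrite -ltNge; near: y.
by move/filter_ex => [].
Unshelve. all: end_near. Qed.

(** If [d] were positive, [df] would be positive just to the right of its zero [x], and by the mean
    value theorem [f] would exceed its maximum. *)
Lemma interior_max f df (x a b d : R) : a < x < b ->
  (forall y, a < y < b -> is_derive y 1 f (df y)) -> is_derive x 1 df d ->
  (forall y, a < y < b -> f y <= f x) -> df x = 0 /\ d <= 0.
Proof.
move=> axb fd dfd fm; have [ax xb] := andP axb.
have fdx := fd x axb.
have df0 : df x = 0.
  have [] := @derive1_at_max _ f a b x (ltW (lt_trans ax xb)).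
  - by move=> t; rewrite in_itv/= => tab; have [] := fd t tab.
  - by rewrite in_itv/= axb.
  - by move=> t; rewrite in_itv/=; exact: fm.
  by move=> _ <-; apply/esym; exact: (@derive_val _ _ _ _ _ _ _ fdx).
split => //; rewrite leNgt; apply/negP => d0.
have H := pos_derive_gt dfd d0.
have H' : exists e : R, 0 < e /\ forall y, x < y < x + e -> 0 < df y.
  move: H; rewrite near_withinE df0 => /nbhs_ballP[e /= e0 He]; exists e; split => // y /andP[xy ye].
  apply: He => //=; rewrite /ball/= ltr0_norm ?subr_lt0// opprB ltrBlDr addrC//.
have [e [e0 He]] := H'.
pose y := Num.min (x + e / 2) ((x + b) / 2).
have xy : x < y by rewrite lt_min ltrDl divr_gt0//= midf_lt.
have yb : y < b by rewrite gt_min midf_lt ?orbT.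
have ye : y < x + e by rewrite gt_min ltrD2l gtr_pMr// invf_lt1// ltr1n.
have fd' : forall t : R, t \in `]x, y[ -> is_derive t 1 f (df t).
  by move=> t; rewrite in_itv/= => /andP[xt ty]; apply: fd; rewrite (lt_trans ax xt) (lt_trans ty yb).
have cf : {within `[x, y], continuous f}.
  apply: continuous_in_subspaceT => t; rewrite inE/= in_itv/= => /andP[xt ty].
  apply: der_cont; apply: fd; first by rewrite (lt_le_trans ax xt) (le_lt_trans ty yb).
have [c] := MVT xy fd' cf; rewrite in_itv/= => /andP[xc cy] E.
have : f y <= f x by apply: fm; rewrite yb (lt_trans ax xy).
rewrite -subr_le0 E leNgt mulr_gt0//; last by rewrite subr_gt0.
by apply: He; rewrite xc (lt_trans cy ye).
Qed.

End second_derivative_test.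

(** * Comparison for the backward equation on an unbounded domain *)

Section maximum_principle.
Context {R : realType}.
Variables (T r sig C : R) (u ut us uss : R -> R -> R).
Hypotheses (T_gt0 : 0 < T) (r_ge0 : 0 <= r) (C_ge0 : 0 <= C).
Hypotheses
  (du_t : forall t s : R, 0 < t < T -> 0 < s -> is_derive t 1 (u ^~ s) (ut t s))
  (du_s : forall t s : R, 0 < t < T -> 0 < s -> is_derive s 1 (u t) (us t s))
  (du_ss : forall t s : R, 0 < t < T -> 0 < s -> is_derive s 1 (us t) (uss t s))
  (pde : forall t s : R, 0 < t < T -> 0 < s ->
    ut t s + r * s * us t s + 2^-1 * sig ^+ 2 * s ^+ 2 * uss t s = r * u t s)
  (uc : {within [set p : R * R | 0 <= p.1 <= T /\ 0 < p.2],
     continuous (fun p => u p.1 p.2)})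
  (uT : forall s, 0 < s -> u T s = 0)
  (ub : forall t s, 0 <= t <= T -> 0 < s -> u t s <= C * (1 + s)).

Let c := r + sig ^+ 2 + 1.
(* It dominates functions of linear growth at [0] as well as at infinity. *)
Let bar (t s : R) := expR (c * (T - t)) * (s ^+ 2 + s^-1).

Let c_gt0 : 0 < c.
Proof. by rewrite /c ltr_wpDl// addr_ge0// sqr_ge0. Qed.

(** The spatial part of the equation, including the term with - r, multiplies s^2 by r + sig^2 and
    1/s by sig^2 - 2r. The rate [c] exceeds both, which leaves the negative remainder - (s^2 + (1 +
    3r) / s). *)
Lemma barrier_super (t s : R) : 0 < s ->
  - c * bar t s + r * s * (expR (c * (T - t)) * (2 * s - s ^- 2))
    + 2^-1 * sig ^+ 2 * s ^+ 2 * (expR (c * (T - t)) * (2 + 2 * s ^- 3)) < r * bar t s.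
Proof.
move=> s0; rewrite -subr_lt0 /bar.
have E : - c * (expR (c * (T - t)) * (s ^+ 2 + s^-1)) + r * s * (expR (c * (T - t)) * (2 * s - s ^- 2))
    + 2^-1 * sig ^+ 2 * s ^+ 2 * (expR (c * (T - t)) * (2 + 2 * s ^- 3)) - r * (expR (c * (T - t)) * (s ^+ 2 + s^-1))
  = - (expR (c * (T - t)) * (s ^+ 2 + (1 + 3 * r) * s^-1)).
  by rewrite /c; move: (expR _) => X; field; rewrite gt_eqF.
rewrite E oppr_lt0 mulr_gt0 ?expR_gt0// addr_gt0 ?exprn_gt0// mulr_gt0 ?invr_gt0//.
by rewrite ltr_pwDl// mulr_ge0.
Qed.

Lemma barrier_large (e : R) : 0 < e -> exists a b, [/\ 0 < a, a < b,
  forall t s, 0 <= t <= T -> 0 < s <= a -> u t s - e * bar t s < 0 &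
  forall t s, 0 <= t <= T -> b <= s -> u t s - e * bar t s < 0].
Proof.
move=> e0.
have barge t s : 0 <= t <= T -> 0 < s -> s ^+ 2 + s^-1 <= bar t s.
  move=> /andP[_ tT] s0; rewrite /bar ler_peMl//.
    by rewrite addr_ge0 ?sqr_ge0// invr_ge0 ltW.
  by rewrite -expR0 ler_expR mulr_ge0 ?subr_ge0// ltW.
have K t s : 0 <= t <= T -> 0 < s -> C * (1 + s) < e * (s ^+ 2 + s^-1) -> u t s - e * bar t s < 0.
  move=> tT s0 H; rewrite subr_lt0; apply: (le_lt_trans (ub tT s0)); apply: (lt_le_trans H).
  by rewrite ler_wpM2l ?(ltW e0)//; exact: barge.
(* Here e N = e + 2C. For s <= 1 / (2N), C (1 + s) <= 2C < e N <= e / s; for s >= 2N, C (1 + s) <=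
   2C s < e N s <= e s^2. *)
pose N := 1 + 2 * C / e.
have N1 : 1 <= N by rewrite lerDl divr_ge0 ?mulr_ge0// ltW.
have N0 : 0 < N by rewrite (lt_le_trans _ N1).
have eN : e * N = e + 2 * C by rewrite /N; field; rewrite gt_eqF.
exists (N^-1 / 2), (2 * N); split.
- by rewrite divr_gt0// invr_gt0.
- have h1 : N^-1 <= 1 by rewrite invf_le1.
  lra.
- move=> t s tT /andP[s0 sN]; apply: K => //.
  have h1 : N^-1 <= 1 by rewrite invf_le1.
  have h2 : N <= s^-1.
    by rewrite -[N]invrK lef_pV2 ?posrE ?invr_gt0//; lra.
  have h3 : C * (1 + s) <= C * 2 by rewrite ler_wpM2l//; lra.
  have h4 : e * N <= e * (s ^+ 2 + s^-1).
    by rewrite ler_wpM2l ?(ltW e0)// (le_trans h2)// lerDr sqr_ge0.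
  lra.
- move=> t s tT sN; have s0 : 0 < s by rewrite (lt_le_trans _ sN)// mulr_gt0.
  apply: K => //.
  have h3 : C * (1 + s) <= C * (2 * s) by rewrite ler_wpM2l//; lra.
  have h4 : e * N * s <= e * s ^+ 2.
    by rewrite -mulrA ler_wpM2l ?(ltW e0)// expr2 ler_wpM2r ?(ltW s0)//; lra.
  have h5 : e * s ^+ 2 < e * (s ^+ 2 + s^-1) by rewrite ltr_pM2l// ltrDl invr_gt0.
  have h6 : 0 < e * s by rewrite mulr_gt0.
  rewrite eN mulrDl in h4; lra.
Qed.

Lemma bsm_max_interior t s : 0 < t <= T -> 0 < s -> u t s <= 0.
Proof.
move=> /andP[t0 tT] s0.
move: tT; rewrite le_eqVlt => /predU1P[->|tT]; first by rewrite uT.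
rewrite leNgt; apply/negP => upos.
have bpos : 0 < bar t s by rewrite mulr_gt0 ?expR_gt0// addr_gt0 ?exprn_gt0// invr_gt0.
(* Chosen so that [w t s] is half of [u t s], hence still positive. *)
pose e := u t s / 2 / bar t s.
have e0 : 0 < e by rewrite !divr_gt0.
have [a [b [a0 ab Ha Hb]]] := barrier_large e0.
pose w t s := u t s - e * bar t s.
have wpos : 0 < w t s by rewrite /w /e divfK ?gt_eqF//; lra.
have sa : a < s.
  rewrite ltNge; apply/negP => sa; have := Ha t s; rewrite s0 sa (ltW t0) (ltW tT) => /(_ isT isT).
  by rewrite -/(w t s) ltNge (ltW wpos).
have sb : s < b.
  rewrite ltNge; apply/negP => bs; have := Hb t s; rewrite bs (ltW t0) (ltW tT) => /(_ isT isT).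
  by rewrite -/(w t s) ltNge (ltW wpos).
(* The box starts at the positive time [t], so that all its points before [T] lie where the equation
   holds. A positive maximum of [w] avoids the sides by the barrier and time [T] by the terminal
   value. *)
pose A : set (R * R) := `[t, T] `*` `[a, b].
have cA : compact A by apply: compact_setX; exact: segment_compact.
have A0 : A !=set0 by exists (t, s); split => /=; rewrite in_itv/= ?lexx ?(ltW tT) ?(ltW sa) ?(ltW sb).
have AD : A `<=` [set p : R * R | 0 <= p.1 <= T /\ 0 < p.2].
  move=> [t' s'] []/=; rewrite !in_itv/= => /andP[h1 h2] /andP[h3 h4].
  by rewrite h2 (ltW (lt_le_trans t0 h1)) (lt_le_trans a0 h3).
have cw : {within A, continuous (fun p => w p.1 p.2)}.
  have ucA := continuous_subspaceW AD uc.
  have cb : {within A, continuous (fun p : R * R => e * bar p.1 p.2)}.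
    apply: continuous_in_subspaceT => p; rewrite inE => /AD[_ p0].
    have c1 : {for p, continuous (fun p : R * R => c * (T - p.1))}.
      by apply: cvgM; [exact: cvg_cst|apply: cvgB; [exact: cvg_cst|exact: cvg_fst]].
    have c2 : {for p, continuous (fun p : R * R => expR (c * (T - p.1)))}.
      by apply: (@continuous_comp _ _ _ (fun p : R * R => c * (T - p.1)) expR); [exact: c1|exact: continuous_expR].
    have cs : {for p, continuous (snd : R * R -> R)} by exact: cvg_snd.
    have c3 : {for p, continuous (fun p : R * R => p.2 ^+ 2 + p.2^-1)}.
      apply: cvgD; first exact: (cvgM cs cs).
      by apply: cvgV; [rewrite gt_eqF|exact: cs].
    exact: (cvgM (cvg_cst e) (cvgM c2 c3)).
  by move=> p; apply: cvgB; [exact: ucA|exact: cb].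
have [[t1 s1]] := compact_EVT_max A0 cA cw.
rewrite inE => -[]/=; rewrite !in_itv/= => /andP[tt1 t1T] /andP[as1 s1b] wmax.
have w1 : 0 < w t1 s1.
  apply: (lt_le_trans wpos); apply: (wmax (t, s)).
  by rewrite inE; split => /=; rewrite in_itv/= ?lexx ?(ltW tT) ?(ltW sa) ?(ltW sb).
have t10 : 0 < t1 by rewrite (lt_le_trans t0).
have t1D : 0 <= t1 <= T by rewrite (ltW t10).
have s10 : 0 < s1 by rewrite (lt_le_trans a0).
have as1' : a < s1.
  rewrite ltNge; apply/negP => h; have := Ha t1 s1 t1D; rewrite s10 h => /(_ isT).
  by rewrite -/(w t1 s1) ltNge (ltW w1).
have s1b' : s1 < b.
  rewrite ltNge; apply/negP => h; have := Hb t1 s1 t1D h.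
  by rewrite -/(w t1 s1) ltNge (ltW w1).
have b1 : 0 < bar t1 s1 by rewrite mulr_gt0 ?expR_gt0// addr_gt0 ?exprn_gt0// invr_gt0.
have t1T' : t1 < T.
  rewrite lt_neqAle t1T andbT; apply/eqP => E; move: w1.
  by rewrite /w E uT// sub0r oppr_gt0 ltNge mulr_ge0 ?(ltW e0)// -E ltW.
have t1i : 0 < t1 < T by rewrite t10.
pose X := expR (c * (T - t1)).
have db_t : is_derive t1 1 (bar ^~ s1) (- c * bar t1 s1).
  apply: (dereq (derM (derexp (derZ c (derB (derc t1 T) (derid t1)))) (derc t1 (s1 ^+ 2 + s1^-1)))).
  by rewrite /bar; ring.
have dsq (y : R) : is_derive y 1 (fun y : R => y ^+ 2) (2 * y).
  by apply: (dereq (derM (derid y) (derid y))); ring.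
have db_s (y : R) : 0 < y -> is_derive y 1 (bar t1) (X * (2 * y - y ^- 2)).
  move=> y0; have yN : y != 0 by rewrite gt_eqF.
  apply: (dereq (derZ X (derD (dsq y) (@derV _ id y 1 yN (derid y))))).
  by field.
have db_ss (y : R) : 0 < y ->
    is_derive y 1 (fun y => X * (2 * y - y ^- 2)) (X * (2 + 2 * y ^- 3)).
  move=> y0; have yN : y ^+ 2 != 0 by rewrite expf_neq0// gt_eqF.
  apply: (dereq (derZ X (derB (derZ 2 (derid y)) (@derV _ (fun y => y ^+ 2) y _ yN (dsq y))))).
  by field; rewrite gt_eqF.
have dw_t : is_derive t1 1 (w ^~ s1) (ut t1 s1 - e * (- c * bar t1 s1)).
  exact: (derB (du_t t1i s10) (derZ e db_t)).
have W1 : ut t1 s1 - e * (- c * bar t1 s1) <= 0.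
  apply: (right_max_derive t1T' dw_t) => y /andP[y1 y2]; apply: (wmax (y, s1)).
  by rewrite inE; split => /=; rewrite in_itv/= ?as1 ?s1b// (le_trans tt1 y1) ltW.
have ab1 : a < s1 < b by rewrite as1'.
have [|||E W2] := @interior_max _ (w t1) (fun y => us t1 y - e * (X * (2 * y - y ^- 2))) s1 a b
  (uss t1 s1 - e * (X * (2 + 2 * s1 ^- 3))) ab1.
- move=> y /andP[ay yb]; have y0 := lt_trans a0 ay.
  exact: (derB (du_s t1i y0) (derZ e (db_s _ y0))).
- exact: (derB (du_ss t1i s10) (derZ e (db_ss _ s10))).
- move=> y /andP[ay yb]; apply: (wmax (t1, y)).
  by rewrite inE; split => /=; rewrite in_itv/= ?tt1 ?t1T// (ltW ay) ltW.
(* The barrier being a strict supersolution, the operator minus [r] is positive on [w]; at the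
   maximum the time derivative, the second derivative and [- r * w] are at most 0 and the first
   derivative is 0, a contradiction. *)
have P := pde t1i s10.
have Bs := barrier_super t1 s10.
have W3 : 2^-1 * sig ^+ 2 * s1 ^+ 2 * (uss t1 s1 - e * (X * (2 + 2 * s1 ^- 3))) <= 0.
  apply: mulr_ge0_le0 W2; apply: mulr_ge0; last exact: sqr_ge0.
  by apply: mulr_ge0; [rewrite invr_ge0|exact: sqr_ge0].
have W4 : r * s1 * (us t1 s1 - e * (X * (2 * s1 - s1 ^- 2))) = 0 by rewrite E mulr0.
have W5 : 0 <= r * w t1 s1 by rewrite mulr_ge0// ltW.
rewrite -(ltr_pM2l e0) in Bs; move: Bs W1 W3 W4 W5; rewrite /w -/X.
move: P; move: (ut t1 s1) (us t1 s1) (uss t1 s1) (u t1 s1) (bar t1 s1) (s1 ^- 2) (s1 ^- 3) (s1 ^+ 2) => *.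
lra.
Qed.

Lemma bsm_max t s : 0 <= t <= T -> 0 < s -> u t s <= 0.
Proof.
move=> /andP[t0 tT] s0; move: t0; rewrite le_eqVlt => /predU1P[<-|t0]; last first.
  by apply: bsm_max_interior => //; rewrite t0.
have D0 : [set p : R * R | 0 <= p.1 <= T /\ 0 < p.2] (0, s) by rewrite /= lexx (ltW T_gt0).
have /subspace_continuousP/(_ _ D0) H := uc.
rewrite leNgt; apply/negP => upos.
have : \forall p \near within [set p : R * R | 0 <= p.1 <= T /\ 0 < p.2] (nbhs (0, s)), 0 < u p.1 p.2.
  exact: (cvgr_gt _ H).
rewrite near_withinE => /nbhs_ballP[e /= e0 He].
pose d := Num.min (e / 2) T.
have d0 : 0 < d by rewrite lt_min divr_gt0//=.
have h1 : ball ((0, s) : R * R) e (d, s).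
  split => /=; last exact: ballxx.
  by rewrite /ball/= sub0r normrN gtr0_norm// gt_min ltr_pdivrMr// ltr_pMr// ltr1n.
have h2 : (0 <= d <= T) /\ 0 < s by rewrite (ltW d0) ge_min lexx orbT.
have := He (d, s) h1 h2; apply/negP; rewrite -leNgt.
by apply: bsm_max_interior => //; rewrite d0 ge_min lexx orbT.
Qed.

End maximum_principle.

(** * Classical solutions are Gaussian averages of the payoff *)

Section bsm_price.
Context {R : realType}.
Variables (T K r sig : R).
Hypotheses (T_gt0 : 0 < T) (K_gt0 : 0 < K) (r_ge0 : 0 <= r) (sig_gt0 : 0 < sig).
Let h := payoff K.
Let m := r - sig ^+ 2 / 2.
Let H n v z := hflow m sig n h v z.

Definition bsm_price (t s : R) : R :=
  expR (- r * (T - t)) * hflow (r - sig ^+ 2 / 2) sig 0 (payoff K) (T - t) (ln s).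

Let e0 : 0 <= (0 : R) := lexx 0.
Let e01 : 0 <= (0 : R) <= 1. Proof. by rewrite lexx ler01. Qed.
Let mh : measurable_fun setT h.
Proof. by apply: continuous_measurable_fun; exact: payoff_cont. Qed.
Let hb : bdd 1 0 h. Proof. exact: payoff_bdd. Qed.

Let X (t : R) := expR (- r * (T - t)).
Let dX (t : R) : is_derive t 1 X (r * X t).
Proof.
apply: (dereq (derexp (derZ (- r) (derB (derc t T) (derid t))))).
by rewrite /X; ring.
Qed.

Lemma bsm_price_t (t s : R) : t < T -> is_derive t 1 (bsm_price ^~ s)
  (r * bsm_price t s - X t * (m * H 1 (T - t) (ln s) + sig ^+ 2 / 2 * H 2 (T - t) (ln s))).
Proof.
move=> tT; have v0 : 0 < T - t by rewrite subr_gt0.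
have d1 := hflow_derive_v m sig_gt0 (ln s) v0 ler01 e01 mh hb.
have d2 := @dercomp _ (fun t => T - t) (fun v => H 0 v (ln s)) t _ _ d1 (derB (derc t T) (derid t)).
by apply: (dereq (derM (dX t) d2)); rewrite /bsm_price /H -/h -/m -/(X t); ring.
Qed.

Lemma bsm_price_s (t s : R) : t < T -> 0 < s -> is_derive s 1 (bsm_price t)
  (X t * (H 1 (T - t) (ln s) * s^-1)).
Proof.
move=> tT s0; have v0 : 0 < T - t by rewrite subr_gt0.
have d1 := hflow_derive_z m sig_gt0 (ln s) (leq0n 1) v0 ler01 e01 mh hb.
exact: (derZ (f := fun s => H 0 (T - t) (ln s)) (X t) (@dercomp _ (@ln R) (H 0 (T - t)) s _ _ d1 (is_derive1_ln s0))).
Qed.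

Lemma bsm_price_ss (t s : R) : t < T -> 0 < s ->
  is_derive s 1 (fun s => X t * (H 1 (T - t) (ln s) * s^-1))
    (X t * ((H 2 (T - t) (ln s) - H 1 (T - t) (ln s)) * s ^- 2)).
Proof.
move=> tT s0; have v0 : 0 < T - t by rewrite subr_gt0.
have sN : s != 0 by rewrite gt_eqF.
have d1 := hflow_derive_z m sig_gt0 (ln s) (leqnn 1) v0 ler01 e01 mh hb.
have d2 := derM (@dercomp _ (@ln R) (H 1 (T - t)) s _ _ d1 (is_derive1_ln s0)) (@derV _ id s 1 sN (derid s)).
by apply: (dereq (derZ (X t) d2)); rewrite /H -/h -/m; field.
Qed.

(** In z = ln s one has s d/ds = d/dz and s^2 d^2/ds^2 = d^2/dz^2 - d/dz, so the drift
    [r - sig^2 / 2] of the flow cancels all derivative terms. *)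
Lemma bsm_price_pde (t s : R) : 0 < s ->
  r * bsm_price t s - X t * (m * H 1 (T - t) (ln s) + sig ^+ 2 / 2 * H 2 (T - t) (ln s))
  + r * s * (X t * (H 1 (T - t) (ln s) * s^-1))
  + 2^-1 * sig ^+ 2 * s ^+ 2 * (X t * ((H 2 (T - t) (ln s) - H 1 (T - t) (ln s)) * s ^- 2))
  = r * bsm_price t s.
Proof.
move=> s0; rewrite /m; move: (H 1 _ _) (H 2 _ _) (bsm_price t s) (X t) => a b c d.
by field; rewrite gt_eqF.
Qed.

Lemma bsm_price_T s : 0 < s -> bsm_price T s = Num.max (s - K) 0.
Proof. by move=> s0; rewrite /bsm_price subrr mulr0 expR0 mul1r hflow_at0 /payoff lnK. Qed.

Lemma bsm_price_bdd : exists2 C, 0 <= C & forall t s, 0 <= t <= T -> 0 < s ->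
  `|bsm_price t s| <= C * (1 + s).
Proof.
exists (hcst m sig T); first exact: hcst_ge0.
move=> t s /andP[t0 tT] s0.
rewrite /bsm_price normrM ger0_norm ?expR_ge0//.
have le1 : expR (- r * (T - t)) <= 1.
  by rewrite -expR0 ler_expR mulNr oppr_le0 mulr_ge0// subr_ge0.
have v0 : 0 <= T - t by rewrite subr_ge0.
have vT : T - t <= T by rewrite gerBl.
have := hflow0_le m sig_gt0 (ln s) ler01 e0 mh hb v0 vT.
rewrite mul1r /wt add0r lnK// => le2.
apply: (le_trans (ler_pM (expR_ge0 _) (normr_ge0 _) le1 le2)); rewrite mul1r.
by apply: ler_wpM2l; [exact: hcst_ge0|rewrite lerDr].
Qed.

Lemma bsm_price_cont (p : R * R) : 0 < p.2 ->
  {for p, continuous (fun p => bsm_price p.1 p.2)}.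
Proof.
move=> p0.
have ct : {for p, continuous (fun p : R * R => T - p.1)}.
  by apply: cvgB; [exact: cvg_cst|exact: cvg_fst].
have c1 : {for p, continuous (fun p : R * R => - r * (T - p.1))}.
  by apply: cvgM; [exact: cvg_cst|exact: ct].
have c2 : {for p, continuous (fun p : R * R => expR (- r * (T - p.1)))}.
  by apply: (@continuous_comp _ _ _ (fun p : R * R => - r * (T - p.1)) expR); [exact: c1|exact: continuous_expR].
have cl : {for p, continuous (fun p : R * R => ln p.2)}.
  have cln : {for p.2, continuous (@ln R)} by exact: (der_cont (is_derive1_ln p0)).
  have c2' : {for p, continuous (snd : R * R -> R)} by exact: cvg_snd.
  exact: (@continuous_comp _ _ _ (snd : R * R -> R) (@ln R) p c2' cln).
have c3 := @hflow_h_cvg R 1 (fun=> r) (fun=> sig) h (fun=> sig_gt0) (@payoff_cont _ K) hb _ p _ _ 0 ord0 (or_introl erefl) ct cl.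
exact: (cvgM c2 c3).
Qed.

Lemma bsm_unique u : bsm_solution T K r sig u ->
  forall t s, 0 <= t <= T -> 0 < s -> u t s = bsm_price t s.
Proof.
move=> [[du _ _ _] uc [pde uT _ [C ub]]].
have [Q Q0 HQ] := bsm_price_bdd.
have C0 : 0 <= C.
  have := ub T 1; rewrite lexx (ltW T_gt0) => /(_ isT ltr01) /(le_trans (normr_ge0 _)).
  by rewrite pmulr_lge0// addr_gt0.
(* The multiplier [x], later 1 and - 1, lets one application of the maximum principle give both
   inequalities. *)
have main x : forall t s, 0 <= t <= T -> 0 < s -> x * (u t s - bsm_price t s) <= 0.
  apply: (@bsm_max _ T r sig (`|x| * (C + Q)) (fun t s => x * (u t s - bsm_price t s))
    (fun t s => x * (derive1 (u ^~ s) t - (r * bsm_price t s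
       - X t * (m * H 1 (T - t) (ln s) + sig ^+ 2 / 2 * H 2 (T - t) (ln s)))))
    (fun t s => x * (derive1 (u t) s - X t * (H 1 (T - t) (ln s) * s^-1)))
    (fun t s => x * (derive1n 2 (u t) s
       - X t * ((H 2 (T - t) (ln s) - H 1 (T - t) (ln s)) * s ^- 2)))) => //.
  - by rewrite mulr_ge0// addr_ge0.
  - move=> t s tT s0; have [_ tT'] := andP tT; have [d1 _ _] := du (t, s) (conj tT s0).
    apply: (derZ x (derB _ _)); last exact: bsm_price_t.
    by rewrite derive1E; exact/derivableP.
  - move=> t s tT s0; have [_ tT'] := andP tT; have [_ d1 _] := du (t, s) (conj tT s0).
    apply: (derZ x (derB _ _)); last exact: bsm_price_s.
    by rewrite derive1E; exact/derivableP.
  - move=> t s tT s0; have [_ tT'] := andP tT; have [_ _ d1] := du (t, s) (conj tT s0).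
    apply: (derZ x (derB _ _)); last exact: bsm_price_ss.
    by rewrite derive1nS derive1n1 derive1E; exact/derivableP.
  - move=> t s tT s0; have P1 := pde t s tT s0; have P2 := bsm_price_pde t s0.
    have E (a b c d a' b' c' d' : R) (e f : R) : a + e * b + f * c = r * d ->
        a' + e * b' + f * c' = r * d' ->
        x * (a - a') + e * (x * (b - b')) + f * (x * (c - c')) = r * (x * (d - d')).
      move=> h1 h2; transitivity (x * ((a + e * b + f * c) - (a' + e * b' + f * c'))); first by ring.
      by rewrite h1 h2; ring.
    exact: E P1 P2.
  - move=> p; apply: cvgM; first exact: cvg_cst.
    apply: cvgB; first exact: uc.
    apply: (continuous_in_subspaceT (f := fun q : R * R => bsm_price q.1 q.2)).
    by move=> q; rewrite inE => -[_ q0]; exact: bsm_price_cont.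
  - by move=> s s0; rewrite uT// bsm_price_T// subrr mulr0.
  - move=> t s tT s0; apply: (le_trans (ler_norm _)); rewrite normrM -mulrA.
    apply: ler_wpM2l => //; apply: (le_trans (ler_normB _ _)); rewrite mulrDl.
    by apply: lerD; [exact: ub|exact: HQ].
move=> t s tT s0; have := main 1 t s tT s0; have := main (-1) t s tT s0.
rewrite mul1r mulN1r => h1 h2; apply/eqP; rewrite -subr_eq0 eq_le h2/=.
by rewrite -oppr_le0.
Qed.

End bsm_price.

(** * Return to the original variables *)

Section lognormal.
Context {R : realType}.
Local Notation mu := (@lebesgue_measure R).

(** Substitution on the compact intervals [B n], whose images [A n] exhaust the positive half-line,
    followed by monotone convergence on both sides. *)
Lemma ge0_integral_exp (G : R -> R) (b c : R) : 0 < c ->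
  (forall x, 0 < x -> {for x, continuous G}) -> (forall x, 0 < x -> 0 <= G x) ->
  (\int[mu]_(x in `]0%R, +oo[) (G x)%:E
   = \int[mu]_x (G (expR (b + c * x)) * (c * expR (b + c * x)))%:E)%E.
Proof.
move=> c0 cG G0.
pose F (x : R) := expR (b + c * x).
have dF (x : R) : is_derive x 1 F (c * F x).
  apply: (dereq (derexp (derD (derc x b) (derZ c (derid x))))).
  by rewrite add0r mulr1 mulrC.
have F0 x : 0 < F x by exact: expR_gt0.
have cF : continuous F by move=> x; exact: (der_cont (dF x)).
have E1 : derive1 F = fun x => c * F x.
  by apply/funext => x; rewrite derive1E; have [_ ->] := dF x.
have cF1 : continuous (fun x => c * F x) by move=> x; exact: (cvgM (cvg_cst c) (cF x)).
pose A (n : nat) : set (measurableTypeR R) := `[F (- n%:R), F n%:R]%classic.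
pose B (n : nat) : set (measurableTypeR R) := `[- n%:R, n%:R]%classic.
pose g1 (x : measurableTypeR R) := (G x)%:E.
pose g2 (x : measurableTypeR R) := (G (F x) * (c * F x))%:E.
have Fle : {homo F : x y / x <= y}.
  by move=> x y xy; rewrite ler_expR lerD2l ler_wpM2l// ltW.
have Flt : {homo F : x y / x < y} by move=> x y xy; rewrite ltr_expR ltrD2l ltr_pM2l.
have EA n : (\int[mu]_(x in A n) g1 x = \int[mu]_(x in B n) g2 x)%E.
  rewrite /A /g1 integration_by_substitution_increasing.
  - by apply: eq_integral => x _; rewrite fctE/= E1.
  - by rewrite lerNl oppr0 ler0n || (apply: (@le_trans _ _ 0); rewrite ?oppr_le0).
  - by move=> x y _ _; exact: Flt.
  - by move=> x _; rewrite E1; exact: cF1.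
  - by rewrite E1; apply/cvg_ex; exists (c * F (- n%:R)); apply: cvg_at_right_filter; exact: cF1.
  - by rewrite E1; apply/cvg_ex; exists (c * F n%:R); apply: cvg_at_left_filter; exact: cF1.
  - split; first by move=> x _; have [] := dF x.
      by apply: cvg_at_right_filter; exact: cF.
    by apply: cvg_at_left_filter; exact: cF.
  - apply: continuous_in_subspaceT => x; rewrite inE/= in_itv/= => /andP[x0 _].
    by apply: cG; exact: lt_le_trans x0.
have UA : \bigcup_n A n = `]0, +oo[%classic.
  apply/seteqP; split => [x [n _]|x]; rewrite /A/= !in_itv/= ?andbT.
    by move=> /andP[+ _]; apply: lt_le_trans.
  move=> x0; exists (Num.truncn `|(ln x - b) / c|).+1 => //=.
  set n := (Num.truncn _).+1.
  have hn : `|(ln x - b) / c| <= n%:R by rewrite ltW// truncnS_gt.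
  have -> : x = F ((ln x - b) / c) by rewrite /F mulrC divfK ?gt_eqF// subrKC lnK.
  move: hn; rewrite ler_norml => /andP[h1 h2]. by apply/andP; split; apply: Fle.
have UB : \bigcup_n B n = setT.
  apply/seteqP; split => // x _; exists (Num.truncn `|x|).+1 => //=.
  by rewrite /B/= in_itv/= -ler_norml ltW// truncnS_gt.
have nA : nondecreasing_seq A.
  move=> n m nm; apply/subsetPset => x; rewrite /A/= !in_itv/= => /andP[h1 h2].
  by rewrite (le_trans (Fle _ _ _) h1) ?lerN2 ?ler_nat// (le_trans h2)// Fle// ler_nat.
have nB : nondecreasing_seq B.
  move=> n m nm; apply/subsetPset => x; rewrite /B/= !in_itv/= => /andP[h1 h2].
  by rewrite (le_trans _ h1) ?lerN2 ?ler_nat// (le_trans h2)// ler_nat.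
have m1 n : measurable_fun (A n) g1.
  apply: (@measurable_funS _ _ _ _ (`]0, +oo[%classic : set (measurableTypeR R))) => //.
    by rewrite -UA; exact: bigcup_sup.
  apply/measurable_EFinP; apply: open_continuous_measurable_fun => // x.
  by rewrite inE/= in_itv/= andbT; exact: cG.
have m2 n : measurable_fun (B n) g2.
  apply: measurable_funTS; apply/measurable_EFinP.
  apply: continuous_measurable_fun => x.
  have cGF : {for x, continuous (fun x => G (F x))}.
    by apply: (@continuous_comp _ _ _ F G); [exact: cF|exact: cG].
  exact: (cvgM cGF (@cF1 x)).
have p1 n x : A n x -> (0 <= g1 x)%E.
  by rewrite /A/= in_itv/= => /andP[x0 _]; rewrite lee_fin G0// (lt_le_trans _ x0).
have p2 n x : B n x -> (0 <= g2 x)%E.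
  by move=> _; rewrite lee_fin mulr_ge0 ?G0// mulr_ge0// ltW.
have mA n : measurable (A n) by exact: measurable_itv.
have mB n : measurable (B n) by exact: measurable_itv.
have := @ge0_nondecreasing_set_cvg_integral _ _ R A g1 mu nA mA m1 p1.
have := @ge0_nondecreasing_set_cvg_integral _ _ R B g2 mu nB mB m2 p2.
rewrite UA UB; under eq_fun do rewrite -EA.
move=> h2 h1; exact: (cvg_unique _ h1 h2).
Qed.

(** The positive and negative parts are transformed separately as extended integrals, so the
    identity holds whether or not [G] is integrable. *)
Lemma integral_exp (G : R -> R) (b c : R) : 0 < c ->
  (forall x, 0 < x -> {for x, continuous G}) ->
  \int[mu]_(x in `]0, +oo[) G x = intR (fun x => G (expR (b + c * x)) * (c * expR (b + c * x))).
Proof.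
move=> c0 cG; rewrite /intR /Rintegral; congr fine.
pose F (x : R) := expR (b + c * x).
have F0 x : 0 < c * F x by rewrite mulr_gt0// expR_gt0.
have cmax (f : R -> R) x : {for x, continuous f} -> {for x, continuous (fun x => Num.max (f x) 0)}.
  by move=> cf; exact: (continuous_max cf (cvg_cst _)).
rewrite integralE [RHS]integralE; congr (_ - _)%E.
  have -> : (\int[mu]_(x in `]0%R, +oo[) ((fun x => (G x)%:E)^\+ x) = \int[mu]_(x in `]0%R, +oo[) (Num.max (G x) 0)%:E)%E.
    by apply: eq_integral => x _; rewrite funeposE -EFin_max.
  rewrite (ge0_integral_exp b c0).
  - apply: eq_integral => x _; rewrite funeposE -EFin_max -/(F x).
    by rewrite maxr_pMl ?mul0r// ltW.
  - by move=> x x0; apply: cmax; exact: cG.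
  - by move=> x _; rewrite le_max lexx orbT.
have -> : (\int[mu]_(x in `]0%R, +oo[) ((fun x => (G x)%:E)^\- x) = \int[mu]_(x in `]0%R, +oo[) (Num.max (- G x) 0)%:E)%E.
  by apply: eq_integral => x _; rewrite funenegE -EFinN -EFin_max.
rewrite (ge0_integral_exp b c0).
- apply: eq_integral => x _; rewrite funenegE -EFinN -EFin_max -/(F x).
  by rewrite maxr_pMl ?mul0r ?mulNr// ltW.
- by move=> x x0; apply: cmax; apply: cvgN; exact: cG.
- by move=> x _; rewrite le_max lexx orbT.
Qed.

(** Substituting x = exp(ln s + (r - sig^2 / 2) v + sig sqrt v w) turns [lognormal_dev] into w, and
    the Jacobian cancels x sig sqrt v in the denominator. *)
Lemma lognormal_hflow (r sig v s : R) (g : R -> R) : 0 < sig -> 0 < v -> 0 < s ->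
  (forall x, 0 < x -> {for x, continuous g}) ->
  \int[mu]_(x in `]0, +oo[) (g x * lognormal_density r sig x s v)
  = hflow (r - sig ^+ 2 / 2) sig 0 (g \o expR) v (ln s).
Proof.
move=> sig0 v0 s0 cg.
have sv : 0 < Num.sqrt v by rewrite sqrtr_gt0.
have c0 : 0 < sig * Num.sqrt v by rewrite mulr_gt0.
have pi0 := @sqrt2pi_gt0 R.
have cn : {in Num.pos, forall x : R, {for x, continuous (@ln R)}}.
  by move=> x x0; apply: (der_cont (is_derive1_ln _)).
rewrite (integral_exp (ln s + (r - sig ^+ 2 / 2) * v) c0).
  rewrite hflow0E /gavg; congr intR; apply/funext => w /=.
  rewrite /lognormal_density /lognormal_dev lnM ?posrE ?expR_gt0 ?invr_gt0// lnV ?posrE// expRK.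
  set X := expR _; have X0 : X != 0 by rewrite gt_eqF ?expR_gt0.
  rewrite (_ : (_ - ln s - _ * v) / _ = w); last by field; rewrite !gt_eqF.
  rewrite /gk /gam mul1r (_ : - 2^-1 * w ^+ 2 = - (w ^+ 2 / 2)); last by field.
  by move: (expR (- _)) (g _) => a d; field; rewrite X0 !gt_eqF.
move=> x x0; have xN : x != 0 by rewrite gt_eqF.
have xs0 : 0 < x / s by rewrite divr_gt0.
have c1 : {for x, continuous (fun x : R => x / s)}.
  exact: (cvgM cvg_id (cvg_cst _)).
have c2 : {for x, continuous (fun x : R => ln (x / s))}.
  by apply: (@continuous_comp _ _ _ (fun x : R => x / s) (@ln R)); [exact: c1|exact: cn].
have c3 : {for x, continuous (fun x : R => lognormal_dev r sig x s v)}.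
  exact: (cvgM (cvgB c2 (cvg_cst _)) (cvg_cst _)).
have c4 : {for x, continuous (fun x : R => - 2^-1 * lognormal_dev r sig x s v ^+ 2)}.
  exact: (cvgM (cvg_cst _) (cvgM c3 c3)).
have c5 : {for x, continuous (fun x : R => expR (- 2^-1 * lognormal_dev r sig x s v ^+ 2))}.
  by apply: (@continuous_comp _ _ _ (fun x : R => - 2^-1 * lognormal_dev r sig x s v ^+ 2) expR); [exact: c4|exact: continuous_expR].
have c6 : {for x, continuous (fun x : R => Num.sqrt (2 * pi) * x * sig * Num.sqrt v)}.
  exact: (cvgM (cvgM (cvgM (cvg_cst _) cvg_id) (cvg_cst _)) (cvg_cst _)).
have N6 : Num.sqrt (2 * pi) * x * sig * Num.sqrt v != 0.
  by rewrite gt_eqF// !mulr_gt0.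
exact: (cvgM (cg x x0) (cvgM c5 (cvgV N6 c6))).
Qed.

End lognormal.

(** * Holding-time law and jump probabilities as one continuous kernel *)

Section holding_time_kernel.
Context {R : realType} {k : nat}.
Variable lam : rates R k.
Implicit Types (i j : 'I_k) (y : R).

(** The values without meaning, on the diagonal and at negative ages, are replaced so as to give
    functions that are continuous and nonnegative on the whole line. *)
Definition lam_ext i j y : R := if i == j then 0 else lam i j (Num.max y 0).

Lemma lam_ext_ge0 i j y : 0 <= lam_ext i j y.
Proof.
rewrite /lam_ext; have [//|ij] := eqVneq i j.
by rewrite ltW// rate_gt0// le_max lexx orbT.
Qed.

Lemma lam_ext_cont i j : continuous (lam_ext i j).
Proof.
rewrite /lam_ext; have [_ y|ij y] := eqVneq i j; first exact: cvg_cst.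
have m0 : 0 <= Num.max y 0 by rewrite le_max lexx orbT.
have H := derivable_on_nng_cvg (@rate_derivable _ _ lam i j _ ij m0).
apply: (cvg_trans _ H); apply: (@cvg_trans _ (lam i j @ (Num.max z 0 @[z --> y]))) => //.
apply: cvg_app => P HP.
have cm : Num.max z 0 @[z --> y] --> Num.max y 0.
  exact: (@continuous_max _ _ _ _ _ (@cvg_id _ _) (@cvg_cst _ _ _ _ _)).
have {}HP : \forall z \near Num.max y 0, z \in `[0, +oo[ -> P z by [].
have H' : \forall z \near y, Num.max z 0 \in `[0, +oo[ -> P (Num.max z 0) by exact: cm _ HP.
apply: filterS H' => z /=; apply; by rewrite in_itv/= andbT le_max lexx orbT.
Qed.

Definition tot i y : R := \sum_(j < k | j != i) lam_ext i j y.

Lemma tot_cont i : continuous (tot i).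
Proof.
move=> y; apply: cvg_big => [|j _]; first exact: add_continuous.
exact: lam_ext_cont.
Qed.

Lemma lam_extE i j y : j != i -> 0 <= y -> lam_ext i j y = lam i j y.
Proof. by move=> ji y0; rewrite /lam_ext eq_sym (negbTE ji) max_l. Qed.

Lemma totE i y : 0 <= y -> tot i y = `|diag_rate lam i y|.
Proof.
move=> y0; rewrite /diag_rate normrN ger0_norm.
  by apply: eq_bigr => j ji; rewrite lam_extE.
by apply: sumr_ge0 => j ji; rewrite ltW// rate_gt0// eq_sym.
Qed.

(* [cum_rate i] is extended below 0 so as to be differentiable at age 0. *)
Definition cum_ext i y : R :=
  intR (cut (- 2) (Num.max y (- 1)) (tot i)) - intR (cut (- 2) 0 (tot i)).

Let prim_derive i (y : R) : -2 < y -> is_derive y 1 (fun y => intR (cut (- 2) y (tot i))) (tot i y).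
Proof.
move=> y2; have yy : -2 < y < y + 1 by apply/andP; split; [exact: y2|rewrite ltrDl].
by apply: (cut_derive (intgR_cont_cut (fun x _ => @tot_cont i x)) yy); exact: tot_cont.
Qed.

Lemma cum_ext_cont i : continuous (cum_ext i).
Proof.
move=> y; apply: cvgB; last exact: cvg_cst.
have cm : {for y, continuous (fun y : R => Num.max y (- 1))}.
  exact: (@continuous_max _ _ _ _ _ (@cvg_id _ _) (@cvg_cst _ _ _ _ _)).
have m2 : -2 < Num.max y (- 1) by rewrite lt_max; apply/orP; right; lra.
exact: (@continuous_comp _ _ _ (fun y : R => Num.max y (- 1)) _ _ cm (der_cont (@prim_derive i _ m2))).
Qed.

Lemma cum_ext_derive i y : -1 < y -> is_derive y 1 (cum_ext i) (tot i y).
Proof.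
move=> y1; have y2 : -2 < y by lra.
have d := derB (@prim_derive i _ y2) (derc y (intR (cut (- 2) 0 (tot i)))).
apply: near_eq_is_derive (dereq d (subr0 _)).
near=> z; rewrite /cum_ext max_l//.
by apply: ltW; near: z; exact: lt_nbhsr.
Unshelve. all: end_near. Qed.

Lemma cum_extE i y : 0 <= y -> cum_ext i y = cum_rate lam i y.
Proof.
move=> y0; rewrite /cum_rate intR_cut_itv; last first.
  apply/measurable_EFinP; have /integrableP[+ _] := diag_rate_integrable lam i y.
  by apply: measurable_funS => //; exact: subset_itv_oo_cc.
have -> : cut 0 y (fun v => `|diag_rate lam i v|) = cut 0 y (tot i).
  apply/funext => v; rewrite /cut; case: ifP => // /andP[v0 _].
  by rewrite totE// ltW.
rewrite /cum_ext max_l; last by lra.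
apply/eqP; rewrite subr_eq; apply/eqP.
have i1 := @intgR_cont_cut _ _ 0 y (fun x _ => @tot_cont i x).
have i2 := @intgR_cont_cut _ _ (- 2) 0 (fun x _ => @tot_cont i x).
rewrite -intRD//; apply: (@eq_intR_neq _ 0) => [||v v0].
- exact: (intgR_mfun (@intgR_cont_cut _ _ (- 2) y (fun x _ => @tot_cont i x))).
- exact: (intgR_mfun (intgRD i1 i2)).
rewrite /cut.
have [vp|vn|E] := ltgtP v 0; last by rewrite E eqxx in v0.
- by rewrite (lt_le_trans vp y0) /= add0r.
- by rewrite andbF addr0 (lt_trans _ vn)// oppr_lt0.
Qed.

Lemma hold_cdfE i y : 0 <= y -> hold_cdf lam i y = 1 - expR (- cum_ext i y).
Proof. by move=> y0; rewrite cum_extE. Qed.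

Lemma hold_pdfE i y : 0 <= y -> hold_pdf lam i y = tot i y * expR (- cum_ext i y).
Proof.
move=> y0; have y1 : -1 < y by lra.
have d : is_derive y 1 (fun y => 1 - expR (- cum_ext i y)) (tot i y * expR (- cum_ext i y)).
  have dN : is_derive y 1 (fun y => - cum_ext i y) (- tot i y).
    rewrite (_ : (fun y => _) = (fun y => -1 * cum_ext i y)); last by apply/funext => z; rewrite mulN1r.
    by apply: (dereq (derZ (- 1) (cum_ext_derive i y1))); rewrite mulN1r.
  by apply: (dereq (derB (derc y 1) (derexp dN))); ring.
move/is_derive1P : d => d.
rewrite /hold_pdf /deriv_on_nng.
(* A limit is unique along a proper filter only: here the points to the right of [y] lie in the
   half-line and accumulate at [y]. *)
have P : ProperFilter (within `[0, +oo[%classic y^').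
  apply: Build_ProperFilter => H.
  have : \forall z \near y^'+, False.
    rewrite near_withinE; have {}H : \forall z \near y, z != y -> z \in `[0, +oo[ -> False by exact: H.
    apply: filterS H => z h yz; apply: h; first by rewrite gt_eqF.
    by rewrite in_itv/= andbT (le_trans y0)// ltW.
  by move/filter_ex => [].
apply: cvg_lim; first exact: norm_hausdorff.
have {}d : (1 - expR (- cum_ext i x) - (1 - expR (- cum_ext i y))) / (x - y)
    @[x --> within `[0, +oo[%classic y^'] --> tot i y * expR (- cum_ext i y).
  by apply: cvg_trans d; apply: cvg_app; exact: cvg_within.
apply: cvg_trans d; apply: near_eq_cvg; rewrite near_withinE; near=> z => z0.
move: z0; rewrite /= in_itv/= andbT => z0.
by rewrite /diff_quot !hold_cdfE.
Unshelve. all: end_near. Qed.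

(** The total rate in the holding density cancels the denominator of the jump probability; it is
    positive because regime [j] contributes to it. The survival probabilities give the exponentials
    of the cumulative rate. *)
Lemma kernel_eq (r : 'I_k -> R) i j y v : j != i -> 0 <= y -> 0 <= v ->
  expR (- r i * v) * (hold_pdf lam i (y + v) / (1 - hold_cdf lam i y)) * jump_prob lam i j (y + v)
  = jker r lam_ext cum_ext i j y v.
Proof.
move=> ji y0 v0; have yv : 0 <= y + v by rewrite addr_ge0.
rewrite (hold_pdfE i yv) (hold_cdfE i y0) subKr -expRN opprK /jump_prob (negbTE ji) -(totE i yv) -(lam_extE ji yv).
rewrite /jker /jker0 /hazard.
have t0 : tot i (y + v) != 0.
  rewrite gt_eqF// /tot (bigD1 j)//= ltr_pwDl//; last by apply: sumr_ge0 => l _; exact: lam_ext_ge0.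
  by rewrite lam_extE// rate_gt0// eq_sym.
by move: (expR _) (expR _) (expR _) => a b c; field.
Qed.

Lemma survival_ratio i y v : 0 <= y -> 0 <= v ->
  (1 - hold_cdf lam i (v + y)) / (1 - hold_cdf lam i y)
  = expR (cum_ext i y - cum_ext i (y + v)).
Proof.
move=> y0 v0; have yv : 0 <= y + v by rewrite addr_ge0.
by rewrite (addrC v) (hold_cdfE i yv) (hold_cdfE i y0) !subKr -expRN opprK -expRD addrC.
Qed.

End holding_time_kernel.

(** * Elements of B, their growth up to the closure, their values at age 0 *)

Section price_functions_facts.
Context {R : realType}.

Lemma within_comp (X Y Z : topologicalType) (A : set Y) (f : Y -> Z) (g : X -> Y) (p : X) :
  {within A, continuous f} -> A (g p) -> (\forall x \near p, A (g x)) ->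
  {for p, continuous g} -> {for p, continuous (fun x => f (g x))}.
Proof.
move=> /subspace_continuousP cf Ap Ag cg.
apply: (@cvg_comp _ _ _ g f (nbhs p) (within A (nbhs (g p)))); last exact: cf.
move=> P HP; have {}HP : \forall y \near g p, A y -> P y by exact: HP.
have H : \forall x \near p, A (g x) -> P (g x) := cg _ HP.
suff : \forall x \near p, P (g x) by [].
by apply: filterS2 Ag H => x a; exact.
Qed.

(** [loc_bound] reaches only ages within distance 1; measuring ages in units of [T] brings [[0, T]]
    into that range. *)
Lemma cont_at_bound (kap : R -> R -> R) (T L : R) : 0 < T -> 0 <= L ->
  (forall y v, cont_at kap y v) ->
  exists2 Q, 0 <= Q & forall y v, 0 <= y <= T -> 0 <= v <= L -> `|kap y v| <= Q.
Proof.
move=> T0 L0 ck.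
have ck' y v : cont_at (fun y v => kap (T * y) v) y v.
  have c1 : {for (y, v), continuous (fun q : R * R => T * q.1)}.
    by apply: cvgM; [exact: cvg_cst|exact: cvg_fst].
  have c2 : {for (y, v), continuous (fun q : R * R => q.2)} by exact: cvg_snd.
  exact: (@cont_at_comp _ _ (y, v) _ _ kap c1 c2 (ck (T * y) v)).
have [Q Q0 HQ] := loc_bound 0 L0 ck'; exists Q => // y v /andP[y0 yT] vL.
have -> : kap y v = kap (T * (y / T)) v by rewrite mulrC divfK ?gt_eqF.
by apply: HQ => //; rewrite subr0 ger0_norm ?divr_ge0 ?(ltW T0)// ler_pdivrMr// mul1r.
Qed.

Variables (T : R) (k : nat).
Hypothesis T_gt0 : 0 < T.
Implicit Type phi : R -> R -> 'I_k -> R -> R.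

(** The norm is a supremum over the open domain. If the bound failed at a point of the closure, by
    continuity it would fail at nearby points of the open domain, such as those on the segment
    towards t = 2T/3, y = T/3. *)
Lemma in_B_growth phi : in_B T phi -> exists2 D, 0 <= D &
  forall t s i y, cdom T (t, s, y) -> `|phi t s i y| <= D * (1 + s).
Proof.
move=> [cphi _ gphi].
have [D D0 HD] : exists2 D, 0 <= D & forall t s i y, dom T (t, s, y) -> `|phi t s i y| <= D * (1 + s).
  have ub t s i y : dom T (t, s, y) -> (`|phi t s i y / (1 + s)|%:E <= growth_norm T phi)%E.
    by move=> d; apply: ereal_sup_ubound; exists t, s, i, y.
  case E : (growth_norm T phi) ub gphi => [D| |] ub // _.
    exists `|D| => // t s i y d; have [_ s0 _ _] := d.
    have s1 : 0 < 1 + s by rewrite addr_gt0.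
    have := ub t s i y d; rewrite lee_fin normrM normfV (gtr0_norm s1) ler_pdivrMr// => H.
    by apply: (le_trans H); rewrite ler_wpM2r ?(ltW s1)// ler_norm.
  exists 0 => // t s i y d; have := ub t s i y d.
  by rewrite leeNy_eq.
exists D => // t s i y c; rewrite leNgt; apply/negP => H.
have /subspace_continuousP/(_ _ c) Hc := cphi i.
have Hn : `|phi p.1.1 p.1.2 i p.2| @[p --> within (cdom T) (nbhs (t, s, y))] --> `|phi t s i y|.
  exact: (cvg_norm Hc).
have : \forall p \near within (cdom T) (nbhs ((t, s), y)), D * (1 + s) < `|phi p.1.1 p.1.2 i p.2|.
  exact: (cvgr_gt _ Hn).
rewrite near_withinE => /nbhs_ballP[e /= e0 He].
have [/andP[t0 tT] s0 /andP[y0 yt]] := c.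
(* The fraction of the segment to be covered: both coordinates then move by at most d T < e. *)
pose d := Num.min (e / (2 * T)) 1.
have d0 : 0 < d by rewrite lt_min divr_gt0 ?mulr_gt0//=.
have d1 : d <= 1 by rewrite ge_min lexx orbT.
have de : d * T < e.
  apply: (@le_lt_trans _ _ (e / (2 * T) * T)); first by rewrite ler_wpM2r ?(ltW T_gt0)// ge_min lexx.
  by rewrite (_ : e / (2 * T) * T = e / 2); [rewrite ltr_pdivrMr// ltr_pMr// ltr1n|field; rewrite gt_eqF].
have cl (a b : R) : 0 <= a <= T -> 0 <= b <= T -> `|a - (a + d * (b - a))| < e.
  move=> /andP[a0 aT] /andP[b0 bT]; rewrite opprD addNKr normrN normrM (gtr0_norm d0).
  apply: le_lt_trans de; apply: ler_wpM2l; first exact: ltW.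
  by rewrite ler_norml; apply/andP; split; lra.
have dd : dom T (t + d * (T * 2 / 3 - t), s, y + d * (T / 3 - y)).
  have h1 : 0 <= (1 - d) * t by rewrite mulr_ge0// subr_ge0.
  have h2 : 0 <= (1 - d) * y by rewrite mulr_ge0// subr_ge0.
  have h3 : 0 < d * T by rewrite mulr_gt0.
  have h4 : (1 - d) * t <= (1 - d) * T by rewrite ler_wpM2l// subr_ge0.
  have h5 : (1 - d) * y <= (1 - d) * t by rewrite ler_wpM2l// subr_ge0.
  by split => //; [apply/andP; split|apply/andP; split|]; lra.
have dc : cdom T (t + d * (T * 2 / 3 - t), s, y + d * (T / 3 - y)).
  by case: dd => /andP[/ltW a /ltW b] _ /andP[/ltW a' b'] /ltW c'; split; rewrite ?a ?b ?a' ?c'.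
have := HD _ _ i _ dd; rewrite leNgt => /negP; apply.
apply: (He (t + d * (T * 2 / 3 - t), s, y + d * (T / 3 - y))) => //.
split; [split => //=|].
- by apply: cl; apply/andP; split => //; lra.
- exact: ballxx.
- by apply: (cl y (T / 3)); apply/andP; split => //; lra.
Qed.

(* The clamping makes [newborn] total and continuous. *)
Definition to_go (t : R) : R := T - Num.min (Num.max t 0) T.

Lemma to_goE t : 0 <= t <= T -> to_go t = T - t.
Proof. by move=> /andP[t0 tT]; rewrite /to_go max_l// min_l. Qed.

Lemma to_go_itv t : 0 <= to_go t <= T.
Proof.
rewrite /to_go subr_ge0 ge_min lexx orbT/= gerBl le_min (ltW T_gt0) andbT.
by rewrite le_max lexx orbT.
Qed.

Definition newborn phi (j : 'I_k) (t z : R) : R := phi (to_go t) (expR z) j 0.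

Lemma newborn_cdom t z : cdom T (to_go t, expR z, 0).
Proof. by have := to_go_itv t => /andP[a b]; split; rewrite ?expR_gt0 ?lexx ?a ?b. Qed.

Lemma newborn_singular phi L : 0 < L -> in_B T phi -> exists2 D, 0 <= D &
  forall j, singular L D 1 (newborn phi j).
Proof.
move=> L0 phiB; have [D D0 HD] := in_B_growth phiB; have [cphi _ _] := phiB.
exists (D * Num.sqrt L); first by rewrite mulr_ge0// sqrtr_ge0.
move=> j; split => [u x _|u /andP[u0 uL] x].
  apply: (@within_comp _ _ _ (cdom T) (fun p : R * R * R => phi p.1.1 p.1.2 j p.2)
     (fun q : R * R => (to_go q.1, expR q.2, 0)) (u, x) (cphi j)).
  - exact: newborn_cdom.
  - by apply/nbhs_ballP; exists 1 => //= q _; exact: newborn_cdom.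
  - have c1 : {for (u, x), continuous (fun q : R * R => to_go q.1)}.
      have d1 : {for (u, x), continuous (fun q : R * R => Num.max q.1 0)}.
        by apply: continuous_max; [exact: cvg_fst|exact: cvg_cst].
      have d2 : {for (u, x), continuous (fun q : R * R => Num.min (Num.max q.1 0) T)}.
        by apply: continuous_min; [exact: d1|exact: cvg_cst].
      exact: (cvgB (cvg_cst _) d2).
    have c2 : {for (u, x), continuous (fun q : R * R => expR q.2)}.
      by apply: (@continuous_comp _ _ _ snd (@expR R)); [exact: cvg_snd|exact: continuous_expR].
    exact: (cvg_pair (cvg_pair c1 c2) (cvg_cst _)).
apply: (le_trans (HD _ _ j _ (newborn_cdom u x))); rewrite -/(wt 1 x).
rewrite ler_wpM2r ?wt_ge0// ler_pdivlMr ?sqrtr_gt0//.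
by apply: ler_wpM2l => //; rewrite ler_wsqrtr// ltW.
Qed.

Lemma in_B_section phi t j x : in_B T phi -> 0 <= t <= T -> 0 < x ->
  {for x, continuous (fun x => phi t x j 0)}.
Proof.
move=> [cphi _ _] /andP[t0 tT] x0.
apply: (@within_comp _ _ _ (cdom T) (fun p : R * R * R => phi p.1.1 p.1.2 j p.2)
  (fun x : R => (t, x, 0)) x (cphi j)).
- by split; rewrite ?t0 ?lexx ?tT.
- have : \forall y \near x, 0 < y by exact: lt_nbhsr.
  by apply: filterS => y y0; split; rewrite ?t0 ?lexx ?tT.
- exact: (cvg_pair (cvg_pair (cvg_cst _) cvg_id) (cvg_cst _)).
Qed.

End price_functions_facts.

(** * Existence, uniqueness, smoothness and sign in the original variables *)

Section pricing.
Context {R : realType} {k : nat}.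
Variables (T K : R) (r sigma : 'I_k -> R) (lam : rates R k) (eta : 'I_k -> R -> R -> R).
Hypotheses (T_gt0 : 0 < T) (K_gt0 : 0 < K) (r_ge0 : forall i, 0 <= r i)
  (sigma_gt0 : forall i, 0 < sigma i)
  (eta_bsm : forall i, bsm_solution T K (r i) (sigma i) (eta i)).
Implicit Type phi : R -> R -> 'I_k -> R -> R.

Local Notation m := (drift r sigma).
Local Notation kj := (jker r (lam_ext lam) (cum_ext lam)).
Local Notation S := (src r sigma (payoff K) (cum_ext lam)).
Local Notation vp := (vop m sigma kj).
(* Any horizon beyond [T] does: it makes [T] an interior time to go. *)
Let L := T + 1.
Let L_gt0 : 0 < L. Proof. by rewrite addr_gt0. Qed.
Let T_ltL : T < L. Proof. by rewrite ltrDl. Qed.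

Let ckj i j y v : cont_at (kj i j) y v.
Proof. by apply: cjker; [exact: lam_ext_cont|exact: cum_ext_cont]. Qed.

(** Valid for every element of B, this serves both to check that the constructed price is a solution
    and to bring an arbitrary solution into the Volterra equation. *)
Lemma price_operatorE phi t s i y : in_B T phi -> cdom T (t, s, y) ->
  price_operator T r sigma lam eta phi t s i y
  = S 0 i y (T - t) (ln s) + vp (newborn T phi) i y (T - t) (ln s).
Proof.
move=> phiB [/andP[t0 tT] s0 /andP[y0 yt]].
have tT0 : 0 <= T - t by rewrite subr_ge0.
have t0T : 0 <= t <= T by rewrite t0.
rewrite /price_operator; congr (_ + _).
  rewrite (survival_ratio lam i y0 tT0) (bsm_unique T_gt0 K_gt0 (r_ge0 i) (sigma_gt0 i) (eta_bsm i) t0T s0).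
  by rewrite /src /disc /bsm_price mulrA.
have [D D0 PS] := newborn_singular T_gt0 L_gt0 phiB.
pose f j v := kj i j y v * hflow (m i) (sigma i) 0 (newborn T phi j (T - t - v)) v (ln s).
have E v : 0 < v < T - t ->
  expR (- r i * v) * (hold_pdf lam i (y + v) / (1 - hold_cdf lam i y))
       * (\sum_(j < k | j != i) (jump_prob lam i j (y + v)
           * \int[@lebesgue_measure R]_(x in `]0, +oo[)
               (phi (t + v) x j 0 * lognormal_density (r i) (sigma i) x s v)))
  = \sum_(j < k | j != i) f j v.
  move=> /andP[v0 vt]; have tv : 0 <= t + v <= T.
    by rewrite addr_ge0 ?(ltW v0)//= -lerBrDl ltW.
  rewrite mulr_sumr; apply: eq_bigr => j ji.
  rewrite mulrA (kernel_eq lam r ji y0 (ltW v0)); congr (_ * _).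
  rewrite lognormal_hflow//; last by move=> x x0; exact: (@in_B_section _ T k phi (t + v) j x phiB tv x0).
  congr hflow; apply/funext => x; rewrite /newborn /= to_goE; last first.
    by rewrite subr_ge0 (ltW vt)/= -addrA -opprD gerBl addr_ge0// ltW.
  by congr (phi _ _ _ _); ring.
(* At maturity the time integral runs over a single point. *)
have [tT'|tT'] := leP (T - t) 0.
  rewrite vop_le0// (_ : T - t = 0); last by apply/eqP; rewrite eq_le tT'.
  by rewrite set_itv1 Rintegral_set1.
have tL : 0 < T - t < L by rewrite tT' (le_lt_trans _ T_ltL)// gerBl.
have fi j : intgR (cut 0 (T - t) (f j)).
  exact: (@jop_singular_int _ (m i) (sigma i) L (sigma_gt0 i) L_gt0 (kj i j) _ D 1 y (T - t) (ln s) D0 ler01 (@ckj i j) (PS j) tL).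
have sumI (l : seq 'I_k) :
    intgR (cut 0 (T - t) (fun v => \sum_(j <- l | j != i) f j v)) /\
    intR (cut 0 (T - t) (fun v => \sum_(j <- l | j != i) f j v))
    = \sum_(j <- l | j != i) intR (cut 0 (T - t) (f j)).
  elim: l => [|j l [IH1 IH2]].
    rewrite (_ : (fun v => _) = fun=> 0); last by apply/funext => v; rewrite big_nil.
    by rewrite big_nil; split; [exact: intgR_cst_cut|rewrite intR_cst_cut// mul0r].
  have [ji|ji] := boolP (j != i); last first.
    rewrite (_ : (fun v => _) = (fun v => \sum_(j <- l | j != i) f j v)).
      by rewrite big_cons (negbTE ji).
    by apply/funext => v; rewrite big_cons (negbTE ji).
  rewrite (_ : cut _ _ _ = fun v => cut 0 (T - t) (f j) v
     + cut 0 (T - t) (fun v => \sum_(j <- l | j != i) f j v) v); last first.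
    by apply/funext => v; rewrite /cut; case: ifP => _; rewrite ?addr0// big_cons ji.
  by rewrite big_cons ji -IH2; split; [exact: intgRD|exact: intRD].
have [i1 i2] := sumI (index_enum 'I_k).
rewrite intR_cut_itv; last first.
  apply: (eq_measurable_fun (fun v => \sum_(j < k | j != i) f j v)).
    by move=> v; rewrite inE/= in_itv/= => vt; rewrite E.
  apply/measurable_EFinP.
  by have /integrableP[] := (intgR_cut _ _ _).1 i1.
rewrite /vop -[RHS]i2; congr intR; apply/funext => v; rewrite /cut.
by case: ifP => // vt; rewrite E.
Qed.

Variables (Phi psi : 'I_k -> R -> R -> R) (D C : R).
Hypotheses (D_ge0 : 0 <= D) (C_ge0 : 0 <= C)
  (PhiR : forall i, regular L D 0 (Phi i)) (psiS : forall i, singular L C 0 (psi i))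
  (PhiE : forall i t z, 0 <= t < L -> Phi i t z = S 0 i 0 t z + vp Phi i 0 t z)
  (Phi0 : forall i t z, t <= 0 -> Phi i t z = payoff K z)
  (Phi_ge0 : forall i t z, t < L -> 0 <= Phi i t z)
  (dPhi : forall i (t z : R), 0 < t < L -> is_derive t 1 (Phi i ^~ z) (psi i t z)).
Let e0 : 0 <= (0 : R) := lexx 0.
Let hb : bdd 1 0 (payoff K). Proof. exact: payoff_bdd. Qed.
Let hc : continuous (payoff K). Proof. exact: payoff_cont. Qed.
Let clam i j : continuous (lam_ext lam i j). Proof. exact: lam_ext_cont. Qed.
Let cLam i : continuous (cum_ext lam i). Proof. exact: cum_ext_cont. Qed.
Let cell i : continuous (tot lam i). Proof. exact: tot_cont. Qed.
Let dLam i (y : R) : -1 < y -> is_derive y 1 (cum_ext lam i) (tot lam i y).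
Proof. exact: cum_ext_derive. Qed.
Let Phi00 i : Phi i 0 = payoff K. Proof. by apply/funext => z; exact: Phi0. Qed.

Local Notation V := (value r sigma (payoff K) (lam_ext lam) (cum_ext lam) Phi).

Definition price (t s : R) (i : 'I_k) (y : R) : R := V 0 i y (T - t) (ln s).

Lemma priceE t s i y : price t s i y = S 0 i y (T - t) (ln s) + vp Phi i y (T - t) (ln s).
Proof. by []. Qed.

Lemma value_growth : exists2 Q, 0 <= Q & forall i y t z, 0 <= y <= T -> 0 <= t <= T ->
  `|V 0 i y t z| <= Q * expR z.
Proof.
apply: (@fin_bound R _ (fun i Q => forall y t z, 0 <= y <= T -> 0 <= t <= T -> `|V 0 i y t z| <= Q * expR z)).
  move=> i a b ab H y t z yT tT; apply: (le_trans (H y t z yT tT)).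
  by rewrite ler_wpM2r// expR_ge0.
move=> i.
have [Q Q0 HQ] := cont_at_bound T_gt0 (ltW L_gt0) (@cdisc _ _ r _ cLam i).
have [Q' Q'0 HQ'] : exists2 Q', 0 <= Q' & forall j y t z, 0 <= y <= T -> 0 <= t <= T ->
    `|jop (m i) (sigma i) 0 (kj i j) (Phi j) y t z| <= Q' * expR z.
  apply: (@fin_bound R _ (fun j Q => forall y t z, 0 <= y <= T -> 0 <= t <= T ->
    `|jop (m i) (sigma i) 0 (kj i j) (Phi j) y t z| <= Q * expR z)).
    move=> j a b ab H y t z yT tT; apply: (le_trans (H y t z yT tT)).
    by rewrite ler_wpM2r// expR_ge0.
  move=> j; have [q q0 hq] := cont_at_bound T_gt0 (ltW L_gt0) (@ckj i j).
  have c0 : 0 <= q * D * hcst2 (m i) (sigma i) L.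
    by apply: mulr_ge0; [exact: mulr_ge0|exact: hcst2_ge0].
  have s0 : 0 <= 2 * Num.sqrt L by rewrite mulr_ge0// sqrtr_ge0.
  exists (q * D * hcst2 (m i) (sigma i) L * (2 * Num.sqrt L)); first exact: mulr_ge0.
  move=> y t z yT /andP[t0 tT]; have [t0'|t0'] := leP t 0.
    by rewrite jop_le0// normr0; apply: mulr_ge0; [exact: mulr_ge0|exact: expR_ge0].
  have tL : 0 < t < L by rewrite t0' (le_lt_trans tT).
  have [_ le] := @jop_regular_le _ (m i) (sigma i) L (sigma_gt0 i) 0 (kj i j) (Phi j) D 0 y t z q
    isT D_ge0 e0 (@ckj i j) (PhiR j) tL q0 (fun v vL => hq y v yT vL).
  apply: (le_trans le); rewrite /wt add0r -mulrA (mulrC (expR z)) mulrA.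
  apply: ler_wpM2r; first exact: expR_ge0.
  apply: ler_wpM2l => //; apply: ler_wpM2l => //.
  by rewrite ler_wsqrtr// ltW// (le_lt_trans tT).
exists (Q * hcst (m i) (sigma i) L + \sum_(j < k | j != i) Q').
  apply: addr_ge0; last by apply: sumr_ge0.
  by apply: mulr_ge0 => //; exact: hcst_ge0.
move=> y t z yT tT; rewrite /value mulrDl.
have [t0 tT'] := andP tT; have tL : t <= L by rewrite (le_trans tT')// ltW.
apply: (le_trans (ler_normD _ _)); apply: lerD.
  rewrite /src normrM -mulrA; apply: ler_pM => //; first by apply: HQ; rewrite // t0.
  have := hflow0_le (m i) (sigma_gt0 i) z ler01 e0 (mh hc) hb t0 tL.
  by rewrite mul1r /wt add0r.
rewrite mulr_suml; apply: (le_trans (ler_norm_sum _ _ _)).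
by apply: ler_sum => j _; exact: HQ'.
Qed.

Let T_t t : 0 <= t <= T -> 0 <= T - t <= T.
Proof. by move=> /andP[t0 tT]; rewrite subr_ge0 tT gerBl. Qed.

Lemma price_growth : exists2 Q, 0 <= Q & forall t s i y, cdom T (t, s, y) ->
  `|price t s i y| <= Q * s.
Proof.
have [Q Q0 HQ] := value_growth; exists Q => // t s i y [tT s0 /andP[y0 yt]].
have yT : 0 <= y <= T by rewrite y0 (le_trans yt)//; case/andP: tT.
by have := HQ i y (T - t) (ln s) yT (T_t tT); rewrite lnK.
Qed.

Lemma ln_cont (X : topologicalType) (p : X) (f : X -> R) : 0 < f p ->
  {for p, continuous f} -> {for p, continuous (fun x => ln (f x))}.
Proof.
move=> f0 cf; have cln : {for f p, continuous (@ln R)} by exact: (der_cont (is_derive1_ln f0)).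
exact: (@continuous_comp _ _ _ f (@ln R) p cf cln).
Qed.

Section paths.
Variable p : R * R * R.
Let cY : {for p, continuous (fun q : R * R * R => q.2)}. Proof. exact: cvg_snd. Qed.
Let cq : {for p, continuous (fun q : R * R * R => q.1)}. Proof. exact: cvg_fst. Qed.
Lemma cont_clock : {for p, continuous (fun q : R * R * R => T - q.1.1)}.
Proof.
have c1 : {for p, continuous (fun q : R * R * R => q.1.1)}.
  by apply: (@continuous_comp _ _ _ (fun q : R * R * R => q.1) fst); [exact: cq|exact: cvg_fst].
exact: (cvgB (cvg_cst _) c1).
Qed.
Lemma cont_spot : {for p, continuous (fun q : R * R * R => q.1.2)}.
Proof.
by apply: (@continuous_comp _ _ _ (fun q : R * R * R => q.1) snd); [exact: cq|exact: cvg_snd].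
Qed.
End paths.

Lemma price_in_B : in_B T price.
Proof.
have [Q Q0 HQ] := price_growth; split.
- move=> i; apply: (continuous_in_subspaceT (f := fun q : R * R * R => price q.1.1 q.1.2 i q.2)).
  move=> [[t s] y]; rewrite inE => -[/andP[t0 tT] s0 _].
  have tL : T - t < L by rewrite (le_lt_trans _ T_ltL)// gerBl.
  have cl : {for (t, s, y), continuous (fun q : R * R * R => ln q.1.2)}.
    exact: (ln_cont s0 (cont_spot (p := (t, s, y)))).
  exact: (@value_cvg _ _ r sigma L (payoff K) (lam_ext lam) (cum_ext lam) sigma_gt0 L_gt0 hc hb clam cLam
    Phi D D_ge0 PhiR _ (t, s, y) snd (fun q => T - q.1.1) (fun q => ln q.1.2) cvg_snd (cont_clock (p := (t, s, y))) cl 0 i isT (or_introl erefl) tL).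
- move=> t i y tT yt; apply/cvgrPdist_lt => e e0'.
  have q0 : 0 < Q + 1 by rewrite ltr_wpDl.
  near=> s; rewrite sub0r normrN.
  have s0 : 0 < s by near: s; exact: nbhs_right_gt.
  apply: (le_lt_trans (HQ t s i y _)) => //.
  apply: (@le_lt_trans _ _ (s * (Q + 1))).
    by rewrite mulrC ler_wpM2l ?(ltW s0)// lerDl.
  rewrite -ltr_pdivlMr//; near: s; apply: nbhs_right_lt.
  by rewrite divr_gt0.
- apply: (@le_lt_trans _ _ Q%:E); last exact: ltry.
  apply: ge_ereal_sup => _ [t [s [i [y [[/andP[t0 tT] s0 /andP[y0 yT] yt] ->]]]]].
  have s1 : 0 < 1 + s by rewrite addr_gt0.
  rewrite lee_fin normrM normfV (gtr0_norm s1) ler_pdivrMr//.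
  apply: (le_trans (HQ t s i y _)).
    by split; rewrite // ?ltW// (ltW t0) ltW.
  by apply: ler_wpM2l => //; rewrite lerDr.
Unshelve. all: end_near. Qed.

Lemma newborn_price j t z : 0 <= t <= T -> newborn T price j t z = Phi j t z.
Proof.
move=> tT; have [t0 tT'] := andP tT.
rewrite /newborn /price to_goE// subKr expRK PhiE//.
by rewrite t0 (le_lt_trans tT').
Qed.

Lemma price_solves : solves_problem T r sigma lam eta price.
Proof.
split; last by have [] := price_in_B.
move=> t s i y d; have [/andP[t0 tT] _ _] := d.
suff E : vp (newborn T price) i y (T - t) (ln s) = vp Phi i y (T - t) (ln s).
  by rewrite priceE -E; apply: esym; exact: (price_operatorE i price_in_B d).
apply: eq_vop => j u x /andP[u0 ut]; rewrite newborn_price//.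
by rewrite (ltW u0)/= (le_trans (ltW ut))// gerBl.
Qed.

(** At age 0 both functions solve the same Volterra equation, so they agree there. The right-hand
    side of the pricing equation involves values at age 0 only, which settles all other ages. *)
Lemma price_unique phi : in_B T phi -> solves_problem T r sigma lam eta phi ->
  forall t s i y, cdom T (t, s, y) -> phi t s i y = price t s i y.
Proof.
move=> phiB phiS; have [phiE _] := phiS.
have [D1 D10 S1] := newborn_singular T_gt0 L_gt0 phiB.
have [D2 D20 S2] := newborn_singular T_gt0 L_gt0 price_in_B.
have S1' j : singular L (D1 + D2) 1 (newborn T phi j) by apply: singular_le (S1 j); rewrite ?lerDl.
have S2' j : singular L (D1 + D2) 1 (newborn T price j) by apply: singular_le (S2 j); rewrite ?lerDr.
have E f : in_B T f -> solves_problem T r sigma lam eta f -> forall i t z, 0 < t <= T ->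
    newborn T f i t z - vp (newborn T f) i 0 t z = S 0 i 0 t z.
  move=> fB [fE _] i t z /andP[t0 tT].
  have tT' : 0 <= t <= T by rewrite ltW.
  have d : cdom T (T - t, expR z, 0) by split; rewrite ?expR_gt0 ?T_t// lexx subr_ge0.
  have -> : newborn T f i t z = f (T - t) (expR z) i 0 by rewrite /newborn to_goE.
  by rewrite (fE _ _ _ _ d) (price_operatorE i fB d) subKr expRK addrK.
have U : forall i t z, 0 < t <= T -> newborn T phi i t z = newborn T price i t z.
  apply: (volterra_unique (m := m) sigma_gt0 L_gt0 ckj (addr_ge0 D10 D20) ler01 T_ltL S1' S2').
  by move=> i t z tT; exact: (etrans (E phi phiB phiS i t z tT) (esym (E price price_in_B price_solves i t z tT))).
move=> t s i y d; have [/andP[t0 tT] _ _] := d.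
suff E' : vp (newborn T phi) i y (T - t) (ln s) = vp (newborn T price) i y (T - t) (ln s).
  apply: (etrans (phiE _ _ _ _ d)); apply: (etrans (price_operatorE i phiB d)); rewrite E'.
  by apply: esym; apply: (etrans (proj1 price_solves _ _ _ _ d)); exact: (price_operatorE i price_in_B d).
apply: eq_vop => j u x /andP[u0 ut]; apply: U.
by rewrite u0/= (le_trans (ltW ut))// gerBl.
Qed.

Lemma price_ge0 t s i y : cdom T (t, s, y) -> 0 <= price t s i y.
Proof.
move=> [/andP[t0 tT] _ _]; apply: addr_ge0.
  by apply: mulr_ge0; [exact: disc_ge0|apply: hflow_ge0 => x; exact: payoff_ge0].
apply: sumr_ge0 => j _; apply: intR_ge0 => v; rewrite /cut; case: ifP => // /andP[v0 vt].
apply: mulr_ge0; first by apply: jker_ge0 => *; exact: lam_ext_ge0.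
apply: hflow_ge0 => x; apply: Phi_ge0.
by rewrite ltrBlDr (le_lt_trans _ (ltr_wpDr (ltW v0) T_ltL))// gerBl.
Qed.

(** Outside the closed domain [phi] is arbitrary, so every derivative is transferred from [price]
    through a neighbourhood on which the two coincide. *)
Lemma price_C121 phi : (forall t s i y, cdom T (t, s, y) -> phi t s i y = price t s i y) ->
  C121 T phi.
Proof.
move=> phiE i.
have dc t s y : dom T (t, s, y) -> cdom T (t, s, y).
  by move=> [/andP[t0 tT] s0 /andP[y0 yT] yt]; split; rewrite // ?(ltW t0) ?(ltW tT) ?(ltW y0) ?(ltW yt).
have nt t s y : dom T (t, s, y) -> \forall x \near t, phi x s i y = price x s i y.
  move=> [/andP[t0 tT] s0 /andP[y0 yT] yt]; near=> x; apply: phiE; apply: dc.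
  have yx : y < x by near: x; exact: lt_nbhsr.
  split; rewrite ?y0 ?yT//; apply/andP; split; last by near: x; exact: lt_nbhsl.
  exact: lt_trans yx.
have ns t s y : dom T (t, s, y) -> \forall x \near s, dom T (t, x, y).
  move=> [tT s0 yT yt]; near=> x; split => //.
  by near: x; exact: lt_nbhsr.
have ny t s y : dom T (t, s, y) -> \forall x \near y, phi t s i x = price t s i x.
  move=> [/andP[t0 tT] s0 /andP[y0 yT] yt]; near=> x; apply: phiE; apply: dc.
  have xt : x < t by near: x; exact: lt_nbhsl.
  split; rewrite ?t0 ?tT//; apply/andP; split; last exact: lt_trans xt tT.
  by near: x; exact: lt_nbhsr.
have tau t : 0 < t < T -> 0 < T - t < L.
  by move=> /andP[t0 tT]; rewrite subr_gt0 tT/= (le_lt_trans _ T_ltL)// gerBl ltW.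
have d_t (t s y : R) : dom T (t, s, y) ->
    is_derive t 1 (fun t => phi t s i y) (- value_t r sigma (payoff K) (lam_ext lam) (cum_ext lam) (tot lam) psi i y (T - t) (ln s)).
  move=> d; have [tT s0 /andP[y0 _] _] := d.
  have y1 : -1 < y + (T - t).
    by have [/andP[h _]] := (tau t tT, isT); lra.
  have dv := @value_derive_t _ _ r sigma L (payoff K) (lam_ext lam) (cum_ext lam) (tot lam) sigma_gt0 hc hb clam cLam dLam
    Phi psi D C D_ge0 C_ge0 PhiR psiS Phi00 dPhi i y (T - t) (ln s) y1 (tau t tT).
  have dp : is_derive t 1 (fun t => price t s i y) (- value_t r sigma (payoff K) (lam_ext lam) (cum_ext lam) (tot lam) psi i y (T - t) (ln s)).
    have := @dercomp _ (fun t => T - t) (fun v => V 0 i y v (ln s)) t _ _ dv (derB (derc t T) (derid t)).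
    by move/dereq; apply; rewrite sub0r mulrN1.
  apply: near_eq_is_derive dp; have := nt t s y d.
  by apply: filterS => x.
have d_s (t s y : R) : dom T (t, s, y) ->
    is_derive s 1 (fun s => phi t s i y) (V 1 i y (T - t) (ln s) * s^-1).
  move=> d; have [tT s0 _ _] := d.
  have dv := @value_derive_z _ _ r sigma L (payoff K) (lam_ext lam) (cum_ext lam) sigma_gt0 L_gt0 hc hb clam cLam
    Phi D D_ge0 PhiR 0 i y (T - t) (ln s) isT (tau t tT).
  apply: near_eq_is_derive (@dercomp _ (@ln R) (V 0 i y (T - t)) s _ _ dv (is_derive1_ln s0)).
  by have := ns t s y d; apply: filterS => x /dc h; exact: esym (phiE _ _ _ _ h).
have d_y (t s y : R) : dom T (t, s, y) ->
    is_derive y 1 (phi t s i) (value_y r sigma (payoff K) (lam_ext lam) (cum_ext lam) (tot lam) Phi psi i y (T - t) (ln s)).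
  move=> d; have [tT s0 /andP[y0 _] _] := d; have y1 : -1 < y by lra.
  have dv := @value_derive_y _ _ r sigma L (payoff K) (lam_ext lam) (cum_ext lam) (tot lam) r_ge0 sigma_gt0 L_gt0 clam cLam dLam
    Phi psi D C D_ge0 C_ge0 PhiR psiS Phi00 dPhi i y (T - t) (ln s) y1 (tau t tT).
  apply: near_eq_is_derive dv; have := ny t s y d.
  by apply: filterS => x.
have E_s t s y : dom T (t, s, y) -> derive1 (fun s => phi t s i y) s = V 1 i y (T - t) (ln s) * s^-1.
  by move=> /d_s[_ <-]; rewrite derive1E.
have d_ss (t s y : R) : dom T (t, s, y) ->
    is_derive s 1 (derive1 (fun s => phi t s i y)) ((V 2 i y (T - t) (ln s) - V 1 i y (T - t) (ln s)) * s ^- 2).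
  move=> d; have [tT s0 _ _] := d; have sN : s != 0 by rewrite gt_eqF.
  have dv := @value_derive_z _ _ r sigma L (payoff K) (lam_ext lam) (cum_ext lam) sigma_gt0 L_gt0 hc hb clam cLam
    Phi D D_ge0 PhiR 1 i y (T - t) (ln s) isT (tau t tT).
  have d2 := derM (@dercomp _ (@ln R) (V 1 i y (T - t)) s _ _ dv (is_derive1_ln s0)) (@derV _ id s 1 sN (derid s)).
  have d3 : is_derive s 1 (fun s => V 1 i y (T - t) (ln s) * s^-1) ((V 2 i y (T - t) (ln s) - V 1 i y (T - t) (ln s)) * s ^- 2).
    apply: (dereq d2); move: (V 1 _ _ _ _) (V 2 _ _ _ _) => a b; by field.
  apply: near_eq_is_derive d3.
  by have := ns t s y d; apply: filterS => x h; exact: esym (E_s _ _ _ h).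
have cY p : {for p, continuous (fun q : R * R * R => q.2)} by exact: cvg_snd.
have cs p : 0 < p.1.2 -> {for p, continuous (fun q : R * R * R => q.1.2^-1)}.
  by move=> p0; apply: (cvgV _ (cont_spot (p := p))); rewrite gt_eqF.
have cl (p : R * R * R) : 0 < p.1.2 -> {for p, continuous (fun q : R * R * R => ln q.1.2)}.
  by move=> p0; apply: (@ln_cont _ p (fun q : R * R * R => q.1.2) p0); exact: cont_spot.
have cV n (p : R * R * R) : (n <= 2)%N -> 0 < p.1.1 < T -> 0 < p.1.2 ->
    {for p, continuous (fun q : R * R * R => V n i q.2 (T - q.1.1) (ln q.1.2))}.
  move: p => [[t s] y] n2 tT s0; have [v0 vL] := andP (tau _ tT).
  have H := @value_cvg _ _ r sigma L (payoff K) (lam_ext lam) (cum_ext lam) sigma_gt0 L_gt0 hc hb clam cLam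
    Phi D D_ge0 PhiR _ (t, s, y) (fun q : R * R * R => q.2) (fun q : R * R * R => T - q.1.1) (fun q : R * R * R => ln q.1.2) (cY (t, s, y)) (cont_clock (p := (t, s, y))) (cl (t, s, y) s0) n i n2 (or_intror v0) vL.
  exact: H.
split.
- move=> t s y d; split.
  + by have [] := d_t _ _ _ d.
  + by have [] := d_s _ _ _ d.
  + by have [] := d_ss _ _ _ d.
  + by have [] := d_y _ _ _ d.
- apply: (subspace_eq_continuous (f := fun q : R * R * R =>
    - value_t r sigma (payoff K) (lam_ext lam) (cum_ext lam) (tot lam) psi i q.2 (T - q.1.1) (ln q.1.2))).
    by move=> [[t s] y]; rewrite inE => d; have [_ E] := d_t _ _ _ d; rewrite /from_subspace/= derive1E E.
  apply: continuous_in_subspaceT => -[[t s] y]; rewrite inE => -[tT s0 _ _].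
  have H := (@value_t_cvg _ _ r sigma L (payoff K) (lam_ext lam) (cum_ext lam) (tot lam) sigma_gt0 L_gt0 hc hb clam cLam cell
    psi C C_ge0 psiS _ (t, s, y) (fun q : R * R * R => q.2) (fun q : R * R * R => T - q.1.1) (fun q : R * R * R => ln q.1.2) (cY _) (cont_clock (p := (t, s, y))) (cl (t, s, y) s0) i (tau t tT)).
  exact: (cvgN H).
- apply: (subspace_eq_continuous (f := fun q : R * R * R => V 1 i q.2 (T - q.1.1) (ln q.1.2) * q.1.2^-1)).
    by move=> [[t s] y]; rewrite inE => /E_s.
  apply: continuous_in_subspaceT => -[[t s] y]; rewrite inE => -[tT s0 _ _].
  exact: (cvgM (@cV 1 (t, s, y) isT tT s0) (@cs (t, s, y) s0)).
- apply: (subspace_eq_continuous (f := fun q : R * R * R =>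
    (V 2 i q.2 (T - q.1.1) (ln q.1.2) - V 1 i q.2 (T - q.1.1) (ln q.1.2)) * (q.1.2^-1 * q.1.2^-1))).
    move=> [[t s] y]; rewrite inE => d; have [_ E] := d_ss _ _ _ d.
    by rewrite /from_subspace/= derive1E E -invfM.
  apply: continuous_in_subspaceT => -[[t s] y]; rewrite inE => -[tT s0 _ _].
  exact: (cvgM (cvgB (@cV 2 (t, s, y) isT tT s0) (@cV 1 (t, s, y) isT tT s0)) (cvgM (@cs (t, s, y) s0) (@cs (t, s, y) s0))).
- apply: (subspace_eq_continuous (f := fun q : R * R * R =>
    value_y r sigma (payoff K) (lam_ext lam) (cum_ext lam) (tot lam) Phi psi i q.2 (T - q.1.1) (ln q.1.2))).
    by move=> [[t s] y]; rewrite inE => d; have [_ E] := d_y _ _ _ d; rewrite /from_subspace/= derive1E E.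
  apply: continuous_in_subspaceT => -[[t s] y]; rewrite inE => -[tT s0 _ _].
  have H := (@value_y_cvg _ _ r sigma L (payoff K) (lam_ext lam) (cum_ext lam) (tot lam) sigma_gt0 L_gt0 hc hb clam cLam cell
    Phi psi D C D_ge0 C_ge0 PhiR psiS _ (t, s, y) (fun q : R * R * R => q.2) (fun q : R * R * R => T - q.1.1) (fun q : R * R * R => ln q.1.2) (cY _) (cont_clock (p := (t, s, y))) (cl (t, s, y) s0) i (tau t tT)).
  exact: H.
Unshelve. all: end_near. Qed.

End pricing.

Theorem lemma3p1 (R : realType) (T K : R) (k : nat)
    (r sigma : 'I_k -> R) (lam : rates R k) (eta : 'I_k -> R -> R -> R)
    (T_gt0 : 0 < T) (K_gt0 : 0 < K) (k_gt0 : (0 < k)%N)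
    (r_ge0 : forall i, 0 <= r i) (sigma_gt0 : forall i, 0 < sigma i)
    (cum_rate_pinfty : forall i, cum_rate lam i y @[y --> +oo] --> +oo)
    (irr : irreducible_mx (mean_jump_mx lam))
    (eta_bsm : forall i, bsm_solution T K (r i) (sigma i) (eta i)) :
  [/\ (exists phi : R -> R -> 'I_k -> R -> R,
        [/\ in_B T phi, solves_problem T r sigma lam eta phi &
          forall psi : R -> R -> 'I_k -> R -> R,
            in_B T psi -> solves_problem T r sigma lam eta psi ->
            forall t s i y, cdom T (t, s, y) -> psi t s i y = phi t s i y]),
      (forall phi : R -> R -> 'I_k -> R -> R,
        in_B T phi -> solves_problem T r sigma lam eta phi -> C121 T phi) &
      (forall phi : R -> R -> 'I_k -> R -> R,
        in_B T phi -> solves_problem T r sigma lam eta phi ->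
        forall t s i y, cdom T (t, s, y) -> 0 <= phi t s i y)].
Proof.
have L0 : 0 < T + 1 by rewrite addr_gt0.
have [Phi [D D0 [PhiR PhiE Phi0 Phi_ge0 [psi [C C0 [psiS dPhi]]]]]] :=
  model_solution r sigma_gt0 L0 (@payoff_cont _ K) (@payoff_ge0 _ K) (payoff_bdd K_gt0)
    (payoff_lip K) (@lam_ext_cont _ _ lam) (@lam_ext_ge0 _ _ lam)
    (@cum_ext_cont _ _ lam) (@tot_cont _ _ lam) (@cum_ext_derive _ _ lam).
have solB : in_B T (price T K r sigma lam Phi).
  exact: (price_in_B r lam T_gt0 K_gt0 sigma_gt0 D0 PhiR).
(* Every solution in B coincides with the constructed price, so smoothness and sign need to be known
   for the latter only. *)
have uniq phi : in_B T phi -> solves_problem T r sigma lam eta phi ->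
    forall t s i y, cdom T (t, s, y) -> phi t s i y = price T K r sigma lam Phi t s i y.
  exact: (price_unique T_gt0 K_gt0 r_ge0 sigma_gt0 eta_bsm D0 PhiR PhiE).
split.
- exists (price T K r sigma lam Phi); split => //.
  exact: (price_solves T_gt0 K_gt0 r_ge0 sigma_gt0 eta_bsm D0 PhiR PhiE).
- move=> phi phiB phiS.
  exact: (price_C121 T_gt0 K_gt0 r_ge0 sigma_gt0 D0 C0 PhiR psiS Phi0 dPhi (uniq phi phiB phiS)).
- move=> phi phiB phiS t s i y d; rewrite (uniq phi phiB phiS _ _ _ _ d).
  exact: (@price_ge0 _ _ T K r sigma lam Phi Phi_ge0 t s i y d).
Qed.
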